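(* Let $G\in\mathcal{G}$ (possibly generated by a non-compact family of polynomials). Then all of the following hold. 1. $(\mathcal{J}_G,\leq)$ is totally ordered, where $\leq$ is the surrounding order. 2. Each connected component of $F(G)$ is either simply connected or doubly connected. 3. For any $g\in G$ and any connected component $J$ of $J(G)$, the set $g^{-1}(J)$ is connected. Let $g^{\ast}(J)$ denote the connected component of $J(G)$ containing $g^{-1}(J)$. If $J\in\mathcal{J}_G$, then $g^{\ast}(J)\in\mathcal{J}_G$. If $J_1,J_2\in\mathcal{J}_G$ and $J_1\leq J_2$, then $g^{-1}(J_1)\leq g^{-1}(J_2)$ and $g^{\ast}(J_1)\leq g^{\ast}(J_2)$.
   Context: $\hat{\mathbb{C}}$ is the Riemann sphere. A polynomial semigroup is a semigroup, under composition, generated by a non-empty family of non-constant polynomial maps $\hat{\mathbb{C}}\to\hat{\mathbb{C}}$. The Fatou set $F(G)$ is the set of $z\in\hat{\mathbb{C}}$ having a neighborhood on which $G$ is a normal family; the Julia set is $J(G)=\hat{\mathbb{C}}\setminus F(G)$. $CV(g)$ is the set of critical values of $g:\hat{\mathbb{C}}\to\hat{\mathbb{C}}$, $P(G)=\overline{\bigcup_{g\in G}CV(g)}$ (closure in $\hat{\mathbb{C}}$), and $P^{\ast}(G)=P(G)\setminus\{\infty\}$. $\mathcal{G}$ is the set of all polynomial semigroups $G$ such that each element of $G$ has degree at least two and $P^{\ast}(G)$ is bounded in $\mathbb{C}$. $\mathcal{J}_G$ is the set of all connected components $J$ of $J(G)$ with $J\subset\mathbb{C}$. Surrounding order: for connected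 sets $K_1,K_2\subset\mathbb{C}$, $K_1\leq K_2$ means that $K_1=K_2$ or $K_1$ is included in a bounded component of $\mathbb{C}\setminus K_2$. A domain in $\hat{\mathbb{C}}$ is doubly connected if its complement in $\hat{\mathbb{C}}$ has exactly two connected components. *)

(* Defs.v *)
From HB Require Import structures.
From mathcomp Require Import all_boot all_order all_algebra.
From mathcomp Require Import all_classical all_reals all_analysis.
From mathcomp Require Import complex.
Set Implicit Arguments.
Unset Strict Implicit.
Unset Printing Implicit Defensive.
Import Order.TTheory GRing.Theory Num.Theory.
Import numFieldNormedType.Exports.
Local Open Scope classical_set_scope.
Local Open Scope ring_scope.

(* The complex field R[i], with the topology and the norm of its regular
   module (MathComp-Analysis declares these only for abstract fields). *)
HB.instance Definition _ (R : realType) :=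
  NormedModule.copy R[i] (R[i])^o.

Notation sphere R := (one_point_compactification R[i]).

Definition pt (R : realType) (z : R[i]) : sphere R := Some z.
Definition infty (R : realType) : sphere R := None.
Arguments infty {R}.

(* Chordal metric; it induces the topology of the sphere. *)
Definition chordal (R : realType) (z w : sphere R) : R :=
  let c (x : R[i]) := Num.sqrt (1 + Normc.normc x ^+ 2) in
  match z, w with
  | Some x, Some y => 2 * Normc.normc (x - y) / (c x * c y)
  | Some x, None | None, Some x => 2 / c x
  | None, None => 0
  end.

(* The self-map of the sphere defined by a polynomial; the value at infinity is
   the right one for non-constant polynomials only. *)
Definition polymap (R : realType) (p : {poly R[i]}) (z : sphere R) : sphere R :=
  if z is Some x then pt p.[x] else infty.

(* Non-constant polynomial maps of the sphere are represented by their
   polynomials, and composition of maps by [\Po]. *)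
Inductive semigroup_gen (R : realType) (A : set {poly R[i]}) :
    {poly R[i]} -> Prop :=
  | semigroup_gen_base p : A p -> semigroup_gen A p
  | semigroup_gen_comp p q :
      semigroup_gen A p -> semigroup_gen A q -> semigroup_gen A (p \Po q).

Definition polynomial_semigroup (R : realType) (G : set {poly R[i]}) :=
  exists A : set {poly R[i]},
    [/\ A !=set0, forall p, A p -> (1 < size p)%N & G = semigroup_gen A].

(* The limit h is an arbitrary map to the sphere, so convergence to the
   constant infinity is allowed. *)
Definition normal_on (R : realType) (F : set (sphere R -> sphere R))
    (U : set (sphere R)) :=
  forall f : nat -> sphere R -> sphere R, (forall n, F (f n)) ->
  exists (phi : nat -> nat) (h : sphere R -> sphere R),
    {homo phi : m n / (m < n)%N} /\
    forall K : set (sphere R), compact K -> K `<=` U ->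
    forall e : R, 0 < e ->
    \forall n \near \oo, forall z, K z -> chordal (f (phi n) z) (h z) < e.

Definition Fatou (R : realType) (G : set {poly R[i]}) : set (sphere R) :=
  [set z | exists U, open_nbhs z U /\ normal_on (@polymap R @` G) U].

Definition Julia (R : realType) (G : set {poly R[i]}) : set (sphere R) :=
  ~` Fatou G.

(* At infinity the derivative is taken in the coordinate w = 1/z, in which
   infinity is w = 0 and the map p reads w |-> 1 / p(1/w). *)
Definition critical_point (R : realType) (p : {poly R[i]}) : set (sphere R) :=
  [set z | if z is Some x then root p^`() x
           else is_derive (0 : R[i]) 1
                  (fun w : R[i] => if w == 0 then 0 else (p.[w^-1])^-1) 0].

Definition CV (R : realType) (p : {poly R[i]}) : set (sphere R) :=
  polymap p @` critical_point p.

Definition postcritical (R : realType) (G : set {poly R[i]}) : set (sphere R) :=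
  closure (\bigcup_(p in G) CV p).

(* P^*(G) = P(G) minus infinity, viewed in the plane. *)
Definition planar_postcritical (R : realType) (G : set {poly R[i]}) :
    set R[i] :=
  @pt R @^-1` postcritical G.

Definition class_G (R : realType) (G : set {poly R[i]}) :=
  [/\ polynomial_semigroup G, forall p, G p -> (2 < size p)%N
    & bounded_set (planar_postcritical G)].

Definition components (T : topologicalType) (A : set T) : set (set T) :=
  connected_component A @` A.

Definition planar_components (R : realType) (G : set {poly R[i]}) :
    set (set (sphere R)) :=
  [set J | components (Julia G) J /\ ~ J infty].

(* Surrounding order on connected subsets of the plane, viewed in the sphere;
   D ranges over the components of the complement of K2 in the plane. *)
Definition surround_le (R : realType) (K1 K2 : set (sphere R)) :=
  K1 = K2 \/
  exists D : set R[i], [/\ components (~` (@pt R @^-1` K2)) D,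
    bounded_set D & K1 `<=` @pt R @` D].

Definition path_in (R : realType) (T : topologicalType) (U : set T)
    (x y : T) (c : R -> T) :=
  [/\ {within `[0, 1], continuous c}, forall t, t \in `[0, 1] -> U (c t),
    c 0 = x & c 1 = y].

(* Path-connected, with every loop null-homotopic relative to its base point. *)
Definition simply_connected (R : realType) (T : topologicalType) (U : set T) :=
  (forall x y, U x -> U y -> exists c : R -> T, path_in U x y c) /\
  (forall (x : T) (c : R -> T), path_in U x x c ->
    exists H : R * R -> T,
      [/\ {within `[0, 1] `*` `[0, 1], continuous H},
          forall s t, s \in `[0, 1] -> t \in `[0, 1] -> U (H (s, t)),
          forall t, t \in `[0, 1] -> H (0, t) = c t /\ H (1, t) = x
        & forall s, s \in `[0, 1] -> H (s, 0) = x /\ H (s, 1) = x]).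

Definition doubly_connected (T : topologicalType) (U : set T) :=
  exists K1 K2 : set T, K1 <> K2 /\ components (~` U) = [set K1; K2].

Definition is_pullback (R : realType) (G : set {poly R[i]}) (g : {poly R[i]})
    (J J' : set (sphere R)) :=
  components (Julia G) J' /\ polymap g @^-1` J `<=` J'.

(* The component g^*(J); meaningful when [is_pullback] has a unique solution. *)
Definition pullback (R : realType) (G : set {poly R[i]}) (g : {poly R[i]})
    (J : set (sphere R)) : set (sphere R) :=
  get (is_pullback G g J).

(* Main.v *)
(* Let r bound the finite critical values of all elements of G. For f in G the
   critical values of f lie in |w| < r, so f^-1(|w| = s) is connected for s >= r,
   and by Montel's theorem such level curves, with s arbitrarily large, occur in
   every neighbourhood of a planar component J of J(G), arbitrarily close to any
   given point of J. A finite critical value p0 has |f(p0)| < r for all f in G,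
   so these curves surround p0: hence every planar component J surrounds p0 (or
   contains it), and two disjoint planar components are nested. The same level
   curves, now of f o g, show that g^-1(J) is connected. Nestedness leaves at
   most two components in the complement of a Fatou component U.

   It remains to see that an open connected U in the sphere with connected
   complement is simply connected. After an inversion U lies in the plane, and a
   loop in U is homotopic to a closed walk on a fine square lattice. The faces
   not contained in U are connected through edges not contained in U, because
   the complement of U is connected, and a closed walk is then contracted by
   removing the faces in U one at a time, and finally the remaining edges by a
   winding number count. *)
Require Import Defs.
From mathcomp Require Import all_boot all_order all_algebra.
From mathcomp Require Import all_classical all_reals all_analysis.
From mathcomp Require Import complex ring lra zify.
Set Implicit Arguments.
Unset Strict Implicit.
Unset Printing Implicit Defensive.
Import Order.TTheory GRing.Theory Num.Theory.
Import numFieldNormedType.Exports.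
Local Open Scope classical_set_scope.
Local Open Scope ring_scope.

(** Only polynomials occur, so the function theory is derived from their factorization: the open
    mapping property gives the maximum principle and Schwarz estimates, and reciprocals and roots of
    zero-free polynomials inherit these as uniform limits of polynomials. Montel's theorem enters in
    a weak form, where each member of the family is bounded above by [r2] or below by [r1 > 0] on a
    disc.

    The generators need not form a compact family, so there is no common escape radius. Instead a
    component J is enclosed by a compact set B in the Fatou set. Along a free ultrafilter a sequence
    of the family is, locally on B, bounded or tends to infinity, which leaves a gap of moduli not
    taken on B. A level in that gap, taken near J because the sequence oscillates there, has a
    connected preimage that cannot cross B.

    That this preimage is connected is shown by a continuity argument in the level: a locally
    constant predicate on the curve is extended to larger and larger shells. Surrounding is detected
    by the intermediate value theorem for |f| and by comparing maximal moduli, in place of the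
    Jordan curve theorem. *)

Notation normc := Normc.normc.

(** * The plane and connectedness *)

Section Plane.
Variable R : realType.
Local Notation C := R[i].
Implicit Types (z w : C) (e r : R).

Lemma normcE' z : `|z| = (normc z)%:C%C.
Proof. by []. Qed.

(** The balls of the regular module have radii in [R[i]]; a positive element of [R[i]] is real,
    which allows real radii from here on. *)
Lemma nbhs_normcP z (A : set C) :
  nbhs z A <-> exists e, 0 < e /\ forall y, normc (y - z) < e -> A y.
Proof.
split.
  move=> /nbhs_ballP[e e0 eA].
  have [k ek] : exists k, e = k%:C%C.
    by apply/complex_realP; exact: gtr0_real.
  exists k; split; first by move: e0; rewrite /= ek ltcR.
  move=> y yz; apply: eA; rewrite /ball /= distrC ek.
  by rewrite normcE' ltcR.
move=> [e [e0 eA]]; apply/nbhs_ballP; exists (e%:C%C); first by rewrite /= ltcR.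
move=> y; rewrite /ball /= distrC normcE' ltcR; exact: eA.
Qed.

Lemma normc_ge0 z : 0 <= normc z.
Proof. by case: z => a b; exact: sqrtr_ge0. Qed.

Lemma normc_eq0 z : (normc z == 0) = (z == 0).
Proof.
apply/eqP/eqP => [/Normc.eq0_normc//|->]; exact: Normc.normc0.
Qed.

Lemma normc_gt0 z : (0 < normc z) = (z != 0).
Proof. by rewrite lt_neqAle normc_ge0 andbT eq_sym normc_eq0. Qed.

Lemma normc_dist z w : normc (z - w) = normc (w - z).
Proof. by rewrite -(opprB w) normcN. Qed.

Lemma normc_triangle z y w : normc (z - w) <= normc (z - y) + normc (y - w).
Proof. by apply: le_trans (le_normcD _ _); rewrite addrA subrK. Qed.

Lemma normc_lerB z w : normc z - normc w <= normc (z - w).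
Proof. by rewrite lerBlDr -{1}(subrK w z); exact: le_normcD. Qed.

Lemma normcX z n : normc (z ^+ n) = normc z ^+ n.
Proof.
elim: n => [|n IH]; first by rewrite !expr0 Normc.normc1.
by rewrite !exprS Normc.normcM IH.
Qed.

Lemma normc_real (x : R) : normc (x%:C%C) = `|x|.
Proof. by rewrite /Normc.normc /= expr0n /= addr0 sqrtr_sqr. Qed.

Lemma normcV0 z : normc z^-1 = (normc z)^-1.
Proof. exact: Normc.normcV. Qed.

Lemma Re_le_normc z : `|complex.Re z| <= normc z.
Proof.
case: z => a b /=; rewrite -sqrtr_sqr ler_wsqrtr// lerDl; exact: sqr_ge0.
Qed.

Lemma Im_le_normc z : `|complex.Im z| <= normc z.
Proof.
case: z => a b /=; rewrite -sqrtr_sqr ler_wsqrtr// lerDr; exact: sqr_ge0.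
Qed.

Lemma normc_le_ReIm z : normc z <= `|complex.Re z| + `|complex.Im z|.
Proof.
case: z => a b /=.
rewrite -[leRHS]ger0_norm ?addr_ge0// -sqrtr_sqr ler_wsqrtr//.
rewrite sqrrD !real_normK ?num_real// lerD2r lerDl.
by rewrite mulrn_wge0// mulr_ge0.
Qed.

Lemma continuous_normcP (T : topologicalType) (f : T -> C) (x : T) :
  {for x, continuous f} <->
  forall e, 0 < e -> \forall y \near x, normc (f y - f x) < e.
Proof.
split.
  move=> cf e e0; apply: (cf [set w | normc (w - f x) < e]).
  by apply/nbhs_normcP; exists e; split.
move=> H A /nbhs_normcP[e [e0 eA]]; rewrite /= nbhs_filterE.
have := H e e0; apply: filterS => y; exact: eA.
Qed.

Lemma continuous_plane_realP (f : C -> R) z :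
  (forall e, 0 < e -> exists d, 0 < d /\
    forall y, normc (y - z) < d -> `|f y - f z| < e) -> {for z, continuous f}.
Proof.
move=> H A /nbhs_ballP[e e0 eA].
have [d [d0 dB]] := H e e0.
apply/nbhs_normcP; exists d; split => // y /dB yz.
by apply: eA; rewrite /ball /= distrC.
Qed.

Lemma normc_continuous : continuous (@normc R : C -> R).
Proof.
move=> z; apply: continuous_plane_realP => e e0; exists e; split=> // y yz.
rewrite ltr_norml; have h1 := normc_lerB z y; have h2 := normc_lerB y z.
by rewrite (normc_dist z y) in h1; lra.
Qed.

Lemma Complex_continuous (T : topologicalType) (f g : T -> R) :
  continuous f -> continuous g -> continuous (fun t => Complex (f t) (g t)).
Proof.
move=> cf cg x; apply/continuous_normcP => e e0.
have e2 : 0 < e / 2 by rewrite divr_gt0.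
have /cvgrPdist_lt/(_ _ e2) Hf := cf x.
have /cvgrPdist_lt/(_ _ e2) Hg := cg x.
near=> y.
apply: le_lt_trans (normc_le_ReIm _) _ => /=.
rewrite (splitr e) ltrD// distrC; [near: y; exact: Hf|near: y; exact: Hg].
Unshelve. all: by end_near. Qed.

Lemma real_complex_continuous : continuous (fun x : R => x%:C%C : C).
Proof. by apply: (@Complex_continuous _ id (fun=> 0)) => x; [exact: cvg_id|exact: cvg_cst]. Qed.

Lemma compact_rect (a : R) : compact [set z : C | `|complex.Re z| <= a /\ `|complex.Im z| <= a].
Proof.
have -> : [set z : C | `|complex.Re z| <= a /\ `|complex.Im z| <= a] =
    (fun p : R * R => Complex p.1 p.2) @` (`[- a, a]%classic `*` `[- a, a]%classic).
  apply/seteqP; split=> [[x y] /= [ax ay]|z [[x y] [/= xa ya] <-]].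
    by exists (x, y) => //; split; rewrite /= in_itv /= -ler_norml.
  by move: xa ya; rewrite !in_itv /= -!ler_norml.
apply: continuous_compact; last by apply: compact_setX; exact: segment_compact.
apply: continuous_subspaceT; apply: Complex_continuous => x;
  [exact: cvg_fst|exact: cvg_snd].
Qed.

Lemma compact_bounded_closed (A : set C) (r : R) :
  closed A -> (forall z, A z -> normc z <= r) -> compact A.
Proof.
move=> cA Ar; apply: (subclosed_compact cA (@compact_rect r)) => z /Ar zr.
by split; [exact: le_trans (Re_le_normc z) zr|exact: le_trans (Im_le_normc z) zr].
Qed.

Lemma hausdorff_plane : hausdorff_space C.
Proof. exact: norm_hausdorff. Qed.

Lemma compact_max (A : set C) (f : C -> R) : A !=set0 -> compact A ->
  continuous f -> exists z, A z /\ forall y, A y -> f y <= f z.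
Proof.
move=> A0 cA cf.
have [|z /set_mem Az zM] := compact_EVT_max A0 cA (f := f).
  exact: continuous_subspaceT.
by exists z; split => // y /mem_set /zM.
Qed.

Lemma compact_min (A : set C) (f : C -> R) : A !=set0 -> compact A ->
  continuous f -> exists z, A z /\ forall y, A y -> f z <= f y.
Proof.
move=> A0 cA cf.
have [|z /set_mem Az zM] := compact_EVT_min A0 cA (f := f).
  exact: continuous_subspaceT.
by exists z; split => // y /mem_set /zM.
Qed.

Lemma plane_compact_bounded (A : set C) :
  compact A -> exists r, 0 < r /\ forall z, A z -> normc z < r.
Proof.
move=> cA.
have [->|/set0P A0] := eqVneq A set0; first by exists 1.
have [z [Az zM]] := compact_max A0 cA normc_continuous.
exists (normc z + 1); split; first by rewrite ltr_wpDl// normc_ge0.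
by move=> y /zM yz; rewrite (le_lt_trans yz)// ltrDl.
Qed.

Lemma plane_compact_closed (A : set C) : compact A -> closed A.
Proof. by move=> cA; apply: compact_closed => //; exact: hausdorff_plane. Qed.

Lemma open_normcP (A : set C) :
  open A <-> forall z, A z -> exists e, 0 < e /\ forall y, normc (y - z) < e -> A y.
Proof.
rewrite openE; split => H z Az; first by apply/nbhs_normcP; exact: H.
by apply/nbhs_normcP; exact: H.
Qed.

Lemma open_disc z r : open [set y : C | normc (y - z) < r].
Proof.
apply/open_normcP => y /= yr; exists (r - normc (y - z)).
rewrite subr_gt0; split => // x xy.
by apply: le_lt_trans (normc_triangle x y z) _; rewrite -ltrBrDr.
Qed.

Lemma closed_normc_cond (P : set R) (f : C -> R) : continuous f -> closed P ->
  closed (f @^-1` P).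
Proof. by move=> cf cP; apply: closed_comp => // z _; exact: cf. Qed.

Lemma normc_sub_continuous z : continuous (fun y : C => normc (y - z)).
Proof.
move=> y; apply: continuous_plane_realP => e e0; exists e; split=> // x xy.
apply: le_lt_trans xy.
have h1 := normc_triangle x y z; have h2 := normc_triangle y x z.
by rewrite (normc_dist y x) in h2; rewrite ler_norml; lra.
Qed.

Lemma closed_disc z r : closed [set y : C | normc (y - z) <= r].
Proof.
apply: (@closed_normc_cond [set x | x <= r] (fun y => normc (y - z))).
  exact: normc_sub_continuous.
exact: closed_le.
Qed.

Lemma compact_disc z r : compact [set y : C | normc (y - z) <= r].
Proof.
apply: (@compact_bounded_closed _ (r + normc z)); first exact: closed_disc.
by move=> y /= yz; rewrite -{1}(subrK z y) (le_trans (le_normcD _ _))// lerD2r.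
Qed.

End Plane.

(** * Connectedness through locally constant predicates *)

Section Connected.
Variable T : topologicalType.
Implicit Types (A B P : set T).

(** The truth set of [P] in [A] is relatively open and relatively closed. Nearly every connectedness
    argument below is an instance with a suitable [P], with local constancy required along [A]
    only. *)
Lemma connected_locconst A P : connected A ->
  (forall z, A z -> \forall y \near z, A y -> (P y <-> P z)) ->
  forall x y, A x -> A y -> P x -> P y.
Proof.
move=> cA loc x y Ax Ay Px.
suff E : A `&` P = A by move: Ay; rewrite -E => -[].
apply: cA; first by exists x.
- exists (interior [set y | A y -> P y]); first exact: open_interior.
  apply/seteqP; split=> z [Az].
    by move=> Pz; split=> //; have := loc z Az; apply: filterS => w + Aw => /(_ Aw) [_ /(_ Pz)].
  by move=> /interior_subset/(_ Az).
- exists (~` interior [set y | A y -> ~ P y]).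
    by apply: open_closedC; exact: open_interior.
  apply/seteqP; split=> z [Az].
    by move=> Pz; split=> // /interior_subset/(_ Az).
  move=> nPz; split=> //; apply: contrapT => Pz; apply: nPz.
  by have := loc z Az; apply: filterS => w + Aw => /(_ Aw) [H _] /H.
Qed.

Lemma locconst_connected A :
  (forall P x y, (forall z, A z -> \forall y \near z, A y -> (P y <-> P z)) ->
    A x -> A y -> P x -> P y) -> connected A.
Proof.
move=> H B [x Bx] [U oU BU] [V cV BV].
apply/seteqP; split=> [y|y Ay]; first by rewrite BU => -[].
have Ax : A x by move: Bx; rewrite BU => -[].
apply: (H B x y) => // z Az.
have [Bz|nBz] := pselect (B z).
  have Uz : U z by move: Bz; rewrite BU => -[].
  have : nbhs z U by apply: open_nbhs_nbhs.
  apply: filterS => w Uw Aw; split=> // _; by rewrite BU.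
have Vz : (~` V) z by move=> Vz; apply: nBz; rewrite BV.
have : nbhs z (~` V) by apply: open_nbhs_nbhs; split=> //; exact: closed_openC.
apply: filterS => w Vw Aw; split=> //; by rewrite BV => -[_ /Vw].
Qed.

Lemma near_continuous_lt (R : realType) (f : T -> R) (z : T) (a : R) :
  {for z, continuous f} -> f z < a -> \forall y \near z, f y < a.
Proof. by move=> cf fz; apply: (cvgr_lt (f z)); [exact: cf|]. Qed.

Lemma near_continuous_gt (R : realType) (f : T -> R) (z : T) (a : R) :
  {for z, continuous f} -> a < f z -> \forall y \near z, a < f y.
Proof. by move=> cf fz; apply: (cvgr_gt (f z)); [exact: cf|]. Qed.

Lemma connected_IVT (R : realType) A (f : T -> R) (x y : T) (r : R) :
  connected A -> (forall z, A z -> {for z, continuous f}) -> A x -> A y ->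
  f x < r -> r <= f y -> exists z, A z /\ f z = r.
Proof.
move=> cA cf Ax Ay fx fy; apply: contrapT => H.
suff : f y < r by rewrite ltNge fy.
apply: (@connected_locconst A [set z | f z < r] cA _ x y) => //= z Az.
have [zr|zr|zr] := ltgtP (f z) r.
- have : \forall w \near z, f w < r by apply: (cvgr_lt (f z)); [exact: cf|].
  by apply: filterS => w wr Aw; rewrite wr.
- have : \forall w \near z, r < f w by apply: (cvgr_gt (f z)); [exact: cf|].
  by apply: filterS => w wr Aw; split=> //; rewrite ltNge (ltW wr).
- by case: H; exists z.
Qed.

(** Allows extrema to be taken over one piece of a partition of [A] into relatively clopen
    pieces. *)
Lemma compact_locconst A (Q : set T) : compact A ->
  (forall z, A z -> \forall y \near z, A y -> (Q y <-> Q z)) -> compact (A `&` Q).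
Proof.
move=> cA loc.
have -> : A `&` Q = A `&` ~` (interior [set w | A w -> ~ Q w]).
  apply/seteqP; split=> z [Az Qz]; split=> //.
    by move=> /interior_subset/(_ Az).
  apply: contrapT => nQ; apply: Qz; have := loc z Az.
  by apply: filterS => w + Aw => /(_ Aw) [H _] /H.
by apply: compact_closedI => //; apply: open_closedC; exact: open_interior.
Qed.

Lemma connected_union_star (I : Type) (B : I -> set T) (D : set I) A :
  connected A -> (forall i, D i -> connected (B i)) ->
  (forall i, D i -> A `&` B i !=set0) -> connected (A `|` \bigcup_(i in D) B i).
Proof.
move=> cA cB AB; have [A0|/set0P[x Ax]] := eqVneq A set0.
  rewrite A0 set0U bigcup0; first exact: connected0.
  by move=> i /AB[z []]; rewrite A0.
apply: locconst_connected => P y z loc Hy Hz Py.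
have toA y1 z1 : (A `|` \bigcup_(i in D) B i) y1 -> A z1 -> P y1 <-> P z1.
  move=> Hy1 Az1.
  have AP u v : A u -> A v -> P u -> P v.
    move=> Au Av; apply: (connected_locconst cA) => // w Aw.
    by have := loc w (or_introl Aw); apply: filterS => s + As; apply; left.
  case: Hy1 => [Ay1|[i Di Biy]]; first by split; exact: AP.
  have BP u v : B i u -> B i v -> P u -> P v.
    move=> Bu Bv; apply: (connected_locconst (cB i Di)) => // w Bw.
    have := loc w (or_intror (ex_intro2 _ _ i Di Bw)).
    by apply: filterS => s + Bs; apply; right; exists i.
  have [c [Ac Bc]] := AB i Di.
  by split=> [/(BP y1 c)/(AP c)|/(AP z1 c)/(BP c)]; apply.
by apply/(toA z x Hz Ax); apply/(toA y x Hy Ax).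
Qed.
End Connected.

Lemma connected_image (T U : topologicalType) (f : T -> U) (A : set T) :
  connected A -> continuous f -> connected (f @` A).
Proof.
move=> cA cf; apply: locconst_connected => P _ _ loc [x Ax <-] [y Ay <-].
apply: (@connected_locconst _ A (f @^-1` P)) => // z Az.
have := cf z _ (loc (f z) (ex_intro2 _ _ z Az erefl)).
by rewrite /nbhs /=; apply: filterS => w /= + Aw; apply; exists w.
Qed.

(** * Continuity and connected sets in the plane *)

Section PlaneConnected.
Variable R : realType.
Local Notation C := R[i].
Implicit Types (z w : C) (e r : R).

Lemma plane_continuousD (T : topologicalType) (f g : T -> C) x :
  {for x, continuous f} -> {for x, continuous g} ->
  {for x, continuous (fun t => f t + g t)}.
Proof.
move=> /continuous_normcP cf /continuous_normcP cg; apply/continuous_normcP => e e0.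
have e2 : 0 < e / 2 by rewrite divr_gt0.
apply: filterS2 (cf _ e2) (cg _ e2) => y h1 h2.
rewrite (splitr e) opprD addrACA; apply: le_lt_trans (le_normcD _ _) _; exact: ltrD.
Qed.

Lemma plane_continuousB (T : topologicalType) (f g : T -> C) x :
  {for x, continuous f} -> {for x, continuous g} ->
  {for x, continuous (fun t => f t - g t)}.
Proof.
move=> /continuous_normcP cf /continuous_normcP cg; apply/continuous_normcP => e e0.
have e2 : 0 < e / 2 by rewrite divr_gt0.
apply: filterS2 (cf _ e2) (cg _ e2) => y h1 h2.
rewrite (splitr e).
have -> : f y - g y - (f x - g x) = (f y - f x) - (g y - g x) by ring.
apply: le_lt_trans (le_normcD _ _) _; rewrite normcN; exact: ltrD.
Qed.

Lemma plane_continuousM (T : topologicalType) (f g : T -> C) x :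
  {for x, continuous f} -> {for x, continuous g} ->
  {for x, continuous (fun t => f t * g t)}.
Proof.
move=> /continuous_normcP cf /continuous_normcP cg; apply/continuous_normcP => e e0.
have n0 := normc_ge0 (f x); have n1 := normc_ge0 (g x).
pose d := Num.min 1 (e / (normc (f x) + normc (g x) + 1) / 2).
have d0 : 0 < d by rewrite lt_min ltr01 !divr_gt0// -addrA ltr_wpDl// ltr_wpDl.
have dle : d * (normc (f x) + normc (g x) + 1) <= e / 2.
  rewrite -ler_pdivlMr; last by rewrite -addrA ltr_wpDl// ltr_wpDl.
  by rewrite mulrAC ge_min lexx orbT.
have d1 : d <= 1 by rewrite ge_min lexx.
apply: filterS2 (cf _ d0) (cg _ d0) => y h1 h2.
have -> : f y * g y - f x * g x =
    (f y - f x) * (g y - g x) + ((f y - f x) * g x + f x * (g y - g x)) by ring.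
apply: le_lt_trans (le_normcD _ _) _.
have h3 := le_normcD ((f y - f x) * g x) (f x * (g y - g x)).
rewrite !Normc.normcM in h3 *.
have h4 := normc_ge0 (f y - f x); have h5 := normc_ge0 (g y - g x).
have : normc (f y - f x) * normc (g y - g x) <= d * 1 by apply: ler_pM => //; lra.
have : normc (f y - f x) * normc (g x) <= d * normc (g x) by apply: ler_wpM2r => //; lra.
have : normc (f x) * normc (g y - g x) <= normc (f x) * d by apply: ler_wpM2l => //; lra.
lra.
Qed.

Lemma plane_continuous_cst (T : topologicalType) (c : C) (x : T) :
  {for x, continuous (fun _ : T => c)}.
Proof.
apply/continuous_normcP => e e0.
by apply: nearW => y; rewrite subrr Normc.normc0.
Qed.

Lemma plane_continuous_id (z : C) : {for z, continuous (fun y : C => y)}.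
Proof. by apply/continuous_normcP => e e0; apply/nbhs_normcP; exists e. Qed.

Lemma plane_continuousR (T : topologicalType) (f : T -> R) x :
  {for x, continuous f} -> {for x, continuous (fun t => (f t)%:C%C : C)}.
Proof.
move=> cf; exact: (@continuous_comp _ _ _ f (fun x => x%:C%C) x cf (@real_complex_continuous R _)).
Qed.

Lemma horner_continuous (p : {poly C}) : continuous (fun z : C => p.[z]).
Proof.
elim/poly_ind: p => [|p c IH] z.
  by under eq_fun do rewrite horner0; exact: plane_continuous_cst.
under eq_fun do rewrite hornerMXaddC.
apply: (@plane_continuousD _ (fun z => p.[z] * z) (fun=> c)).
  apply: (@plane_continuousM _ (fun z => p.[z]) (fun z => z)); first exact: IH.
  exact: plane_continuous_id.
exact: plane_continuous_cst.
Qed.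

Definition lin z w (t : R) : C := z + t%:C%C * (w - z).

Lemma lin_continuous z w : continuous (lin z w).
Proof.
move=> t.
have h1 := @plane_continuous_cst _ z t.
have h2 := @plane_continuous_cst _ (w - z) t.
have h3 : {for t, continuous (fun x : R => x%:C%C : C)} by exact: real_complex_continuous.
exact: (plane_continuousD h1 (plane_continuousM h3 h2)).
Qed.

Lemma lin0 z w : lin z w 0 = z. Proof. by rewrite /lin mul0r addr0. Qed.
Lemma lin1 z w : lin z w 1 = w. Proof. by rewrite /lin mul1r addrC subrK. Qed.

Definition segm z w := lin z w @` `[0, 1]%classic.

Lemma connected_segm z w : connected (segm z w).
Proof. by apply: connected_image; [exact: segment_connected|exact: lin_continuous]. Qed.

Lemma compact_segm z w : compact (segm z w).
Proof.
apply: continuous_compact; last exact: segment_compact.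
by apply: continuous_subspaceT; exact: lin_continuous.
Qed.

Lemma segm_l z w : segm z w z.
Proof. by exists 0; [rewrite /= in_itv /= lexx ler01|exact: lin0]. Qed.
Lemma segm_r z w : segm z w w.
Proof. by exists 1; [rewrite /= in_itv /= lexx ler01|exact: lin1]. Qed.

Lemma lin_sub z w c t : lin z w t - c = (1 - t)%:C%C * (z - c) + t%:C%C * (w - c).
Proof. by rewrite /lin rmorphB rmorph1; ring. Qed.

Lemma normc_lin_le z w c t : 0 <= t -> t <= 1 ->
  normc (lin z w t - c) <= (1 - t) * normc (z - c) + t * normc (w - c).
Proof.
move=> t0 t1; rewrite lin_sub; apply: le_trans (le_normcD _ _) _.
by rewrite !Normc.normcM !normc_real !ger0_norm// subr_ge0.
Qed.

Lemma segm_disc z w c r : normc (z - c) < r -> normc (w - c) < r ->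
  forall y, segm z w y -> normc (y - c) < r.
Proof.
move=> zr wr _ [t /= + <-]; rewrite in_itv /= => /andP[t0 t1].
apply: le_lt_trans (normc_lin_le _ _ _ t0 t1) _.
move: (normc (z - c)) (normc (w - c)) zr wr => u v zr wr.
have [t00|tn0] := eqVneq t 0; first by rewrite t00; lra.
have tp : 0 < t by rewrite lt_neqAle eq_sym tn0.
have h1 : 0 < t * (r - v) by rewrite mulr_gt0// subr_gt0.
have h2 : 0 <= (1 - t) * (r - u) by rewrite mulr_ge0 ?subr_ge0// ltW.
lra.
Qed.

Lemma connected_disc z r : connected [set y : C | normc (y - z) < r].
Proof.
have [r0|r0] := leP r 0.
  rewrite (_ : mkset _ = set0); first exact: connected0.
  by apply/seteqP; split=> y //= /lt_le_trans/(_ r0); rewrite ltNge normc_ge0.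
have -> : [set y : C | normc (y - z) < r] =
    [set z] `|` \bigcup_(y in [set y : C | normc (y - z) < r]) segm z y.
  apply/seteqP; split=> [y yr|y [->|[w wr]]].
  - by right; exists y => //; exact: segm_r.
  - by rewrite /= subrr Normc.normc0.
  - by apply: segm_disc => //; rewrite subrr Normc.normc0.
apply: connected_union_star; [exact: connected1|move=> y _; exact: connected_segm|].
by move=> y _; exists z; split => //; exact: segm_l.
Qed.

Lemma connected_circle r : connected [set z : C | normc z = r].
Proof.
have [r0|r0] := ltP r 0.
  rewrite (_ : mkset _ = set0); first exact: connected0.
  by apply/seteqP; split=> y //= yr; move: r0; rewrite -yr ltNge normc_ge0.
pose up (x : R) : C := Complex x (Num.sqrt (r ^+ 2 - x ^+ 2)).
pose dn (x : R) : C := Complex x (- Num.sqrt (r ^+ 2 - x ^+ 2)).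
have csq : continuous (fun x : R => Num.sqrt (r ^+ 2 - x ^+ 2)).
  move=> x.
  have h : {for x, continuous (fun x : R => r ^+ 2 - x ^+ 2)}.
    by apply: continuousB; [exact: cst_continuous|exact: exprn_continuous].
  exact: (continuous_comp h (@sqrt_continuous R _)).
have cup : continuous up by apply: Complex_continuous => //; move=> x; exact: cvg_id.
have cdn : continuous dn.
  by apply: Complex_continuous; move=> x; [exact: cvg_id|apply: cvgN; exact: csq].
have -> : [set z : C | normc z = r] =
    up @` `[-r, r]%classic `|` dn @` `[-r, r]%classic.
  have H x y : - r <= x -> x <= r -> y ^+ 2 = r ^+ 2 - x ^+ 2 ->
      normc (Complex x y) = r.
    by move=> h1 h2 /= ->; rewrite addrC subrK sqrtr_sqr ger0_norm.
  have S x : - r <= x -> x <= r -> 0 <= r ^+ 2 - x ^+ 2 by move=> *; nra.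
  apply/seteqP; split=> [[x y] /= zr|z].
    have zr2 : x ^+ 2 + y ^+ 2 = r ^+ 2.
      by rewrite -zr sqr_sqrtr// addr_ge0// sqr_ge0.
    have xr : - r <= x /\ x <= r.
      by apply/andP; rewrite -ler_norml -zr; exact: (Re_le_normc (Complex x y)).
    have yy : Num.sqrt (r ^+ 2 - x ^+ 2) = `|y|.
      by rewrite -zr2 addrC addKr sqrtr_sqr.
    have [y0|y0] := leP 0 y; [left|right]; exists x;
      rewrite /= ?in_itv /= ?xr.1 ?xr.2 //; rewrite ?/up ?/dn yy.
      by rewrite ger0_norm.
    by rewrite ltr0_norm// opprK.
  by case=> -[x /=]; rewrite in_itv /= => /andP[h1 h2] <-;
    apply: H => //; rewrite ?sqrrN sqr_sqrtr// S.
apply: connectedU.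
- exists (r%:C%C); split; exists r; rewrite /= ?in_itv /= ?lexx ?andbT ?gerN ?ge0_cp//;
    rewrite ?/up ?/dn subrr sqrtr0 ?oppr0 //; lra.
- by apply: connected_image; [exact: segment_connected|exact: cup].
- by apply: connected_image; [exact: segment_connected|exact: cdn].
Qed.

(** The exterior is the circle of radius [r] with radial segments attached, [pr] being the radial
    projection. *)
Lemma connected_exterior r : 0 < r -> connected [set z : C | r <= normc z].
Proof.
move=> r0.
have nz (z : C) : r <= normc z -> normc z != 0 by move=> H; rewrite gt_eqF// (lt_le_trans r0 H).
pose pr (z : C) : C := (r / normc z)%:C%C * z.
have npr z : r <= normc z -> normc (pr z) = r.
  move=> rz; rewrite /pr Normc.normcM normc_real ger0_norm ?divr_ge0 ?normc_ge0// ?ltW//.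
  by rewrite divfK// nz.
have -> : [set z : C | r <= normc z] = [set z | normc z = r] `|`
   \bigcup_(y in [set z | r <= normc z]) segm (pr y) y.
  apply/seteqP; split=> [y yr|y [/= ->//|[w /= wr [t /=]]]].
    by right; exists y => //; exact: segm_r.
  rewrite in_itv /= => /andP[t0 t1] <-.
  have -> : lin (pr w) w t = ((1 - t) * (r / normc w) + t)%:C%C * w.
    by rewrite /lin /pr !(rmorphD, rmorphB, rmorphM, rmorph1); ring.
  have q0 : 0 <= r / normc w by rewrite divr_ge0 ?normc_ge0 ?ltW.
  rewrite Normc.normcM normc_real ger0_norm; last by nra.
  rewrite mulrDl -mulrA divfK ?nz//; by nra.
apply: connected_union_star; first exact: connected_circle.
  by move=> y _; exact: connected_segm.
by move=> y /= yr; exists (pr y); split; [exact: npr|exact: segm_l].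
Qed.
End PlaneConnected.

(** * Polynomial maps of the plane *)

Arguments Normc.normc : simpl never.

Section PolyAnalysis.
Variable R : realType.
Local Notation C := R[i].
Implicit Types (z w a : C) (e r M : R) (p q f : {poly C}).

Lemma normc_prod (I : Type) (s : seq I) (F : I -> C) :
  normc (\prod_(i <- s) F i) = \prod_(i <- s) normc (F i).
Proof. by apply: (big_morph _ (@Normc.normcM R)); exact: Normc.normc1. Qed.

(* Some root of [p - w] is as close to [z0] as the modulus of
   [p.[z0] - w = lead_coef p * \prod (z0 - r_i)] is small. *)
Lemma poly_open_map p z0 e : (1 < size p)%N -> 0 < e ->
  exists d, 0 < d /\
    forall w, normc (w - p.[z0]) < d -> exists z, normc (z - z0) < e /\ p.[z] = w.
Proof.
move=> sp e0; have p0 : lead_coef p != 0.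
  by rewrite lead_coef_eq0 -size_poly_gt0 (leq_trans _ sp).
exists (normc (lead_coef p) * e ^+ (size p).-1); split.
  by rewrite mulr_gt0 ?exprn_gt0 ?normc_gt0.
move=> w wd; set q := p - w%:P.
have sw : (size (- w%:P)%R < size p)%N.
  by rewrite size_polyN (leq_ltn_trans (size_polyC_leq1 _)).
have sq : size q = size p by rewrite /q size_polyDl.
have lq : lead_coef q = lead_coef p by rewrite /q lead_coefDl.
have [rs qE] := closed_field_poly_normal q.
have srs : size rs = (size p).-1.
  rewrite -sq qE size_scale ?lq// size_prod_XsubC//.
have [/hasP[z zrs ze]|/hasPn H] := boolP (has (fun z => normc (z - z0) < e) rs).
  exists z; split => //.
  have : root q z by rewrite qE rootZ ?lq// root_prod_XsubC.
  by rewrite /q rootE hornerD hornerN hornerC subr_eq0 => /eqP.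
move: wd; rewrite ltNge => /negP[].
have -> : normc (w - p.[z0]) = normc q.[z0].
  by rewrite normc_dist /q hornerD hornerN hornerC.
rewrite qE hornerZ lq Normc.normcM horner_prod normc_prod ler_wpM2l ?normc_ge0//.
rewrite -srs; elim: rs {qE srs} H => [|x rs IH] H.
  by rewrite big_nil expr0.
rewrite big_cons exprS hornerXsubC; apply: ler_pM.
- exact: ltW.
- by apply: exprn_ge0; exact: ltW.
- by rewrite normc_dist leNgt; apply: H; rewrite mem_head.
- by rewrite IH// => y ys; apply: H; rewrite in_cons ys orbT.
Qed.

Lemma normc_bump_up z e : 0 < e -> exists w, normc (w - z) < e /\ normc z < normc w.
Proof.
move=> e0; have e2 : 0 < e / 2 by rewrite divr_gt0.
have [->|z0] := eqVneq z 0.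
  exists ((e / 2)%:C%C); rewrite subr0 Normc.normc0 normc_real gtr0_norm//; split; lra.
have nz : 0 < normc z by rewrite normc_gt0.
exists ((1 + e / 2 / normc z)%:C%C * z); split.
  have -> : (1 + e / 2 / normc z)%:C%C * z - z = (e / 2 / normc z)%:C%C * z.
    by rewrite rmorphD rmorph1; ring.
  rewrite Normc.normcM normc_real gtr0_norm ?divr_gt0// divfK ?gt_eqF//; lra.
rewrite Normc.normcM normc_real gtr0_norm; last by rewrite addr_gt0 ?divr_gt0.
by rewrite mulrDl mul1r divfK ?gt_eqF// ltrDl.
Qed.

Lemma normc_bump_down z e : 0 < e -> z != 0 ->
  exists w, normc (w - z) < e /\ normc w < normc z.
Proof.
move=> e0 z0; have nz : 0 < normc z by rewrite normc_gt0.
pose t := Num.min (1 / 2) (e / 2 / normc z).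
have t0 : 0 < t by rewrite lt_min !divr_gt0.
have t1 : t <= 1 / 2 by rewrite ge_min lexx.
have t2 : t * normc z <= e / 2.
  by rewrite -ler_pdivlMr// ge_min lexx orbT.
exists ((1 - t)%:C%C * z); split.
  have -> : (1 - t)%:C%C * z - z = - (t%:C%C * z).
    by rewrite rmorphB rmorph1; ring.
  rewrite normcN Normc.normcM normc_real gtr0_norm//; lra.
rewrite Normc.normcM normc_real gtr0_norm; last lra.
by nra.
Qed.

(** Local maximum principle: the image of a small disc contains a disc about [p.[z]]. The companion
    [poly_local_down] is the minimum principle. *)
Lemma poly_local_up p z e : (1 < size p)%N -> 0 < e ->
  exists w, normc (w - z) < e /\ normc p.[z] < normc p.[w].
Proof.
move=> sp e0; have [d [d0 dP]] := poly_open_map z sp e0.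
have [w [wd wz]] := normc_bump_up p.[z] d0.
by have [y [ye yw]] := dP w wd; exists y; rewrite yw.
Qed.

Lemma poly_local_down p z e : (1 < size p)%N -> 0 < e -> p.[z] != 0 ->
  exists w, normc (w - z) < e /\ normc p.[w] < normc p.[z].
Proof.
move=> sp e0 pz; have [d [d0 dP]] := poly_open_map z sp e0.
have [w [wd wz]] := normc_bump_down d0 pz.
by have [y [ye yw]] := dP w wd; exists y; rewrite yw.
Qed.

Lemma poly_growth p M : (1 < size p)%N ->
  exists r, 0 < r /\ forall z, r <= normc z -> M <= normc p.[z].
Proof.
elim/poly_ind: p M => [|p c IH] M; first by rewrite size_poly0.
have [p0|p0] := eqVneq p 0.
  by rewrite p0 mul0r add0r => /leq_trans/(_ (size_polyC_leq1 _)).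
move=> _.
(* A lower bound for the cofactor of ['X] far out: its modulus if it is a non-zero constant, and 1
   by induction otherwise. *)
have [a [a0 [r [r0 H]]]] : exists a : R, 0 < a /\ exists r, 0 < r /\
    forall z, r <= normc z -> a <= normc p.[z].
  have [s1|s1] := leqP (size p) 1.
    have pE := size1_polyC s1; have p00 : p`_0 != 0 by apply: contraNneq p0 => h; rewrite pE h.
    exists (normc p`_0); split; first by rewrite normc_gt0.
    exists 1; split => // z _; have -> : p.[z] = p`_0 by rewrite {1}pE hornerC.
    exact: lexx.
  by exists 1; split => //; exact: IH.
have nc := normc_ge0 c.
exists (r + (`|M| + normc c) / a); split.
  by rewrite ltr_pwDl// divr_ge0 ?addr_ge0// ltW.
move=> z zr; rewrite hornerMXaddC.
have h1 : r <= normc z by apply: le_trans zr; rewrite lerDl divr_ge0 ?addr_ge0// ltW.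
have h2 : (`|M| + normc c) <= normc z * a.
  by rewrite -ler_pdivrMr//; apply: le_trans zr; rewrite lerDr ltW.
have h3 := normc_lerB (p.[z] * z) (- c).
rewrite opprK normcN Normc.normcM in h3.
have h4 := ler_wpM2r (normc_ge0 z) (H z h1).
have := ler_norm M; lra.
Qed.

(** The cofactor of ['X] is non-constant, hence of modulus at least 3 far out; one of the three
    copies of [|z|] absorbs the constant term. The factor 2 makes orbits escape geometrically. *)
Lemma poly_escape p : (2 < size p)%N ->
  exists r, 0 < r /\ forall z, r <= normc z -> 2 * normc z <= normc p.[z].
Proof.
elim/poly_ind: p => [|p c _]; first by rewrite size_poly0.
have [p0|p0] := eqVneq p 0.
  by rewrite p0 mul0r add0r => /leq_trans/(_ (size_polyC_leq1 _)).
rewrite size_MXaddC (negbTE p0) /= ltnS => sp.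
have [r [r0 rP]] := poly_growth 3 sp.
exists (r + normc c); split; first by rewrite ltr_pwDl// normc_ge0.
move=> z zr; rewrite hornerMXaddC.
have nc := normc_ge0 c.
have h1 : r <= normc z by lra.
have h2 : normc c <= normc z by lra.
have h3 := normc_lerB (p.[z] * z) (- c).
rewrite opprK normcN Normc.normcM in h3.
have h4 := ler_wpM2r (normc_ge0 z) (rP z h1).
lra.
Qed.

Lemma normc_poly_continuous p : continuous (fun z : C => normc p.[z]).
Proof.
move=> z; exact: (continuous_comp (@horner_continuous R p z) (@normc_continuous R p.[z])).
Qed.

(** The maximum over the closed disc is attained, and [poly_local_up] excludes an interior
    maximum. *)
Lemma poly_disc_max p a r M : 0 < r ->
  (forall z, normc (z - a) = r -> normc p.[z] <= M) ->
  forall z, normc (z - a) <= r -> normc p.[z] <= M.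
Proof.
move=> r0 H z zr.
have har : normc (a + r%:C%C - a) = r.
  by rewrite addrC addKr normc_real gtr0_norm.
have [s1|s1] := leqP (size p) 1.
  by have := H _ har; rewrite (size1_polyC s1) !hornerC.
have A0 : [set y | normc (y - a) <= r] !=set0 by exists z.
have [x [xr xM]] := compact_max A0 (@compact_disc _ a r) (@normc_poly_continuous p).
apply: le_trans (xM z zr) _; have := xr; rewrite /= le_eqVlt => /orP[/eqP/H//|xr'].
have rx : 0 < r - normc (x - a) by rewrite subr_gt0.
have [y [yx yM]] := poly_local_up x s1 rx.
have : normc p.[y] <= normc p.[x].
  apply: xM => /=; apply: le_trans (normc_triangle y x a) _; lra.
by rewrite leNgt yM.
Qed.

(** Schwarz lemma: the maximum principle is applied to the quotient of [p - p.[a]] by ['X - a],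
    which is again a polynomial. *)
Lemma poly_schwarz p a r M : 0 < r ->
  (forall z, normc (z - a) <= r -> normc p.[z] <= M) ->
  forall z, normc (z - a) <= r ->
  normc (p.[z] - p.[a]) <= 2 * M / r * normc (z - a).
Proof.
move=> r0 H z zr.
have /factor_theorem[q qE] : root (p - p.[a]%:P) a.
  by rewrite rootE hornerD hornerN hornerC subrr.
have qz x : p.[x] - p.[a] = q.[x] * (x - a).
  by have := congr1 (fun u => u.[x]) qE; rewrite hornerD hornerN hornerC hornerM hornerXsubC.
rewrite qz Normc.normcM ler_wpM2r ?normc_ge0//.
apply: (@poly_disc_max q a r) => // x xr.
have := qz x; move/(congr1 (@normc R)); rewrite Normc.normcM xr => qx.
rewrite ler_pdivlMr// -qx; apply: le_trans (le_normcD _ _) _.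
rewrite normcN mulr_natl mulr2n lerD// H ?xr// ?subrr ?Normc.normc0//; exact: ltW.
Qed.

(** [poly_schwarz] recentred at [y]: the disc of radius [r / 2] about [y] lies in the given disc and
    contains [x]. *)
Lemma poly_lipschitz p a r M : 0 < r ->
  (forall z, normc (z - a) <= r -> normc p.[z] <= M) ->
  forall x y, normc (x - a) <= r / 4 -> normc (y - a) <= r / 4 ->
  normc (p.[x] - p.[y]) <= 4 * M / r * normc (x - y).
Proof.
move=> r0 H x y xr yr.
have -> : 4 * M / r = 2 * M / (r / 2) by field; rewrite gt_eqF.
have h := normc_triangle x a y; rewrite (normc_dist a y) in h.
apply: (@poly_schwarz p y (r / 2)) => //; [lra| |lra].
by move=> z zy; apply: H; apply: le_trans (normc_triangle z y a) _; lra.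
Qed.
End PolyAnalysis.

(** * Uniform limits of polynomials on the unit disc, and Harnack's inequality *)

Section Approximable.
Variable R : realType.
Local Notation C := R[i].
Implicit Types (z w a : C) (e r M k : R) (p q f : {poly C}) (u v : C -> C).

(** Stands in for the functions holomorphic near the closed unit disc: the class is closed under the
    operations required below and inherits the Lipschitz estimate of polynomials. *)
Definition approximable u := forall e, 0 < e ->
  exists p, forall z, normc z <= 1 -> normc (u z - p.[z]) <= e.

Lemma approximable_bounded u : approximable u ->
  exists M, 0 < M /\ forall z, normc z <= 1 -> normc (u z) <= M.
Proof.
move=> /(_ 1 ltr01)[p pu].
have A0 : [set y : C | normc (y - 0) <= 1] !=set0.
  by exists 0; rewrite /= subrr Normc.normc0.
have [x [x1 xM]] := compact_max A0 (@compact_disc _ 0 1) (@normc_poly_continuous _ p).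
exists (1 + normc p.[x]); split; first by rewrite ltr_pwDl// normc_ge0.
move=> z z1; rewrite -(subrK p.[z] (u z)); apply: le_trans (le_normcD _ _) _.
by rewrite lerD ?pu// xM//= subr0.
Qed.

Lemma approximable_lim u :
  (forall e, 0 < e -> exists v, approximable v /\
     forall z, normc z <= 1 -> normc (u z - v z) <= e) -> approximable u.
Proof.
move=> H e e0; have e2 : 0 < e / 2 by rewrite divr_gt0.
have [v [av uv]] := H _ e2; have [p pv] := av _ e2.
exists p => z z1; apply: le_trans (normc_triangle (u z) (v z) p.[z]) _.
by rewrite (splitr e) lerD ?uv ?pv.
Qed.

Lemma approximableD u v : approximable u -> approximable v ->
  approximable (fun z => u z + v z).
Proof.
move=> au av e e0; have e2 : 0 < e / 2 by rewrite divr_gt0.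
have [p pu] := au _ e2; have [q qv] := av _ e2; exists (p + q) => z z1.
rewrite hornerD opprD addrACA; apply: le_trans (le_normcD _ _) _.
by rewrite (splitr e) lerD ?pu ?qv.
Qed.

Lemma approximableM u v : approximable u -> approximable v ->
  approximable (fun z => u z * v z).
Proof.
move=> au av e e0.
have [M [M0 uM]] := approximable_bounded au.
have [N [N0 vN]] := approximable_bounded av.
pose d := Num.min 1 (e / (M + N + 1)).
have s0 : 0 < M + N + 1 by rewrite !addr_gt0.
have d0 : 0 < d by rewrite lt_min ltr01 divr_gt0.
have d1 : d <= 1 by rewrite ge_min lexx.
have d2 : d * (M + N + 1) <= e by rewrite -ler_pdivlMr// ge_min lexx orbT.
have [p pu] := au _ d0; have [q qv] := av _ d0; exists (p * q) => z z1.
have := pu z z1; have := qv z z1; have := uM z z1; have := vN z z1.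
rewrite hornerM.
have -> : u z * v z - p.[z] * q.[z] = (u z - p.[z]) * v z +
    (u z * (v z - q.[z]) - (u z - p.[z]) * (v z - q.[z])) by ring.
set a := u z - p.[z]; set b := v z - q.[z] => h1 h2 h3 h4.
apply: le_trans (le_normcD _ _) _.
have h5 := le_normcD (u z * b) (- (a * b)).
rewrite normcN !Normc.normcM in h5 *.
have na := normc_ge0 a; have nb := normc_ge0 b.
have nu := normc_ge0 (u z); have nv := normc_ge0 (v z).
have : normc a * normc (v z) <= d * N by exact: ler_pM.
have : normc (u z) * normc b <= M * d by exact: ler_pM.
have : normc a * normc b <= d * 1 by apply: ler_pM => //; lra.
lra.
Qed.

Lemma approximable_cst c : approximable (fun=> c).
Proof. by move=> e e0; exists c%:P => z _; rewrite hornerC subrr Normc.normc0 ltW. Qed.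

Lemma approximableX u n : approximable u -> approximable (fun z => u z ^+ n).
Proof.
move=> au; elim: n => [|n IH].
  by under eq_fun do rewrite expr0; exact: approximable_cst.
by under eq_fun do rewrite exprS; exact: approximableM.
Qed.

Lemma approximable_lipschitz u M : approximable u -> 0 <= M ->
  (forall z, normc z <= 1 -> normc (u z) <= M) ->
  forall x y, normc x <= 1 / 4 -> normc y <= 1 / 4 ->
  normc (u x - u y) <= 4 * M * normc (x - y).
Proof.
move=> au M0 uM x y hx hy; apply/ler_addgt0Pr => e e0.
have nxy := normc_ge0 (x - y).
have h0 := normc_triangle x 0 y; rewrite subr0 sub0r normcN in h0.
have e4 : 0 < e / 4 by rewrite divr_gt0.
have [p pu] := au _ e4.
have pM z : normc (z - 0) <= 1 -> normc p.[z] <= M + e / 4.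
  rewrite subr0 => z1; have -> : p.[z] = u z - (u z - p.[z]) by ring.
  by apply: le_trans (le_normcD _ _) _; rewrite normcN lerD ?uM ?pu.
have h1 := poly_lipschitz ltr01 pM (x := x) (y := y).
rewrite !subr0 divr1 in h1; have {}h1 := h1 hx hy.
have -> : u x - u y = (u x - p.[x]) + ((p.[x] - p.[y]) - (u y - p.[y])) by ring.
apply: le_trans (le_normcD _ _) _.
have h2 := le_normcD (p.[x] - p.[y]) (- (u y - p.[y])).
rewrite normcN in h2.
have h3 : normc (u x - p.[x]) <= e / 4 by apply: pu; lra.
have h4 : normc (u y - p.[y]) <= e / 4 by apply: pu; lra.
have : e * normc (x - y) <= e * (1 / 2) by apply: ler_wpM2l; lra.
lra.
Qed.

Lemma expr_cvg0 k M e : 0 <= k -> k < 1 -> 0 < e -> exists n, k ^+ n * M <= e.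
Proof.
move=> k0 k1 e0; have [M0|M0] := leP M 0.
  by exists 0%N; rewrite expr0 mul1r (le_trans M0)// ltW.
have /cvgrPdist_lt/(_ (e / M)) : (fun n => k ^+ n) @ \oo --> (0 : R).
  by apply: cvg_expr; rewrite ger0_norm.
rewrite divr_gt0// => /(_ isT) [n _ /(_ n (leqnn n))].
rewrite /= sub0r normrN ger0_norm ?exprn_ge0// => H.
by exists n; rewrite -ler_pdivlMr// ltW.
Qed.

Lemma one_sub_neq0 w : normc w < 1 -> 1 - w != 0.
Proof. by apply: contraTneq => /subr0_eq <-; rewrite Normc.normc1 ltxx. Qed.

(** Geometric series: the tail after [n] terms is [u ^+ n / (1 - u)], at most [k ^+ n / (1 - k)]. *)
Lemma approximable_inv u k : approximable u -> k < 1 ->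
  (forall z, normc z <= 1 -> normc (u z) <= k) ->
  approximable (fun z => (1 - u z)^-1).
Proof.
move=> au k1 uk.
have k0 : 0 <= k by apply: le_trans (uk 0 _); rewrite ?normc_ge0// Normc.normc0.
apply: approximable_lim => e e0.
have [n kn] := expr_cvg0 (1 - k)^-1 k0 k1 e0.
exists (fun z => \sum_(i < n) u z ^+ i); split.
  elim: {kn} n => [|n IH].
    by under eq_fun do rewrite big_ord0; exact: approximable_cst.
  under eq_fun do rewrite big_ord_recr /=.
  by apply: approximableD => //; exact: approximableX.
move=> z z1; have uz := uk z z1.
have nz : 1 - u z != 0 by apply: one_sub_neq0; lra.
have -> : (1 - u z)^-1 - \sum_(i < n) u z ^+ i = u z ^+ n / (1 - u z).
  have /(congr1 -%R) := subrX1 (u z) n; rewrite opprB -mulNr opprB => E.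
  by apply: (mulfI nz); rewrite mulrBr -E mulfV// mulrCA mulfV// mulr1 opprB addrC subrK.
rewrite Normc.normcM normcX normcV0.
apply: le_trans kn; apply: ler_pM.
- by rewrite exprn_ge0// normc_ge0.
- by rewrite invr_ge0 normc_ge0.
- by rewrite lerXn2r// nnegrE// normc_ge0.
- have k10 : 0 < 1 - k by rewrite subr_gt0.
  rewrite lef_pV2// ?posrE//.
    by have := normc_lerB 1 (u z); rewrite Normc.normc1; lra.
  by rewrite normc_gt0.
Qed.

(* The root of [1 - w] in the right half plane, so that [|1 - s| <= |1 + s|]. *)
Lemma sqrt_near1 w k : 0 <= k -> normc w <= k ^+ 2 ->
  exists s : C, s ^+ 2 = 1 - w /\ normc (1 - s) <= k.
Proof.
move=> k0 wk.
have [s [s2 Res]] : exists s : C, s ^+ 2 = 1 - w /\ 0 <= complex.Re s.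
  have h := sqr_sqrtc (1 - w).
  have [r0|r0] := leP 0 (complex.Re (sqrtc (1 - w))).
    by exists (sqrtc (1 - w)).
  exists (- sqrtc (1 - w)); rewrite sqrrN; split=> //.
  by rewrite raddfN /= oppr_ge0 ltW.
exists s; split=> //.
have h1 : (1 - s) * (1 + s) = w by rewrite -[w](subKr 1) -s2; ring.
have h2 : normc (1 - s) <= normc (1 + s).
  case: s Res {s2 h1} => a b /= a0; rewrite /Normc.normc /= ler_sqrt ?addr_ge0 ?sqr_ge0//.
  by rewrite !add0r sqrrN lerD2r; nra.
rewrite -(@ler_pXn2r _ 2)// ?nnegrE ?normc_ge0//.
apply: le_trans wk; rewrite -h1 Normc.normcM expr2 ler_wpM2l//.
exact: normc_ge0.
Qed.

(** With [v = 1 - s] for the root [s] of [sqrt_near1], the equation reads [v = (u + v ^+ 2) / 2].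
    The iteration [y] of this fixed-point equation starts at 0 and stays in the disc of radius [k].
    There [|v + y| <= 2 k] makes it a contraction of ratio [k], so that the pointwise choice of
    roots is approximable. *)
Lemma approximable_sqrt u k : approximable u -> 0 <= k -> k < 1 ->
  (forall z, normc z <= 1 -> normc (u z) <= k ^+ 2) ->
  exists v, [/\ approximable v, forall z, normc z <= 1 -> normc (v z) <= k &
    forall z, normc z <= 1 -> (1 - v z) ^+ 2 = 1 - u z].
Proof.
move=> au k0 k1 uk.
have /choice[s sP] : forall z, exists y : C, normc z <= 1 ->
    y ^+ 2 = 1 - u z /\ normc (1 - y) <= k.
  move=> z; have [z1|z1] := leP (normc z) 1; last by exists 0.
  by have [y yP] := sqrt_near1 k0 (uk z z1); exists y.
pose v z := 1 - s z.
have vk z : normc z <= 1 -> normc (v z) <= k by move=> /sP[].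
have v2 z : normc z <= 1 -> (1 - v z) ^+ 2 = 1 - u z.
  by move=> /sP[+ _]; rewrite /v subKr.
exists v; split=> //.
pose y := fix y n z := if n is n'.+1 then 2^-1 * (u z + y n' z ^+ 2) else 0 : C.
have ay n : approximable (y n).
  elim: n => [|n IH] /=; first exact: approximable_cst.
  apply: approximableM; first exact: approximable_cst.
  by apply: approximableD => //; exact: approximableX.
have half : normc (2^-1 : C) = 2^-1.
  have -> : (2^-1 : C) = (2^-1 : R)%:C%C by rewrite fmorphV rmorph_nat.
  by rewrite normc_real ger0_norm// invr_ge0.
have kk : k ^+ 2 <= k by rewrite expr2; nra.
have yk n z : normc z <= 1 -> normc (y n z) <= k.
  move=> z1; elim: n => [|n IH] /=; first by rewrite Normc.normc0.
  rewrite Normc.normcM half; have h := le_normcD (u z) (y n z ^+ 2).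
  rewrite normcX in h; have h2 := uk z z1.
  have : normc (y n z) ^+ 2 <= k ^+ 2 by rewrite lerXn2r ?nnegrE ?normc_ge0.
  lra.
have yv n z : normc z <= 1 -> normc (v z - y n z) <= k ^+ n * k.
  move=> z1; elim: n => [|n IH] /=; first by rewrite subr0 expr0 mul1r vk.
  have -> : v z - 2^-1 * (u z + y n z ^+ 2) =
      2^-1 * ((v z + y n z) * (v z - y n z)).
    have -> : u z = 1 - (1 - v z) ^+ 2 by rewrite v2// subKr.
    by field.
  rewrite !Normc.normcM half exprS.
  have h := le_normcD (v z) (y n z).
  have h2 := vk z z1; have h3 := yk n z z1.
  have h4 : normc (v z + y n z) * normc (v z - y n z) <= (2 * k) * (k ^+ n * k).
    by apply: ler_pM => //; rewrite ?normc_ge0//; lra.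
  by rewrite -mulrA; lra.
apply: approximable_lim => e e0.
have [n kn] := expr_cvg0 k k0 k1 e0.
by exists (y n); split=> // z z1; apply: le_trans kn; exact: yv.
Qed.

(** Takes [m] successive square roots of [1 - u] and then an inverse; the bound [k] turns into its
    square root each time and stays below 1. *)
Lemma approximable_root u k m : approximable u -> k < 1 ->
  (forall z, normc z <= 1 -> normc (u z) <= k) ->
  exists v, approximable v /\
    forall z, normc z <= 1 -> v z ^+ (2 ^ m) * (1 - u z) = 1.
Proof.
elim: m u k => [|m IH] u k au k1 uk.
  exists (fun z => (1 - u z)^-1); split; first exact: approximable_inv uk.
  move=> z z1; rewrite expn0 expr1 mulVf//.
  by apply: one_sub_neq0; have := uk z z1; lra.
have k0 : 0 <= k by apply: le_trans (uk 0 _); rewrite ?normc_ge0// Normc.normc0.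
have s1 : Num.sqrt k < 1 by rewrite -[ltRHS]sqrtr1 ltr_sqrt.
have [|v [av vk v2]] := approximable_sqrt au (sqrtr_ge0 k) s1.
  by move=> z z1; rewrite sqr_sqrtr// uk.
have [w [aw wP]] := IH v _ av s1 vk.
exists w; split=> // z z1.
by rewrite -v2// expnS mulnC exprM -exprMn wP// expr1n.
Qed.

(** All roots of [f] have modulus above 1, so each factor is [- r * (1 - r^-1 * z)] with
    [|r^-1 * z|] bounded by [|r|^-1 < 1]. The inverse root is preferred because it is bounded by 1
    as soon as [|f| >= 1]. *)
Lemma poly_root_approximable f m :
  (forall z, normc z <= 1 -> f.[z] != 0) ->
  exists v, approximable v /\ forall z, normc z <= 1 -> v z ^+ (2 ^ m) * f.[z] = 1.
Proof.
move=> f0; have [rs fE] := closed_field_poly_normal f.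
have lf : lead_coef f != 0.
  by apply: contraTneq (f0 0 _) => [l0|]; [rewrite fE l0 scale0r horner0 eqxx|rewrite Normc.normc0].
have rs1 (r : C) : r \in rs -> 1 < normc r.
  move=> rrs; rewrite ltNge; apply/negP => /f0.
  by rewrite fE -rootE rootZ// root_prod_XsubC rrs.
have kroot (c : C) : c != 0 -> exists y : C, y ^+ (2 ^ m) * c = 1.
  move=> c0; exists ((2 ^ m).-root c^-1).
  by rewrite rootCK ?expn_gt0// mulVf.
have [c cE] := kroot _ lf.
suff [v [av vP]] : exists v, approximable v /\ forall z, normc z <= 1 ->
    v z ^+ (2 ^ m) * (\prod_(r <- rs) ('X - r%:P)).[z] = 1.
  exists (fun z => c * v z); split.
    by apply: approximableM => //; exact: approximable_cst.
  move=> z z1; rewrite fE hornerZ exprMn mulrACA cE mul1r; exact: vP.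
elim: rs {fE} rs1 => [|r rs IH] rs1.
  exists (fun=> 1); split; first exact: approximable_cst.
  by move=> z _; rewrite big_nil hornerC expr1n mulr1.
have [|v [av vP]] := IH; first by move=> x xs; apply: rs1; rewrite in_cons xs orbT.
have r1 : 1 < normc r by apply: rs1; rewrite mem_head.
have r0 : r != 0 by rewrite -normc_gt0 (lt_trans ltr01).
have [b bE] : exists b : C, b ^+ (2 ^ m) * (- r) = 1 by apply: kroot; rewrite oppr_eq0.
have [|||w [aw wP]] := @approximable_root (fun z => r^-1 * z) ((normc r)^-1) m.
- apply: approximableM; first exact: approximable_cst.
  by move=> e e0; exists 'X => z _; rewrite hornerX subrr Normc.normc0 ltW.
- by rewrite invf_lt1// (lt_trans ltr01).
- move=> z z1; rewrite Normc.normcM normcV0 -[leRHS]mulr1 ler_wpM2l// invr_ge0.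
  exact: normc_ge0.
exists (fun z => b * w z * v z); split.
  apply: approximableM => //; apply: approximableM => //; exact: approximable_cst.
move=> z z1; rewrite big_cons hornerM hornerXsubC !exprMn.
have -> : z - r = (- r) * (1 - r^-1 * z).
  by rewrite mulNr mulrBr mulr1 mulrA mulfV// mul1r opprB.
by rewrite mulrACA (mulrACA (b ^+ _)) bE wP// vP// !mul1r.
Qed.

Lemma rescale_poly f a r : exists g, forall z, g.[z] = f.[a + r%:C%C * z].
Proof.
exists (f \Po (a%:P + r%:C%C%:P * 'X)) => z.
by rewrite horner_comp hornerD hornerM !hornerC hornerX.
Qed.

Lemma rescaleK a r z : 0 < r -> exists x, [/\ z = a + r%:C%C * x & normc (z - a) = r * normc x].
Proof.
move=> r0; have rn : r%:C%C != 0 :> C by rewrite -normc_gt0 normc_real gtr0_norm.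
exists ((z - a) / r%:C%C); split; first by rewrite mulrC divfK// addrC subrK.
by rewrite Normc.normcM normcV0 normc_real gtr0_norm// mulrC divfK// gt_eqF.
Qed.

(* Harnack: [f^(-1/2^m)] is bounded by 1 hence 4-Lipschitz near the centre. *)
Lemma poly_harnack M : exists N, forall f a r, 0 < r ->
  (forall z, normc (z - a) <= r -> 1 <= normc f.[z]) -> N <= normc f.[a] ->
  forall z, normc (z - a) <= r / 16 -> M <= normc f.[z].
Proof.
have [m mM] : exists m, M <= 2 ^+ (2 ^ m)%N.
  have [m Mm] : exists m : nat, M <= m%:R.
    exists (Num.bound `|M|); apply: le_trans (ler_norm _) (ltW (archi_boundP _)).
    exact: normr_ge0.
  exists m; apply: le_trans Mm _; rewrite -natrX ler_nat.
  by apply: leq_trans (ltnW (ltn_expl m _)) (ltnW (ltn_expl (2 ^ m)%N _)).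
(* This bound at the centre gives [|v 0| <= 1 / 4]. Over a distance of 1/16 the constant 4 adds at
   most 1/4, so [|v| <= 1 / 2] and [|f| >= 2 ^+ (2 ^ m) >= M]. *)
exists (4 ^+ (2 ^ m)%N) => f a r r0 f1 fa z zr.
have [g gE] := rescale_poly f a r.
have g1 y : normc y <= 1 -> 1 <= normc g.[y].
  move=> y1; rewrite gE; apply: f1; rewrite addrC addKr Normc.normcM normc_real gtr0_norm//.
  by rewrite ler_piMr// ltW.
have [|v [av vP]] := @poly_root_approximable g m.
  by move=> y /g1 h; rewrite -normc_gt0 (lt_le_trans ltr01).
have vg y : normc y <= 1 -> normc (v y) ^+ (2 ^ m)%N * normc g.[y] = 1.
  by move=> /vP/(congr1 (@normc R)); rewrite Normc.normcM normcX Normc.normc1.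
have m0 : (0 < 2 ^ m)%N by rewrite expn_gt0.
have v1 y : normc y <= 1 -> normc (v y) <= 1.
  move=> y1; rewrite leNgt; apply/negP => h.
  have := vg y y1; have := g1 y y1.
  have : 1 < normc (v y) ^+ (2 ^ m)%N by rewrite exprn_egt1// gt_eqF.
  by nra.
have n0 : normc (0 : C) = 0 := Normc.normc0 R.
have v0 : normc (v 0) <= 1 / 4.
  rewrite leNgt; apply/negP => h.
  have := vg 0; rewrite n0 ler01 => /(_ isT).
  have g0 : 4 ^+ (2 ^ m)%N <= normc g.[0] by rewrite gE mulr0 addr0.
  have : (1 / 4) ^+ (2 ^ m)%N < normc (v 0) ^+ (2 ^ m)%N.
    by rewrite ltrXn2r// ?gt_eqF//.
  rewrite div1r exprVn => h2.
  have p4 : 0 < 4 ^+ (2 ^ m)%N :> R by rewrite exprn_gt0.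
  have h3 : 1 < normc (v 0) ^+ (2 ^ m)%N * 4 ^+ (2 ^ m)%N.
    by rewrite -ltr_pdivrMr// div1r.
  have h4 : normc (v 0) ^+ (2 ^ m)%N * 4 ^+ (2 ^ m)%N <= normc (v 0) ^+ (2 ^ m)%N * normc g.[0].
    by rewrite ler_wpM2l// exprn_ge0// normc_ge0.
  by lra.
have [x [zE zn]] := rescaleK a z r0.
have x16 : normc x <= 1 / 16.
  have h : normc x * r <= 1 / 16 * r by rewrite mulrC -zn; lra.
  by move: h; rewrite ler_pM2r.
have vx : normc (v x) <= 1 / 2.
  have := approximable_lipschitz av ler01 v1 (x := x) (y := 0).
  rewrite n0 => /(_ _ _) h.
  have {}h : normc (v x - v 0) <= 4 * 1 * normc (x - 0) by apply: h; lra.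
  rewrite subr0 in h; have := normc_lerB (v x) (v 0); lra.
rewrite zE -gE; apply: le_trans mM _.
have x1 : normc x <= 1 by lra.
have h1 := vg x x1.
have h2 : normc (v x) ^+ (2 ^ m)%N <= (1 / 2) ^+ (2 ^ m)%N.
  by rewrite lerXn2r// nnegrE// ?normc_ge0//; lra.
have h3 : 1 <= (1 / 2) ^+ (2 ^ m)%N * normc g.[x].
  by apply: le_trans (ler_wpM2r (normc_ge0 _) h2); rewrite h1.
by move: h3; rewrite div1r exprVn mulrC ler_pdivlMr ?mul1r// exprn_gt0.
Qed.

Lemma poly_inv_lipschitz f a r M : 0 < r -> 0 < M ->
  (forall z, normc (z - a) <= r -> M <= normc f.[z]) ->
  forall x y, normc (x - a) <= r / 4 -> normc (y - a) <= r / 4 ->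
  normc (f.[x]^-1 - f.[y]^-1) <= 4 / M / r * normc (x - y).
Proof.
move=> r0 M0 fM x y xr yr.
have [g gE] := rescale_poly f a r.
have gM z : normc z <= 1 -> M <= normc g.[z].
  move=> y1; rewrite gE; apply: fM; rewrite addrC addKr Normc.normcM normc_real gtr0_norm//.
  by rewrite ler_piMr// ltW.
have g0 z : normc z <= 1 -> g.[z] != 0.
  by move=> /gM h; rewrite -normc_gt0 (lt_le_trans M0).
(* With exponent [2 ^ 0] the function [v] is the reciprocal of [g]. *)
have [v [av vP]] := @poly_root_approximable g 0 g0.
have vE z : normc z <= 1 -> v z = g.[z]^-1.
  move=> z1; have := vP z z1; rewrite expn0 expr1 => h.
  by rewrite -[RHS]mul1r -h mulfK// g0.
have vM z : normc z <= 1 -> normc (v z) <= M^-1.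
  move=> z1; rewrite vE// normcV0 lef_pV2 ?posrE ?gM//.
  by rewrite (lt_le_trans M0 (gM _ _)).
have [x' [xE xn]] := rescaleK a x r0.
have [y' [yE yn]] := rescaleK a y r0.
have nx' : normc x' <= 1 / 4.
  have h : normc x' * r <= 1 / 4 * r by rewrite mulrC -xn; lra.
  by move: h; rewrite ler_pM2r.
have ny' : normc y' <= 1 / 4.
  have h : normc y' * r <= 1 / 4 * r by rewrite mulrC -yn; lra.
  by move: h; rewrite ler_pM2r.
have Mi : 0 <= M^-1 by rewrite invr_ge0 ltW.
have := approximable_lipschitz av Mi vM nx' ny'.
rewrite !vE; [|lra|lra].
rewrite !gE -xE -yE => h; apply: le_trans h _.
have -> : x - y = r%:C%C * (x' - y') by rewrite xE yE; ring.
rewrite Normc.normcM normc_real gtr0_norm// mulrA.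
by rewrite -[4 / M / r * r]mulrA mulVf ?gt_eqF// mulr1.
Qed.
End Approximable.

(** * Connected preimages of circles enclosing all critical values *)

Section CirclePreimage.
Variable R : realType.
Local Notation C := R[i].
Implicit Types (z w a : C) (e r s : R) (p h : {poly C}) (A B P Q : set C).

Lemma plane_separation A B : closed A -> closed B -> A `&` B = set0 ->
  exists U V, [/\ open U, open V, A `<=` U, B `<=` V & U `&` V = set0].
Proof.
move=> cA cB AB.
(* Discs about points of [A] whose doubles miss [B]. If such a disc met one about a point of [B],
   the smaller centre would lie in the double of the larger disc. *)
pose nb (A B : set C) := [set z | exists a e, [/\ A a, 0 < e,
  forall y, normc (y - a) < 2 * e -> ~ B y & normc (z - a) < e]].
have nbo A1 B1 : open (nb A1 B1).
  apply/open_normcP => z [a [e [Aa e0 eB ze]]].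
  exists (e - normc (z - a)); rewrite subr_gt0; split=> // y yz.
  exists a, e; split=> //; apply: le_lt_trans (normc_triangle y z a) _.
  by rewrite -ltrBrDr.
have nbA A1 B1 : closed B1 -> A1 `&` B1 = set0 -> A1 `<=` nb A1 B1.
  move=> cB1 AB1 a Aa; have : (~` B1) a by move=> Ba; have : (A1 `&` B1) a by []; rewrite AB1.
  move: (closed_openC cB1) => /open_normcP/[apply] -[e [e0 eB]].
  exists a, (e / 2); split=> //; first by rewrite divr_gt0.
    by move=> y ye; apply: eB; rewrite mulrC divfK in ye.
  by rewrite subrr Normc.normc0 divr_gt0.
exists (nb A B), (nb B A); split=> //; first exact: nbA.
  by apply: nbA => //; rewrite setIC.
apply/seteqP; split=> // z [[a [e [Aa e0 eB ze]]] [b [e' [Bb e0' eA ze']]]].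
have := normc_triangle a z b; rewrite (normc_dist a z) => h.
have [ee|ee] := leP e e'.
  by apply: (eA a) => //; lra.
by apply: (eB b) => //; rewrite normc_dist; lra.
Qed.

(** Strict differentiability, with two moving points: the descent argument below starts from any
    point near [z], while the derivative stays the one at [z]. *)
Lemma poly_strict_deriv p z e : 0 < e -> exists d, 0 < d /\
  forall x y, normc (x - z) < d -> normc (y - z) < d ->
  normc (p.[x] - p.[y] - p^`().[z] * (x - y)) <= e * normc (x - y).
Proof.
elim/poly_ind: p e => [|p c IH] e e0.
  exists 1; split=> // x y _ _.
  rewrite deriv0 !horner0 mul0r !subr0 Normc.normc0.
  by apply: mulr_ge0; [exact: ltW|exact: normc_ge0].
have nz := normc_ge0 z; have na := normc_ge0 p^`().[z].
pose e1 := e / 3 / (normc z + 1).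
have e10 : 0 < e1 by rewrite !divr_gt0// ltr_wpDl.
have e1z : e1 * (normc z + 1) = e / 3 by rewrite divfK// gt_eqF// ltr_wpDl.
have [d1 [d10 H1]] := IH _ e10.
have e3 : 0 < e / 3 by rewrite divr_gt0.
have := @horner_continuous R p z; move/continuous_normcP/(_ _ e3)/nbhs_normcP.
move=> [d2 [d20 H2]].
pose d3 := e / 3 / (normc p^`().[z] + 1).
have d30 : 0 < d3 by rewrite !divr_gt0// ltr_wpDl.
have d3z : d3 * (normc p^`().[z] + 1) = e / 3 by rewrite divfK// gt_eqF// ltr_wpDl.
exists (Num.min 1 (Num.min d1 (Num.min d2 d3))); split.
  by rewrite !lt_min ltr01 d10 d20 d30.
move=> x y; rewrite !lt_min => /and4P[x1 xd1 xd2 xd3] /and4P[y1 yd1 yd2 yd3].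
rewrite !hornerMXaddC derivD derivC addr0 derivM derivX mulr1 hornerD hornerM hornerX.
have -> : p.[x] * x + c - (p.[y] * y + c) - (p^`().[z] * z + p.[z]) * (x - y) =
  (p.[x] - p.[y] - p^`().[z] * (x - y)) * x +
  (p^`().[z] * (x - z) * (x - y) + (p.[y] - p.[z]) * (x - y)) by ring.
apply: le_trans (le_normcD _ _) _.
have h := le_normcD (p^`().[z] * (x - z) * (x - y)) ((p.[y] - p.[z]) * (x - y)).
rewrite !Normc.normcM in h *.
have nxy := normc_ge0 (x - y).
have hx : normc x <= normc z + 1 by have := normc_lerB x z; lra.
have t1 : normc (p.[x] - p.[y] - p^`().[z] * (x - y)) * normc x <=
    e1 * normc (x - y) * (normc z + 1).
  by apply: ler_pM; rewrite ?normc_ge0//; exact: H1.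
have t2 : normc p^`().[z] * normc (x - z) * normc (x - y) <= (e / 3) * normc (x - y).
  rewrite ler_wpM2r// -d3z mulrC; apply: ler_pM; rewrite ?normc_ge0//; lra.
have t3 : normc (p.[y] - p.[z]) * normc (x - y) <= (e / 3) * normc (x - y).
  by rewrite ler_wpM2r// ltW// H2.
rewrite mulrAC e1z in t1.
lra.
Qed.

(* Near a non-critical point the sublevel set [|h| < |h z|] is locally
   connected at [z]: [- h z / h' z] is a direction of descent. *)
Lemma sublevel_locally_connected h z e : h^`().[z] != 0 -> h.[z] != 0 -> 0 < e ->
  exists d, [/\ 0 < d, d <= e & forall x1 x2, normc (x1 - z) < d -> normc (x2 - z) < d ->
    normc h.[x1] < normc h.[z] -> normc h.[x2] < normc h.[z] ->
    exists L : set C, [/\ connected L, L x1, L x2 &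
      forall y, L y -> normc (y - z) < e /\ normc h.[y] < normc h.[z]]].
Proof.
set a := h^`().[z]; set b := h.[z] => a0 b0 e0.
set s0 := normc b; have s00 : 0 < s0 by rewrite normc_gt0.
pose v := - b / a.
have v0 : 0 < normc v by rewrite normc_gt0 mulf_neq0 ?oppr_eq0 ?invr_eq0.
have av : a * v = - b by rewrite mulrC divfK.
have e1 : 0 < s0 / 8 / normc v by rewrite !divr_gt0.
have [d1 [d10 H1]] := poly_strict_deriv h z e1.
have s8 : 0 < s0 / 8 by rewrite divr_gt0.
have := @horner_continuous R h z; move/continuous_normcP/(_ _ s8)/nbhs_normcP.
move=> [d2 [d20 H2]].
pose d3 := Num.min e (Num.min d1 d2).
have d30 : 0 < d3 by rewrite !lt_min e0 d10.
have d3e : d3 <= e by rewrite ge_min lexx.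
have d31 : d3 <= d1 by rewrite !ge_min lexx !orbT.
have d32 : d3 <= d2 by rewrite !ge_min lexx !orbT.
pose t0 := Num.min 1 (d3 / 2 / normc v).
have t00 : 0 < t0 by rewrite lt_min ltr01 !divr_gt0.
have t01 : t0 <= 1 by rewrite ge_min lexx.
have t0v : t0 * normc v <= d3 / 2 by rewrite -ler_pdivlMr// ge_min lexx orbT.
(* To first order [h.[x + t v]] is [h.[x] - t b], that is [(1 - t) h.[x] + t (h.[x] - b)]. The
   linearization error and the term [t (h.[x] - b)] are at most [t * s0 / 8] each. *)
have desc x t : normc (x - z) < d3 / 2 -> 0 <= t -> t <= t0 ->
    normc (x + t%:C%C * v - z) < d3 /\
    normc h.[x + t%:C%C * v] <= (1 - t) * normc h.[x] + t * (s0 / 4).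
  move=> xz tp tt.
  have ntE : forall w, normc (t%:C%C * w) = t * normc w.
    by move=> w; rewrite Normc.normcM normc_real ger0_norm.
  have ntv : normc (t%:C%C * v) <= t0 * normc v.
    by rewrite ntE ler_wpM2r// ltW.
  have yz : normc (x + t%:C%C * v - z) < d3.
    by rewrite addrAC; apply: le_lt_trans (le_normcD _ _) _; lra.
  split=> //.
  have h1 : normc (h.[x + t%:C%C * v] - h.[x] - a * (x + t%:C%C * v - x)) <=
      s0 / 8 / normc v * normc (x + t%:C%C * v - x) by apply: H1; lra.
  have xx : x + t%:C%C * v - x = t%:C%C * v by rewrite addrC addKr.
  rewrite xx ntE in h1.
  have h2 : s0 / 8 / normc v * (t * normc v) = t * (s0 / 8).
    by rewrite mulrCA divfK// gt_eqF.
  have av' : a * (t%:C%C * v) = t%:C%C * - b by rewrite mulrCA av.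
  rewrite h2 av' in h1.
  have h3 : normc (h.[x] - b) < s0 / 8 by apply: H2; lra.
  have -> : h.[x + t%:C%C * v] = (1 - t)%:C%C * h.[x] + (t%:C%C * (h.[x] - b) +
     (h.[x + t%:C%C * v] - h.[x] - t%:C%C * - b)) by rewrite rmorphB rmorph1; ring.
  apply: le_trans (le_normcD _ _) _.
  have h4 := le_normcD (t%:C%C * (h.[x] - b)) (h.[x + t%:C%C * v] - h.[x] - t%:C%C * - b).
  have n1t : normc ((1 - t)%:C%C * h.[x]) = (1 - t) * normc h.[x].
    by rewrite Normc.normcM normc_real ger0_norm// subr_ge0; lra.
  rewrite ntE in h4; rewrite n1t.
  have h5 : t * normc (h.[x] - b) <= t * (s0 / 8) by rewrite ler_wpM2l// ltW.
  lra.
have st8 : 0 < t0 * s0 / 8 by rewrite divr_gt0// mulr_gt0.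
have := @horner_continuous R h z; move/continuous_normcP/(_ _ st8)/nbhs_normcP.
move=> [d4 [d40 H4]].
pose d := Num.min (d3 / 2) d4.
have d0 : 0 < d by rewrite lt_min d40 divr_gt0.
have dd3 : d <= d3 / 2 by rewrite ge_min lexx.
have dd4 : d <= d4 by rewrite ge_min lexx orbT.
exists d; split=> //; first by lra.
move=> x1 x2 x1z x2z hx1 hx2.
pose y1 := x1 + t0%:C%C * v; pose y2 := x2 + t0%:C%C * v.
(* Both points are pushed down along [v]. The segment from [x1] to [x2] may rise above the level
   [s0], but by at most [t0 * s0 / 8], and the push lowers it by more than that. *)
exists (segm x1 y1 `|` segm y1 y2 `|` segm y2 x2).
have slide x : normc (x - z) < d -> normc h.[x] < s0 -> forall y,
    segm x (x + t0%:C%C * v) y -> normc (y - z) < e /\ normc h.[y] < s0.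
  move=> xz hx _ [u /= + <-]; rewrite in_itv /= => /andP[u0 u1].
  have -> : lin x (x + t0%:C%C * v) u = x + (u * t0)%:C%C * v.
    by rewrite /lin rmorphM; ring.
  have [|||k1 k2] := desc x (u * t0); [lra|by rewrite mulr_ge0// ltW| |].
    by rewrite -[leRHS]mul1r ler_wpM2r// ltW.
  split; first by lra.
  apply: le_lt_trans k2 _.
  have [->|u00] := eqVneq u 0; first by rewrite mul0r; lra.
  have ut : 0 < u * t0 by rewrite mulr_gt0// lt_neqAle eq_sym u00.
  have ut1 : u * t0 <= 1 by rewrite -[leRHS]mul1r ler_pM// ltW.
  have k3 : 0 <= (1 - u * t0) * (s0 - normc h.[x]) by rewrite mulr_ge0 ?subr_ge0// ltW.
  have k4 : 0 < u * t0 * s0 by rewrite mulr_gt0.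
  lra.
split.
- apply: connectedU.
  + exists y2; split; [by right; exact: segm_r|exact: segm_l].
  + apply: connectedU; [|exact: connected_segm|exact: connected_segm].
    exists y1; split; [exact: segm_r|exact: segm_l].
  + exact: connected_segm.
- by left; left; exact: segm_l.
- by right; exact: segm_r.
- move=> y [[|]|].
  + exact: slide.
  + move=> [u /= + <-]; rewrite in_itv /= => /andP[u0 u1].
    have -> : lin y1 y2 u = lin x1 x2 u + t0%:C%C * v by rewrite /lin /y1 /y2; ring.
    have xd : normc (lin x1 x2 u - z) < d.
      by apply: (segm_disc x1z x2z); exists u => //; rewrite /= in_itv /= u0.
    have [|||k1 k2] := desc (lin x1 x2 u) t0; [lra|exact: ltW|exact: lexx|].
    split; first by lra.
    apply: le_lt_trans k2 _.
    have k3 : normc (h.[lin x1 x2 u] - b) < t0 * s0 / 8 by apply: H4; lra.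
    have k4 := normc_lerB h.[lin x1 x2 u] b.
    have k5 : normc h.[lin x1 x2 u] <= s0 + t0 * s0 / 8 by rewrite -/s0 in k4; lra.
    have k6 : 0 <= (1 - t0) * (s0 + t0 * s0 / 8 - normc h.[lin x1 x2 u]).
      by rewrite mulr_ge0 ?subr_ge0.
    have k7 : 0 < t0 * s0 by rewrite mulr_gt0.
    have k8 : 0 < t0 * (t0 * s0) by rewrite mulr_gt0.
    lra.
  + move=> yy; apply: (slide x2 x2z hx2).
    case: yy => u /= + <-; rewrite in_itv /= => /andP[u0 u1].
    exists (1 - u); first by rewrite /= in_itv /= subr_ge0 gerBl u0 u1.
    by rewrite /lin /y2 rmorphB rmorph1; ring.
Qed.

Section Level.
Variables (h : {poly C}) (r : R).
Hypotheses (sh : (1 < size h)%N) (r0 : 0 < r)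
  (crit : forall c, root h^`() c -> normc h.[c] < r).

Let phi z := normc h.[z].
Let cphi : continuous phi. Proof. exact: normc_poly_continuous. Qed.
Let Y s := [set z : C | r <= phi z /\ phi z <= s].
Let locconst A Q := forall z, A z -> \forall y \near z, A y -> (Q y <-> Q z).

Let cY s : compact (Y s).
Proof.
have [N [N0 NP]] := poly_growth (s + 1) sh.
apply: (@compact_bounded_closed _ _ N).
  have -> : Y s = phi @^-1` [set x | r <= x] `&` phi @^-1` [set x | x <= s] by [].
  apply: closedI.
    by apply: closed_normc_cond; [exact: cphi|exact: closed_ge].
  by apply: closed_normc_cond; [exact: cphi|exact: closed_le].
move=> z [_ zs]; have [//|/ltW/NP] := leP (normc z) N.
by rewrite -/(phi z); lra.
Qed.

Let locconstN A Q : locconst A Q -> locconst A (~` Q).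
Proof.
move=> H z Az; have := H z Az; apply: filterS => y + Ay => /(_ Ay) [a b].
by split=> nq q; apply: nq; [exact: b|exact: a].
Qed.

Let locconstS A B Q : A `<=` B -> locconst B Q -> locconst A Q.
Proof. by move=> AB H z /AB/H; apply: filterS => y + /AB; apply. Qed.

(** The minimum of [phi] over a clopen piece of the shell [Y s] lies on the level [r]: above it,
    [poly_local_down] finds a smaller value in the same piece. *)
Let meets_bottom s Q : locconst (Y s) Q -> (exists2 z, Y s z & Q z) ->
  exists2 z, phi z = r & Q z.
Proof.
move=> loc [z0 Yz0 Qz0].
have A0 : (Y s `&` Q) !=set0 by exists z0.
have [z [[[zr zs] Qz] zmin]] := compact_min A0 (compact_locconst (@cY s) loc) cphi.
have [zr'|zr'|zr'] := ltgtP (phi z) r; [by move: zr; rewrite leNgt zr'| |by exists z].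
have /nbhs_normcP[e [e0 eP]] : \forall y \near z, (Y s y -> (Q y <-> Q z)) /\ r < phi y.
  apply: filterI; first exact: loc.
  by apply: near_continuous_gt; [exact: cphi|].
have hz0 : h.[z] != 0 by rewrite -normc_gt0; apply: lt_le_trans zr.
have [w [wz wphi]] := poly_local_down sh e0 hz0.
have [H rw] := eP w wz.
have Yw : Y s w by split; [exact: ltW|apply: le_trans (ltW wphi) zs].
have : phi z <= phi w by apply: zmin; split=> //; apply/H.
by rewrite leNgt wphi.
Qed.

(** With [s] the maximum of [phi] on a large disc, the boundary circle lies in the shell. A clopen
    piece reaches the bottom level, hence the disc, and its maximum over the disc is on the circle
    by [poly_local_up]. Two pieces would thus split the connected circle. *)
Let connected_Y : exists s, r < s /\ connected (Y s).
Proof.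
have [N [N0 NP]] := poly_growth (r + 1) sh.
have A0 : [set z : C | normc (z - 0) <= N] !=set0.
  by exists 0; rewrite /= subrr Normc.normc0 ltW.
have [m [mN mmax]] := compact_max A0 (@compact_disc _ 0 N) cphi.
exists (phi m).
have circ z : normc z = N -> Y (phi m) z.
  move=> zN; split; first by have := NP z; rewrite zN lexx => /(_ isT); rewrite -/(phi z); lra.
  by apply: mmax; rewrite /= subr0 zN.
split.
  have : r + 1 <= phi N%:C%C by apply: NP; rewrite normc_real gtr0_norm.
  have : phi N%:C%C <= phi m by apply: mmax; rewrite /= subr0 normc_real gtr0_norm.
  lra.
have meets Q : locconst (Y (phi m)) Q -> (exists2 z, Y (phi m) z & Q z) ->
    exists2 z, normc z = N & Q z.
  move=> loc ex; have [u ur Qu] := meets_bottom loc ex.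
  have uN : normc u < N.
    by rewrite ltNge; apply/negP => /NP; rewrite -/(phi u) ur; lra.
  have Yu : Y (phi m) u by split; [rewrite ur|apply: mmax; rewrite /= subr0 ltW].
  have B0 : ((Y (phi m) `&` Q) `&` [set z | normc (z - 0) <= N]) !=set0.
    by exists u; split=> //=; rewrite subr0 ltW.
  have cB := compact_closedI (compact_locconst (@cY (phi m)) loc) (@closed_disc _ 0 N).
  have [z [[[Yz Qz] /=]]] := compact_max B0 cB cphi.
  rewrite subr0 le_eqVlt => /orP[/eqP zN _|zN zmax]; first by exists z.
  have /nbhs_normcP[e [e0 eP]] : \forall y \near z,
      (Y (phi m) y -> (Q y <-> Q z)) /\ normc y < N.
    apply: filterI; first exact: loc.
    by apply: near_continuous_lt; [exact: normc_continuous|].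
  have [w [wz wphi]] := poly_local_up z sh e0.
  have [H wN] := eP w wz.
  have Yw : Y (phi m) w.
    split; first by apply: le_trans (ltW wphi); case: Yz.
    by apply: mmax; rewrite /= subr0 ltW.
  have : phi w <= phi z.
    by apply: zmax; split; [split=> //; apply/H|rewrite /= subr0 ltW].
  by rewrite leNgt wphi.
apply: locconst_connected => Q x y loc Yx Yy Qx; apply: contrapT => nQy.
have [c cN Qc] := meets Q loc (ex_intro2 _ _ x Yx Qx).
have [c' c'N Qc'] := meets _ (locconstN loc) (ex_intro2 _ _ y Yy nQy).
apply: Qc'; apply: (connected_locconst (@connected_circle R N) _ cN c'N Qc).
exact: locconstS loc.
Qed.

Let extends P s := exists chi : set C, locconst (Y s) chi /\
  forall z, phi z = r -> (chi z <-> P z).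

(** The set where the two extensions disagree is clopen in the shell, so it would reach the bottom
    level, where they agree. *)
Let extends_unique P s chi1 chi2 : locconst (Y s) chi1 -> locconst (Y s) chi2 ->
  (forall z, phi z = r -> (chi1 z <-> P z)) -> (forall z, phi z = r -> (chi2 z <-> P z)) ->
  forall z, Y s z -> (chi1 z <-> chi2 z).
Proof.
move=> l1 l2 e1 e2 z Yz; apply: contrapT => nz.
have [|w wr] := @meets_bottom s [set z | ~ (chi1 z <-> chi2 z)] _ (ex_intro2 _ _ z Yz nz).
  move=> y Yy; apply: filterS2 (l1 y Yy) (l2 y Yy) => x h1 h2 Yx /=.
  by rewrite (propext (h1 Yx)) (propext (h2 Yx)).
by move=> /=; rewrite (propext (e1 w wr)) (propext (e2 w wr)) => nw; exact: (nw (iff_refl _)).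
Qed.

(** The two compact pieces of [Y s] have disjoint open neighbourhoods, and these still cover a
    slightly thicker shell: otherwise the minimum of [phi] over the uncovered part exceeds [s], and
    any level below it will do. *)
Let extends_right P s : r <= s -> extends P s -> exists s', s < s' /\ extends P s'.
Proof.
move=> rs [chi [loc chiP]].
have c1 := compact_locconst (@cY s) loc.
have c2 := compact_locconst (@cY s) (locconstN loc).
have [|U [V [oU oV AU BV UV]]] := plane_separation (plane_compact_closed c1) (plane_compact_closed c2).
  by apply/seteqP; split=> // z [[_ ?] []].
have [s' [ss' s'P]] : exists s', s < s' /\ Y s' `<=` U `|` V.
  have cK : compact (Y (s + 1) `&` ~` (U `|` V)).
    by apply: compact_closedI => //; apply: open_closedC; exact: openU.
  have [K0|/set0P K0] := eqVneq (Y (s + 1) `&` ~` (U `|` V)) set0.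
    exists (s + 1); split; first by rewrite ltrDl.
    by move=> z Yz; apply: contrapT => nz; have : (Y (s + 1) `&` ~` (U `|` V)) z by []; rewrite K0.
  have [z [[[zr zs] zUV] zmin]] := compact_min K0 cK cphi.
  have sz : s < phi z.
    rewrite ltNge; apply/negP => zs'; apply: zUV.
    by have [cz|cz] := pselect (chi z); [left; apply: AU|right; apply: BV].
  exists ((s + phi z) / 2); split; first by lra.
  move=> y [yr ys]; apply: contrapT => nUV.
  have : phi z <= phi y by apply: zmin; split=> //; split=> //; lra.
  lra.
exists s'; split=> //; exists U; split.
  move=> z Yz; have [Uz|Vz] := s'P z Yz.
    have : nbhs z U by apply: open_nbhs_nbhs.
    by apply: filterS => w Uw _.
  have : nbhs z V by apply: open_nbhs_nbhs.
  apply: filterS => w Vw _.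
  by split=> Uw; exfalso; [have : (U `&` V) w by []|have : (U `&` V) z by []]; rewrite UV.
move=> z zr; rewrite -(propext (chiP z zr)).
have Yz : Y s z by split; rewrite zr.
split=> [Uz|cz]; last exact: AU.
apply: contrapT => nc; have : (U `&` V) z by split=> //; apply: BV.
by rewrite UV.
Qed.

(** The extensions below [s0] fit together by uniqueness. Passing to the level [s0] itself is the
    one place where the hypothesis on critical points enters: the sublevel set is locally connected
    at a non-critical point. *)
Let extends_left P s0 : r < s0 -> (forall s, r <= s -> s < s0 -> extends P s) ->
  extends P s0.
Proof.
move=> rs0 H.
have /choice[chi chiP] : forall s, exists chi : set C, r <= s -> s < s0 ->
    locconst (Y s) chi /\ forall z, phi z = r -> (chi z <-> P z).
  move=> s; have [h1|h1] := leP r s; last by exists setT.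
  have [h2|h2] := ltP s s0; last by exists setT.
  by have [c cP] := H s h1 h2; exists c.
(* A diagonal choice: each point is judged by the extension to its own level. *)
pose psi z := chi (phi z) z.
have psiE s z : r <= phi z -> phi z <= s -> s < s0 -> (psi z <-> chi s z).
  move=> zr zs ss0; have [l1 e1] := chiP _ zr (le_lt_trans zs ss0).
  have [l2 e2] := chiP s (le_trans zr zs) ss0.
  apply: (extends_unique l1 _ e1 e2); last by split.
  by apply: locconstS l2 => y [yr yz]; split=> //; exact: le_trans zs.
have psi_loc : locconst [set z | r <= phi z /\ phi z < s0] psi.
  move=> z [zr zs].
  pose s := (phi z + s0) / 2.
  have [l1 e1] : locconst (Y s) (chi s) /\ forall z, phi z = r -> (chi s z <-> P z).
    by apply: chiP; rewrite /s; lra.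
  have Yz : Y s z by split=> //; rewrite /s; lra.
  have near_s : \forall y \near z, phi y < s.
    by apply: near_continuous_lt; [exact: cphi|rewrite /s; lra].
  apply: filterS2 (l1 z Yz) near_s => y h1 h2 [yr ys].
  rewrite (propext (@psiE s y yr (ltW h2) _)); last by rewrite /s; lra.
  rewrite (propext (@psiE s z zr _ _)); rewrite ?/s; [|lra|lra].
  by apply: h1; split=> //; exact: ltW.
(* On the level [s0] the value is the limit from below; [dconst] shows that nearby points below the
   level all agree. *)
pose chi0 := [set z | if phi z < s0 then psi z else
  forall e, 0 < e -> exists w, [/\ normc (w - z) < e, r <= phi w, phi w < s0 & psi w]].
exists chi0; split; last first.
  move=> z zr; rewrite /chi0 /= zr rs0.
  have [_ e1] := chiP r (lexx _) rs0.
  by rewrite (propext (@psiE r z _ _ rs0)) ?zr// (propext (e1 z zr)).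
move=> z [zr]; rewrite le_eqVlt => /orP[/eqP zs|zs]; last first.
  have near_s : \forall y \near z, phi y < s0.
    by apply: near_continuous_lt; [exact: cphi|].
  apply: filterS2 (psi_loc z (conj zr zs)) near_s => y h1 h2 [yr _].
  by rewrite /chi0 /= h2 zs; apply: h1.
have nr : \forall y \near z, r < phi y.
  by apply: near_continuous_gt; [exact: cphi|rewrite zs].
have [e [e0 eP]] := (nbhs_normcP _ _).1 nr.
have hz0 : h.[z] != 0.
  by rewrite -normc_gt0; apply: (lt_trans r0); move: zs; rewrite /phi => ->.
have hd0 : h^`().[z] != 0.
  apply/negP => /eqP hd; have : root h^`() z by rewrite rootE hd.
  by move/crit; move: zs; rewrite /phi => ->; rewrite ltNge (ltW rs0).
have [d [d0 de dP]] := sublevel_locally_connected hd0 hz0 e0.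
have dconst x1 x2 : normc (x1 - z) < d -> normc (x2 - z) < d ->
    phi x1 < s0 -> phi x2 < s0 -> psi x1 -> psi x2.
  move=> x1d x2d x1s x2s.
  have [||L [cL L1 L2 LP]] := dP x1 x2 x1d x2d; rewrite -/(phi _) -/(phi z) ?zs//.
  apply: (connected_locconst cL) => //.
  apply: locconstS psi_loc => y /LP[ye]; rewrite -/(phi _) -/(phi z) zs => ys.
  by split=> //; apply: ltW; exact: eP.
have chi0E x w : normc (x - z) < d -> Y s0 x -> normc (w - z) < d -> phi w < s0 ->
    (chi0 x <-> psi w).
  move=> xd [xr xs] wd ws; rewrite /chi0 /=.
  case: ifPn => xs0; first by split; exact: dconst.
  have xs' : phi x = s0 by apply/eqP; rewrite eq_le xs leNgt.
  have hx0 : h.[x] != 0.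
    by rewrite -normc_gt0; apply: (lt_trans r0); move: xs'; rewrite /phi => ->.
  split=> [/(_ (d - normc (x - z)))|pw k k0].
    rewrite subr_gt0 => /(_ xd) [y [yx yr ys py]]; apply: dconst py => //.
    by apply: le_lt_trans (normc_triangle y x z) _; rewrite -ltrBrDr.
  have m0 : 0 < Num.min k (d - normc (x - z)) by rewrite lt_min k0 subr_gt0.
  have [y [yx yphi]] := poly_local_down sh m0 hx0.
  move: yx; rewrite lt_min => /andP[yk yd].
  have yzd : normc (y - z) < d.
    by apply: le_lt_trans (normc_triangle y x z) _; rewrite -ltrBrDr.
  have ys : phi y < s0 by rewrite -xs'.
  exists y; split=> //; first by apply: ltW; apply: eP; exact: lt_le_trans de.
  exact: dconst pw.
have [w [wd wphi]] := poly_local_down sh d0 hz0.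
have ws : phi w < s0 by rewrite -zs.
apply/nbhs_normcP; exists d; split=> // y yd Yy.
rewrite (propext (@chi0E y w yd Yy wd ws)) (propext (@chi0E z w _ _ wd ws))//.
  by rewrite subrr Normc.normc0.
by split; rewrite zs// ltW.
Qed.

(** A locally constant [P] on the curve extends to every shell, the supremum of the admissible
    heights being excluded by [extends_left] and [extends_right]. On a connected shell the
    extension, hence [P], is constant. *)
Lemma connected_circle_preimage : connected [set z : C | normc h.[z] = r].
Proof.
apply: locconst_connected => P x y loc xr yr Px; apply: contrapT => nPy.
have Er : extends P r.
  exists P; split=> // z [zr zs].
  have zE : phi z = r by apply/eqP; rewrite eq_le zr zs.
  have := loc z zE; apply: filterS => w H [wr ws]; apply: H.
  by apply/eqP; rewrite eq_le wr ws.
have mono s t : t <= s -> extends P s -> extends P t.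
  move=> ts [chi [l e]]; exists chi; split=> //.
  by apply: locconstS l => z [zr zt]; split=> //; exact: le_trans ts.
have [s [rs cYs]] := connected_Y.
have [chi [l e]] : extends P s; last first.
  suff : chi y by move/(e y yr).
  apply: (connected_locconst cYs l (x := x)); last exact/(e x xr).
    by split; move: xr; rewrite /phi => ->; rewrite // ltW.
  by split; move: yr; rewrite /phi => ->; rewrite // ltW.
apply: contrapT => nEs.
pose T := [set t | extends P t].
have supT : has_sup T.
  split; first by exists r.
  exists s => t Tt; rewrite leNgt; apply/negP => st; apply: nEs; exact: (mono t s (ltW st)).
have rsup : r <= sup T by apply: sup_upper_bound.
have Esup : extends P (sup T).
  have [<-//|rne] := eqVneq r (sup T).
  apply: extends_left; first by rewrite lt_neqAle rne.
  move=> t rt tsup; have [u Tu tu] : exists2 u, T u & t < u.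
    have d0 : 0 < sup T - t by rewrite subr_gt0.
    by have [u Tu] := sup_adherent d0 supT; rewrite subKr; exists u.
  exact: mono (ltW tu) Tu.
have [s' [ss' Es']] := extends_right rsup Esup.
have : s' <= sup T by apply: sup_upper_bound.
by rewrite leNgt ss'.
Qed.
End Level.
End CirclePreimage.

(** * Normal families and the topology of the sphere *)

Section Montel.
Variable R : realType.
Local Notation C := R[i].
Local Notation pt := (@pt R).
Local Notation infty := (@infty R).
Local Notation chordal := (@chordal R).
Implicit Types (z w a : C) (e r s : R) (p f : {poly C}).

(** Ascoli along an ultrafilter: bounded values converge at each point without extracting a diagonal
    subsequence, and the common Lipschitz constant with compactness of [U] makes the convergence
    uniform. *)
Lemma ultra_uniform_limit (F : set_system nat) (U : set C) (psi : nat -> C -> C) (M L : R) :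
  UltraFilter F -> compact U -> 0 <= L ->
  (\forall n \near F, (forall z, U z -> normc (psi n z) <= M) /\
     forall x y, U x -> U y -> normc (psi n x - psi n y) <= L * normc (x - y)) ->
  exists h : C -> C, forall e, 0 < e ->
    \forall n \near F, forall z, U z -> normc (psi n z - h z) < e.
Proof.
move=> UF cU L0 H; have PF : ProperFilter F by exact: ultra_proper.
have /choice[h hP] : forall z, exists w, U z ->
    forall e, 0 < e -> \forall n \near F, normc (psi n z - w) < e.
  move=> z; have [Uz|nUz] := pselect (U z); last by exists 0.
  have FK : ((fun n => psi n z) @ F) [set w : C | normc (w - 0) <= M].
    by apply: filterS H => n [+ _] /=; rewrite subr0; apply.
  have [w [_ clw]] := @compact_disc _ 0 M ((fun n => psi n z) @ F) _ FK.
  exists w => _ e e0.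
  have [//|HF] := in_ultra_setVsetC [set n | normc (psi n z - w) < e] UF.
  have /(_ [set y | ~ normc (y - w) < e]) := clw _ [set y | normc (y - w) < e].
  move=> /(_ HF); case; first by apply/nbhs_normcP; exists e.
  by move=> y [].
exists h => e e0.
have e5 : 0 < e / 5 by rewrite divr_gt0.
have hL x y : U x -> U y -> normc (h x - h y) <= L * normc (x - y).
  move=> Ux Uy; apply/ler_addgt0Pr => k k0.
  have k2 : 0 < k / 2 by rewrite divr_gt0.
  have [n [[[_ Ln] h1] h2]] := @filter_ex _ F _ _
    (@filterI _ F _ _ _ (@filterI _ F _ _ _ H (hP x Ux _ k2)) (hP y Uy _ k2)).
  have -> : h x - h y = (psi n x - psi n y) + ((psi n y - h y) - (psi n x - h x)) by ring.
  apply: le_trans (le_normcD _ _) _; have h3 := le_normcD (psi n y - h y) (- (psi n x - h x)).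
  rewrite normcN in h3; have h4 := Ln x y Ux Uy.
  by simpl in h1, h2; lra.
have := (compact_near_coveringP U).1 cU nat F (fun n z => U z -> normc (psi n z - h z) < e).
suff cov x : U x -> \near x & F, (U x -> normc (psi F x - h x) < e).
  move=> /(_ _ cov); apply: filterS => n Hn z Uz; exact: (Hn z Uz Uz).
move=> Ux; pose d := e / 5 / (L + 1).
have L1 : 0 < L + 1 by rewrite ltr_wpDl.
have d0 : 0 < d by rewrite divr_gt0.
have dL : d * (L + 1) = e / 5 by rewrite divfK// gt_eqF.
exists ([set y | normc (y - x) < d], [set n | ((forall z, U z -> normc (psi n z) <= M) /\
     forall x y, U x -> U y -> normc (psi n x - psi n y) <= L * normc (x - y)) /\ normc (psi n x - h x) < e / 5]).
  split => /=; first by apply/nbhs_normcP; exists d.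
  by apply: filterI => //; exact: hP.
move=> [y n] /= [yx [[_ Ln] h1]] Uy.
have -> : psi n y - h y = (psi n y - psi n x) + ((psi n x - h x) - (h y - h x)) by ring.
apply: le_lt_trans (le_normcD _ _) _; have h3 := le_normcD (psi n x - h x) (- (h y - h x)).
rewrite normcN in h3; have h4 := Ln y x Uy Ux; have h5 := hL y x Uy Ux.
have h6 : L * normc (y - x) <= (L + 1) * d.
  by apply: ler_pM; rewrite ?normc_ge0//; lra.
by rewrite [leRHS]mulrC dL in h6; lra.
Qed.

Lemma free_ultrafilter : exists F : set_system nat, UltraFilter F /\ \oo `<=` F.
Proof. exact: ultraFilterLemma. Qed.

(** Returns from the ultrafilter to the subsequences of [normal_on]: members of a free filter
    contain arbitrarily large indices. *)
Lemma ultra_subsequence (F : set_system nat) (Q : nat -> nat -> Prop) :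
  ProperFilter F -> \oo `<=` F -> (forall k, \forall n \near F, Q k n) ->
  exists phi : nat -> nat, {homo phi : m n / (m < n)%N} /\ forall k, Q k (phi k).
Proof.
move=> PF oF H.
have /choice[c cP] : forall kN : nat * nat, exists n, (kN.2 <= n)%N /\ Q kN.1 n.
  move=> [k N].
  have FN : F [set n | (N <= n)%N] by apply: oF; exists N.
  by have [n [Nn Qn]] := @filter_ex _ F _ _ (@filterI _ F _ _ _ FN (H k)); exists n.
pose phi := fix phi n := if n is n'.+1 then c (n, (phi n').+1) else c (0%N, 0%N).
exists phi; split.
  apply: homo_ltn => [y x z|i]; first exact: ltn_trans.
  by have [] := cP (i.+1, (phi i).+1).
by case=> [|k]; [have [] := cP (0%N, 0%N)|have [] := cP (k.+1, (phi k).+1)].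
Qed.

Lemma homo_ge_id (phi : nat -> nat) : {homo phi : m n / (m < n)%N} -> forall n, (n <= phi n)%N.
Proof. by move=> H; elim=> // n IH; apply: leq_ltn_trans IH (H _ _ _). Qed.

Let c (x : C) : R := Num.sqrt (1 + normc x ^+ 2).

Let c1 x : 1 <= c x.
Proof. by rewrite /c -[leLHS]sqrtr1 ler_sqrt ?lerDl ?sqr_ge0// addr_ge0// sqr_ge0. Qed.

Let cge x : normc x <= c x.
Proof.
rewrite /c -[leLHS]ger0_norm ?normc_ge0// -sqrtr_sqr ler_sqrt ?lerDr//.
by rewrite addr_ge0// sqr_ge0.
Qed.

Let cge2 x : c x <= 1 + normc x.
Proof.
have h := normc_ge0 x.
rewrite /c -[leRHS]ger0_norm ?addr_ge0// -sqrtr_sqr ler_sqrt ?sqr_ge0//.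
by rewrite sqrrD expr1n mul1r lerD2r lerDl mulrn_wge0.
Qed.

Lemma chordal_le_dist x y : chordal (pt x) (pt y) <= 2 * normc (x - y).
Proof.
rewrite /= -/(c x) -/(c y) ler_pdivrMr; last first.
  by rewrite mulr_gt0// (lt_le_trans ltr01).
rewrite ler_peMr ?mulr_ge0 ?normc_ge0//.
by rewrite -[leLHS]mulr1 ler_pM.
Qed.

Lemma chordal_le_inv x y : x != 0 -> y != 0 ->
  chordal (pt x) (pt y) <= 2 * normc (x^-1 - y^-1).
Proof.
move=> x0 y0; have -> : x^-1 - y^-1 = (y - x) / (x * y).
  by field; rewrite x0 y0.
rewrite /= -/(c x) -/(c y) Normc.normcM normcV0 (normc_dist y) mulrA.
rewrite ler_wpM2l ?mulr_ge0 ?normc_ge0// Normc.normcM.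
by rewrite lef_pV2 ?posrE ?mulr_gt0 ?normc_gt0// ?(lt_le_trans ltr01)// ler_pM ?normc_ge0.
Qed.

Lemma chordal_infty_le x : x != 0 -> chordal (pt x) infty <= 2 * normc (x^-1).
Proof.
move=> x0; rewrite /= -/(c x) normcV0 ler_wpM2l// lef_pV2 ?posrE ?normc_gt0//.
by rewrite (lt_le_trans ltr01).
Qed.

(** Half the chordal distance to infinity. Being Lipschitz for [chordal], it turns chordal estimates
    into estimates between real numbers. *)
Definition height (z : sphere R) : R := if z is Some x then (c x)^-1 else 0.

Lemma height_lip x (w : sphere R) : `|height (pt x) - height w| <= chordal (pt x) w.
Proof.
have cx : 0 < c x by rewrite (lt_le_trans ltr01).
case: w => [y|] /=; last first.
  have ci : 0 < (c x)^-1 by rewrite invr_gt0.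
  by rewrite -/(c x) subr0 ger0_norm; lra.
have cy : 0 < c y by rewrite (lt_le_trans ltr01).
rewrite -/(c x) -/(c y).
have -> : (c x)^-1 - (c y)^-1 = (c y - c x) / (c x * c y).
  by field; rewrite !gt_eqF.
have cp : 0 <= (c x * c y)^-1 by rewrite invr_ge0 mulr_ge0// ltW.
rewrite normrM (ger0_norm cp); apply: ler_wpM2r => //.
have key u v : c u - c v <= 2 * normc (u - v).
  have sq t : c t ^+ 2 = 1 + normc t ^+ 2 by rewrite /c sqr_sqrtr// addr_ge0// sqr_ge0.
  have e1 : (c u - c v) * (c u + c v) = (normc u - normc v) * (normc u + normc v).
    by rewrite -!subr_sqr !sq; ring.
  have h1 := normc_lerB u v; have h2 := normc_ge0 (u - v).
  have h3 := normc_ge0 u; have h4 := normc_ge0 v.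
  have h5 := cge u; have h6 := cge v; have h7 := c1 u; have h8 := c1 v.
  have [|hh] := leP (c u - c v) (normc (u - v)); first by lra.
  have : (normc u - normc v) * (normc u + normc v) <= normc (u - v) * (c u + c v).
    have [n0|n0] := leP 0 (normc u - normc v); first by apply: ler_pM => //; lra.
    have : (normc u - normc v) * (normc u + normc v) <= 0 by rewrite mulr_le0_ge0//; lra.
    have : 0 <= normc (u - v) * (c u + c v) by rewrite mulr_ge0//; lra.
    lra.
  rewrite -e1 ler_pM2r; [lra|lra].
by rewrite ler_norml; have := key x y; have := key y x; rewrite (normc_dist y x); lra.
Qed.

Lemma height_continuous p : continuous (fun z : C => height (pt p.[z])).
Proof.
move=> z; apply: continuous_plane_realP => e e0.
have e2 : 0 < e / 2 by rewrite divr_gt0.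
have := @horner_continuous R p z; move/continuous_normcP/(_ _ e2)/nbhs_normcP.
move=> [d [d0 dP]]; exists d; split=> // y /dP h.
apply: le_lt_trans (height_lip _ _) _; apply: le_lt_trans (chordal_le_dist _ _) _; lra.
Qed.

Lemma height_bound x b : 0 < b -> b <= height (pt x) -> normc x <= b^-1.
Proof.
move=> b0 /= h; apply: le_trans (cge x) _.
rewrite -[c x]invrK lef_pV2 ?posrE// ?invr_gt0//; exact: lt_le_trans (c1 x).
Qed.

Lemma height_small x b : 0 < b -> height (pt x) <= b -> b^-1 - 1 <= normc x.
Proof.
move=> b0 /= h; rewrite lerBlDl; apply: le_trans _ (cge2 x).
rewrite -[c x]invrK lef_pV2 ?posrE// ?invr_gt0//; exact: lt_le_trans (c1 x).
Qed.
End Montel.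

(** * Components and clopen neighbourhoods in a compact Hausdorff space *)

Section QuasiComponent.
Variable T : topologicalType.
Hypotheses (hT : hausdorff_space T) (cT : compact [set: T]).
Implicit Types (A B E J N O : set T).

Let ccompact A : closed A -> compact A.
Proof. by move=> cA; apply: (subclosed_compact cA cT). Qed.

Lemma compact_normal_separation A B : closed A -> closed B -> A `&` B = set0 ->
  exists U V, [/\ open U, open V, A `<=` U, B `<=` V & U `&` V = set0].
Proof.
move=> cA cB AB; have := compact_normal hT cT cA.
move=> /(_ (~` B)) [|W /set_nbhsP[U [oU AU UW]] clW].
  apply/set_nbhsP; exists (~` B); split=> //; first exact: closed_openC.
  by move=> z Az Bz; have : (A `&` B) z by []; rewrite AB.
exists U, (~` closure W); split=> //.
- exact/closed_openC/closed_closure.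
- by move=> z Bz /clW.
- by apply/seteqP; split=> // z [/UW/subset_closure].
Qed.

(** The relatively clopen subsets of [A] containing [x]; their intersection is the quasi-component
    of [x]. *)
Let clop A x E := [/\ E `<=` A, closed E, closed (A `\` E) & E x].

Let clopI A x E E' : clop A x E -> clop A x E' -> clop A x (E `&` E').
Proof.
move=> [E1 E2 E3 E4] [F1 F2 F3 F4]; split=> //.
- by move=> z [/E1].
- exact: closedI.
- have -> : A `\` (E `&` E') = (A `\` E) `|` (A `\` E').
    by rewrite setDIr.
  exact: closedU.
Qed.

(** If every clopen set met [K], the traces on [K] would generate a proper filter, and its cluster
    point would lie in every clopen set. *)
Let clop_small A x K : closed A -> A x -> closed K ->
  (forall z, K z -> exists2 E, clop A x E & ~ E z) -> exists2 E, clop A x E & E `&` K = set0.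
Proof.
move=> cA Ax cK H; apply: contrapT => nE.
have Fne E : clop A x E -> E `&` K !=set0.
  by move=> cE; apply/set0P/eqP => EK; apply: nE; exists E.
have clA : clop A x A by split=> //; rewrite setDv; exact: closed0.
have PF : ProperFilter (filter_from (clop A x) (fun E => E `&` K)).
  apply: filter_from_proper; last by move=> E /Fne.
  apply: filter_from_filter; first by exists A.
  move=> E E' cE cE'; exists (E `&` E'); first exact: clopI.
  by move=> z [[? ?] ?].
have [p [Kp clp]] := ccompact cK PF (ex_intro2 _ _ A clA (@subIsetr _ A K)).
have [E cE nEp] := H p Kp; have [_ cEE _ _] := cE.
have [y [[Ey _] nEy]] := clp _ (~` E) (ex_intro2 _ _ E cE (fun z h => h)) (open_nbhs_nbhs (conj (closed_openC cEE) nEp)).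
exact: nEy.
Qed.

(* In a compact Hausdorff space components and quasi-components agree. *)
Lemma component_clopen_nbhd A x O : closed A -> A x -> open O ->
  connected_component A x `<=` O ->
  exists E, [/\ connected_component A x `<=` E, E `<=` O, E `<=` A, closed E & closed (A `\` E)].
Proof.
move=> cA Ax oO JO.
pose Q := \bigcap_(E in clop A x) E.
have clA : clop A x A by split=> //; rewrite setDv; exact: closed0.
have cQ : closed Q by apply: closed_bigI => E [].
have QJ : Q `<=` connected_component A x.
  have Qx : Q x by move=> E [].
  have QA : Q `<=` A by move=> z; apply.
  apply: connected_component_max => //.
  apply: locconst_connected => P y z loc Qy Qz Py; apply: contrapT => nPz.
  (* The two parts of [Q] have disjoint open neighbourhoods [U1] and [U2]. Some clopen [E] lies in
     their union, so its part in [U1] is again clopen around [x] and contains all of [Q]. *)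
  have key (P' : set T) : (forall z, Q z -> \forall y \near z, Q y -> (P' y <-> P' z)) ->
     P' x -> forall z, Q z -> P' z.
    move=> loc' Px w Qw; apply: contrapT => nPw.
    have loccl (P1 : set T) : (forall z, Q z -> \forall y \near z, Q y -> (P1 y <-> P1 z)) -> closed (Q `&` P1).
      move=> l1; have -> : Q `&` P1 = Q `&` ~` (interior [set w | Q w -> ~ P1 w]).
        apply/seteqP; split=> u [Qu Pu]; split=> //.
          by move=> /interior_subset/(_ Qu).
        apply: contrapT => nQ; apply: Pu; have := l1 u Qu.
        by apply: filterS => v + Qv => /(_ Qv) [H _] /H.
      by apply: closedI => //; apply: open_closedC; exact: open_interior.
    have c1 := loccl _ loc'.
    have c2 : closed (Q `&` ~` P').
      apply: loccl => u Qu; have := loc' u Qu; apply: filterS => v + Qv => /(_ Qv) [a b].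
      by split=> np p; apply: np; [exact: b|exact: a].
    have [|U1 [U2 [oU1 oU2 s1 s2 U12]]] := compact_normal_separation c1 c2.
      by apply/seteqP; split=> // u [[_ ?] []].
    have [|u [Au nu]|E cE EK] := @clop_small A x (A `&` ~` (U1 `|` U2)) cA Ax.
      by apply: closedI => //; apply: open_closedC; exact: openU.
    - apply: contrapT => ne; apply: nu; have Qu : Q u.
        by move=> E cE; apply: contrapT => nEu; apply: ne; exists E.
      by have [p|p] := pselect (P' u); [left; apply: s1|right; apply: s2].
    have [E1 E2 E3 E4] := cE.
    have EU : E `<=` U1 `|` U2.
      move=> u Eu; apply: contrapT => nu.
      have : (E `&` (A `&` ~` (U1 `|` U2))) u by split=> //; split=> //; exact: E1.
      by rewrite EK.
    have U12' u : U1 u -> ~ U2 u by move=> h1 h2; have : (U1 `&` U2) u by []; rewrite U12.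
    have clE : clop A x (E `&` U1).
      split.
      - by move=> u [/E1].
      - have -> : E `&` U1 = E `&` ~` U2.
          apply/seteqP; split=> u [Eu h]; split=> //; first exact: U12'.
          by case: (EU u Eu).
        by apply: closedI => //; exact: open_closedC.
      - have -> : A `\` (E `&` U1) = (A `\` E) `|` (E `&` ~` U1).
          apply/seteqP; split=> u.
            move=> [Au nu]; have [Eu|nEu] := pselect (E u); last by left.
            by right; split=> // U1u; apply: nu.
          by move=> [[Au nE]|[Eu nU]]; split=> //; [case|exact: E1|case].
        by apply: closedU => //; apply: closedI => //; exact: open_closedC.
      - by split=> //; apply: s1.
    by have [_ U1w] := Qw _ clE; apply: (U12' w U1w); apply: s2.
  have [Px|nPx] := pselect (P x); first exact: nPz (key _ loc Px z Qz).
  have {}nPx : (~` P) x by [].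
  apply: (key (~` P) _ nPx y Qy) Py => u Qu.
  have := loc u Qu; apply: filterS => v + Qv => /(_ Qv) [a b].
  by split=> np p; apply: np; [exact: b|exact: a].
have [|z nOz|E cE EO] := @clop_small A x (~` O) cA Ax.
- exact: open_closedC.
- apply: contrapT => ne; apply: nOz; apply: JO; apply: QJ => E cE.
  by apply: contrapT => nEz; apply: ne; exists E.
have [E1 E2 E3 E4] := cE.
exists E; split=> //; last first.
  by move=> z Ez; apply: contrapT => nO; have : (E `&` ~` O) z by []; rewrite EO.
move=> y Jy; apply: (connected_locconst (@component_connected _ A x) _ (connected_component_refl Ax) Jy E4).
move=> z /connected_component_sub Az.
have [Ez|nEz] := pselect (E z).
  have : (~` (A `\` E)) z by case.
  move=> h; have := open_nbhs_nbhs (conj (closed_openC E3) h).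
  apply: filterS => w nw /connected_component_sub Aw; split=> // _.
  by apply: contrapT => nE; apply: nw.
have := open_nbhs_nbhs (conj (closed_openC E2) nEz).
by apply: filterS => w nw _; split.
Qed.

(** The last clause says that the boundary of [N] misses [A]. With [A] the Julia set, a component is
    enclosed by a compact part of the Fatou set, although other components may accumulate on it. *)
Lemma component_separation A x O : closed A -> A x -> open O ->
  connected_component A x `<=` O ->
  exists N, [/\ open N, connected_component A x `<=` N, closure N `<=` O &
    A `&` closure N `<=` N].
Proof.
move=> cA Ax oO JO.
have [E [JE EO EA cE cAE]] := component_clopen_nbhd cA Ax oO JO.
have [||U [V [oU oV EU BV UV]]] := @compact_normal_separation E ((A `\` E) `|` ~` O) cE.
- by apply: closedU => //; exact: open_closedC.
- by apply/seteqP; split=> // z [Ez [[_ /(_ Ez)]|/(_ (EO z Ez))]].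
have clU : closure U `<=` ~` V.
  rewrite (closure_id (~` V)).1; last exact: open_closedC.
  by apply: closureS => z Uz Vz; have : (U `&` V) z by []; rewrite UV.
exists U; split=> //; first exact: subset_trans JE EU.
  by move=> z /clU nV; apply: contrapT => nO; apply: nV; apply: BV; right.
move=> z [Az /clU nV]; apply: EU; apply: contrapT => nE; apply: nV; apply: BV; by left.
Qed.
End QuasiComponent.

(** * Topology of the sphere and continuity of polynomial maps *)

Section SphereTopology.
Variable R : realType.
Local Notation C := R[i].
Local Notation S := (sphere R).
Local Notation pt := (@pt R).
Local Notation infty := (@infty R).
Implicit Types (z w a : C) (e r s : R) (p f : {poly C}).

Lemma nbhs_ptP z (A : set S) : nbhs (pt z) A <-> nbhs z (pt @^-1` A).
Proof. by []. Qed.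

Lemma nbhs_inftyP (A : set S) :
  nbhs infty A <-> A infty /\ exists r, 0 < r /\ forall z, r <= normc z -> A (pt z).
Proof.
split.
  move=> [K [cK clK] KA]; split; first by apply: KA; right.
  have [r [r0 Kr]] := plane_compact_bounded cK; exists r; split=> // z rz.
  by apply: KA; left; exists z => // /Kr; rewrite ltNge rz.
move=> [Ai [r [r0 rA]]]; exists [set z : C | normc (z - 0) <= r].
  by split; [exact: compact_disc|exact: closed_disc].
move=> _ [[z + <-]|->//]; rewrite /= subr0 => /negP; rewrite -ltNge => h.
exact/rA/ltW.
Qed.

Lemma pt_continuous : continuous pt.
Proof. by move=> z A. Qed.

Lemma open_pt (A : set C) : open A -> open (pt @` A).
Proof. exact: one_point_compactification_open_some. Qed.

Lemma open_preimage_pt (A : set S) : open A -> open (pt @^-1` A).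
Proof. by move=> oA; apply: open_comp => // z _; exact: pt_continuous. Qed.

Lemma closed_preimage_pt (A : set S) : closed A -> closed (pt @^-1` A).
Proof. by move=> oA; apply: closed_comp => // z _; exact: pt_continuous. Qed.

Lemma compact_pt (A : set C) : compact A -> compact (pt @` A).
Proof.
move=> cA; apply: continuous_compact => //.
by apply: continuous_subspaceT; exact: pt_continuous.
Qed.

Lemma sphere_hausdorff : hausdorff_space S.
Proof.
have pi z : exists U V, [/\ nbhs (pt z) U, nbhs infty V & U `&` V = set0].
  exists (pt @` [set y | normc (y - z) < 1]), ([set infty] `|` pt @` [set y | normc z + 1 <= normc y]); split.
  - apply/nbhs_ptP/nbhs_normcP; exists 1; split=> // y yz; by exists y.
  - apply/nbhs_inftyP; split; first by left.
    exists (normc z + 1); split; first by rewrite ltr_wpDl// normc_ge0.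
    by move=> y hy; right; exists y.
  - apply/seteqP; split=> // _ [[y /= yz <-] [//|[w /= hw [wy]]]]; move: hw; rewrite wy.
    by have := normc_lerB y z; lra.
move=> [z|] [w|] // cl.
- congr (Some _); apply: (@hausdorff_plane R) => A B nA nB.
  have nA' : nbhs (pt z) (pt @` A).
    by apply/nbhs_ptP; apply: filterS nA => x Ax; exists x.
  have nB' : nbhs (pt w) (pt @` B).
    by apply/nbhs_ptP; apply: filterS nB => x Ax; exists x.
  have [_ [[a Aa <-] [b Bb [ab]]]] := cl _ _ nA' nB'.
  by exists a; split=> //; rewrite -ab.
- have [U [V [nU nV UV]]] := pi z.
  by have [y] := cl U V nU nV; rewrite UV.
- have [U [V [nU nV UV]]] := pi w.
  by have [y] := cl V U nV nU; rewrite setIC UV.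
Qed.

Lemma sphere_compact : compact [set: S].
Proof. exact: one_point_compactification_compact. Qed.

Lemma sphere_closed_compact (A : set S) : closed A -> compact A.
Proof. by move=> cA; apply: (subclosed_compact cA sphere_compact). Qed.

Lemma compact_preimage_pt (A : set S) : closed A -> ~ A infty -> compact (pt @^-1` A).
Proof.
move=> cA nA.
have := open_nbhs_nbhs (conj (closed_openC cA) nA).
move=> /nbhs_inftyP[_ [r [r0 rA]]].
apply: (@compact_bounded_closed _ _ r); first exact: closed_preimage_pt.
by move=> z Az; rewrite leNgt; apply/negP => /ltW/rA.
Qed.

Lemma connected_pt (A : set C) : connected A -> connected (pt @` A).
Proof. by move=> cA; apply: connected_image; [exact: cA|exact: pt_continuous]. Qed.

Lemma connected_preimage_pt (A : set S) : connected A -> ~ A infty -> connected (pt @^-1` A).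
Proof.
move=> cA nA; apply: locconst_connected => P x y loc Ax Ay Px.
suff [w Pw [<-]] : (pt @` P) (pt y) by [].
apply: (connected_locconst cA _ Ax Ay); last by exists x.
move=> [z|] // Az; apply/nbhs_ptP; have := loc z Az.
apply: filterS => w + Aw => /(_ Aw) [a b].
by split=> -[u Pu [uw]]; [exists z|exists w] => //; [apply: a; rewrite -uw|apply: b; rewrite -uw].
Qed.

Lemma image_preimage_pt (A : set S) : ~ A infty -> pt @` (pt @^-1` A) = A.
Proof.
move=> nA; apply/seteqP; split; first exact: image_preimage_subset.
by move=> [z|] Az //; exists z.
Qed.

Lemma sphere_component_open (A : set S) x : open A -> open (connected_component A x).
Proof.
move=> oA; rewrite openE => y Jy.
have Ay := connected_component_sub Jy.
rewrite (same_connected_component Jy).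
have := open_nbhs_nbhs (conj oA Ay); case: y Jy Ay => [z|] Jy Ay.
  move=> /nbhs_ptP/nbhs_normcP[e [e0 eA]].
  apply/nbhs_ptP/nbhs_normcP; exists e; split=> // w wz.
  exists (pt @` [set u | normc (u - z) < e]); last by exists w.
  split; first by exists z => //=; rewrite subrr Normc.normc0.
    by move=> _ [u uz <-]; exact: eA.
  by apply: connected_pt; exact: connected_disc.
move=> /nbhs_inftyP[_ [r [r0 rA]]].
apply/nbhs_inftyP; split; first exact: connected_component_refl.
exists r; split=> // w rw.
exists ([set infty] `|` pt @` [set u | r <= normc u]); last by right; exists w.
split; first by left.
  by move=> _ [->//|[u ru <-]]; exact: rA.
apply: locconst_connected => P u v loc Hu Hv Pu.
have /nbhs_inftyP[_ [s [s0 sP]]] := loc infty (or_introl erefl).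
have ms : r <= normc (Num.max r s)%:C%C.
  by rewrite normc_real ger0_norm le_max ?lexx ?(ltW r0).
have ss : s <= normc (Num.max r s)%:C%C.
  by rewrite normc_real ger0_norm le_max ?lexx ?orbT ?(ltW r0).
pose m : C := (Num.max r s)%:C%C.
have Em : (pt @` [set u | r <= normc u]) (pt m) by exists m.
have inf_m := sP _ ss (or_intror Em).
have loc' t : (pt @` [set u | r <= normc u]) t ->
    \forall y \near t, (pt @` [set u | r <= normc u]) y -> (P y <-> P t).
  by move=> Ht; have := loc t (or_intror Ht); apply: filterS => t' + Ht'; apply; right.
have key x1 : ([set infty] `|` pt @` [set u | r <= normc u]) x1 -> (P x1 <-> P infty).
  move=> [->//|Ex1]; rewrite -(propext inf_m).
  have cE := connected_pt (@connected_exterior R r r0).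
  by split=> h; apply: (connected_locconst cE loc' _ _ h).
by apply/(key v Hv); apply/(key u Hu).
Qed.

Lemma plane_component_open (A : set C) x : open A -> open (connected_component A x).
Proof.
move=> oA; rewrite openE => y Jy.
have Ay := connected_component_sub Jy.
rewrite (same_connected_component Jy).
have := open_nbhs_nbhs (conj oA Ay); move=> /nbhs_normcP[e [e0 eA]].
apply/nbhs_normcP; exists e; split=> // w wz.
exists [set u | normc (u - y) < e] => //.
split; first by rewrite /= subrr Normc.normc0.
  by move=> u uz; exact: eA.
exact: connected_disc.
Qed.

Lemma sphere_connected : connected [set: S].
Proof.
apply: locconst_connected => P u v loc _ _ Pu.
have /nbhs_inftyP[_ [s [s0 sP]]] := loc infty I.
have key x1 : P x1 <-> P infty.
  case: x1 => [x1|//].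
  rewrite -(propext (sP (s%:C%C) _ I)); last by rewrite normc_real gtr0_norm.
  have cE := connected_pt (@connected_segm R x1 (s%:C%C)).
  have [h1 h2] := (segm_l x1 (s%:C%C), segm_r x1 (s%:C%C)).
  split=> h; apply: (connected_locconst cE _ _ _ h).
  - by move=> t _; have := loc t I; apply: filterS => t' + _; apply.
  - by exists x1.
  - by exists s%:C%C.
  - by move=> t _; have := loc t I; apply: filterS => t' + _; apply.
  - by exists s%:C%C.
  - by exists x1.
by apply/(key v); apply/(key u).
Qed.

Lemma polymap_continuous p : (1 < size p)%N -> continuous (polymap p).
Proof.
move=> sp [z|].
  move=> A /nbhs_ptP nA; apply/nbhs_ptP.
  exact: (@horner_continuous R p z) nA.
move=> A /nbhs_inftyP[Ai [r [r0 rA]]]; apply/nbhs_inftyP; split=> //.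
have [s [s0 sP]] := poly_growth r sp.
by exists s; split=> // z /sP/rA.
Qed.

Lemma polymap_comp p q : polymap (p \Po q) = polymap p \o polymap q.
Proof. by apply/funext => -[z|//]; rewrite /polymap /= horner_comp. Qed.

Lemma polymap_surj p : (1 < size p)%N -> forall w : S, exists z : S, polymap p z = w.
Proof.
move=> sp [w|]; last by exists infty.
have sw : (size (- w%:P)%R < size p)%N.
  by rewrite size_polyN (leq_ltn_trans (size_polyC_leq1 _)).
have /closed_rootP[z] : size (p - w%:P) != 1%N.
  by rewrite size_polyDl// gtn_eqF.
rewrite rootE hornerD hornerN hornerC subr_eq0 => /eqP zw.
by exists (pt z); rewrite /= zw.
Qed.

Lemma polymap_inftyP p (z : S) : polymap p z = infty -> z = infty.
Proof. by case: z. Qed.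
End SphereTopology.

(** * A weak Montel theorem and estimates near Fatou points *)

Section Normality.
Variable R : realType.
Local Notation C := R[i].
Local Notation S := (sphere R).
Local Notation pt := (@pt R).
Local Notation infty := (@infty R).
Local Notation chordal := (@chordal R).
Implicit Types (z w a : C) (e r s d : R) (p f g : {poly C}) (G : set {poly C}).

Lemma chordal_ultra_subsequence (F : set_system nat) (u : nat -> S -> S) (U : set C) (h : C -> S) :
  ProperFilter F -> \oo `<=` F ->
  (forall e, 0 < e -> \forall n \near F, forall z, U z -> chordal (u n (pt z)) (h z) < e) ->
  exists (phi : nat -> nat) (h : S -> S),
    {homo phi : m n / (m < n)%N} /\
    forall K : set S, compact K -> K `<=` pt @` U ->
    forall e : R, 0 < e ->
    \forall n \near \oo, forall z : S, K z -> chordal (u (phi n) z) (h z) < e.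
Proof.
move=> PF oF H.
have [|phi [hphi phiP]] := @ultra_subsequence F
  (fun k n => forall z, U z -> chordal (u n (pt z)) (h z) < k.+1%:R^-1) PF oF.
  by move=> k; apply: H; rewrite invr_gt0.
exists phi, (fun z : S => if z is Some y then h y else infty); split=> // K _ KU e e0.
have := near_infty_natSinv_lt (PosNum e0); apply: filterS => n ne z /KU[y Uy <-].
exact: lt_trans (phiP n y Uy) ne.
Qed.

(** The ultrafilter decides which alternative holds along the sequence; then the polynomials or
    their reciprocals are uniformly Lipschitz and converge. Halving [d] gives a closed disc, and the
    Lipschitz bound holds on its quarter, whence [d / 8]. *)
Lemma montel (A : set {poly C}) z0 d r1 r2 : 0 < d -> 0 < r1 -> 0 <= r2 ->
  (forall f, A f -> (forall y, normc (y - z0) < d -> r1 <= normc f.[y]) \/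
                    (forall y, normc (y - z0) < d -> normc f.[y] <= r2)) ->
  normal_on (@polymap R @` A) (pt @` [set y | normc (y - z0) < d / 8]).
Proof.
move=> d0 r10 r20 H u uA.
have /choice[f fP] : forall n, exists f, A f /\ polymap f = u n.
  by move=> n; have [f Af fu] := uA n; exists f.
have [F [UF oF]] := free_ultrafilter.
have PF : ProperFilter F by exact: ultra_proper.
pose D := [set y | normc (y - z0) <= d / 2 / 4].
have cD : compact D by exact: compact_disc.
have d20 : 0 < d / 2 by rewrite divr_gt0.
have dd y : normc (y - z0) <= d / 2 -> normc (y - z0) < d by lra.
suff [h hP] : exists h : C -> S, forall e, 0 < e ->
    \forall n \near F, forall z, D z -> chordal (u n (pt z)) (h z) < e.
  have [phi [g [hphi gP]]] := chordal_ultra_subsequence PF oF hP.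
  exists phi, g; split=> // K cK KU; apply: gP => // y /KU[x xd <-].
  by exists x => //; rewrite /D /= in xd *; lra.
have [FA|FA] := in_ultra_setVsetC [set n | forall y, normc (y - z0) < d -> normc (f n).[y] <= r2] UF.
  have [||h hP] := @ultra_uniform_limit R F D (fun n z => (f n).[z]) r2 (4 * r2 / (d / 2)) UF cD.
  - by rewrite divr_ge0// ?mulr_ge0// ltW.
  - apply: filterS FA => n /= fn; split.
      by move=> z Dz; apply: fn; rewrite /D /= in Dz; lra.
    by apply: poly_lipschitz => // z /dd/fn.
  exists (fun z => pt (h z)) => e e0; have e2 : 0 < e / 2 by rewrite divr_gt0.
  apply: filterS (hP _ e2) => n hn z Dz; rewrite -(fP n).2 [polymap _ _]/=.
  by apply: le_lt_trans (chordal_le_dist _ _) _; have := hn z Dz; lra.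
have FA1 : \forall n \near F, forall y, normc (y - z0) < d -> r1 <= normc (f n).[y].
  by apply: filterS FA => n /= fn; have [//|/fn] := H _ (fP n).1.
have [||h hP] := @ultra_uniform_limit R F D (fun n z => (f n).[z]^-1) r1^-1 (4 / r1 / (d / 2)) UF cD.
- by rewrite !divr_ge0// ltW.
- apply: filterS FA1 => n /= fn; split.
    move=> z Dz; have h1 : r1 <= normc (f n).[z] by apply: fn; rewrite /D /= in Dz; lra.
    by rewrite normcV0 lef_pV2 ?posrE// (lt_le_trans r10 h1).
  by apply: poly_inv_lipschitz => // z /dd/fn.
(* Here [h] is the limit of the reciprocals, so a zero of [h] is the value infinity. *)
exists (fun z => if h z == 0 then infty else pt (h z)^-1) => e e0.
have e2 : 0 < e / 2 by rewrite divr_gt0.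
apply: filterS2 FA1 (hP _ e2) => n fn hn z Dz; rewrite -(fP n).2 [polymap _ _]/=.
have fz : (f n).[z] != 0.
  by rewrite -normc_gt0; apply: lt_le_trans r10 (fn z _); rewrite /D /= in Dz; lra.
have := hn z Dz; case: eqVneq => [->|hz].
  by rewrite subr0 => h1; apply: le_lt_trans (chordal_infty_le fz) _; lra.
move=> h1; apply: le_lt_trans (chordal_le_inv fz _) _; first by rewrite invr_eq0.
by rewrite invrK; lra.
Qed.

(** If no element took both a small and a large value near [z0], each one would satisfy an
    alternative of [montel]. *)
Lemma Julia_oscillation G z0 d r1 r2 : Julia G (pt z0) -> 0 < d -> 0 < r1 ->
  exists f x y, [/\ G f, normc (x - z0) < d, normc (y - z0) < d,
    normc f.[x] < r1 & r2 < normc f.[y]].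
Proof.
move=> Jz d0 r10; apply: contrapT => H; apply: Jz.
exists (pt @` [set y | normc (y - z0) < d / 8]); split.
  split; first by apply: open_pt; exact: open_disc.
  by exists z0 => //; rewrite /= subrr Normc.normc0 divr_gt0.
apply: (@montel _ _ d r1 (Num.max r2 0)) => //; first by rewrite le_max lexx orbT.
move=> f Gf; have [h1|h1] := pselect (forall y, normc (y - z0) < d -> r1 <= normc f.[y]).
  by left.
right=> y yd; rewrite leNgt; apply/negP => hy; apply: h1 => x xd.
rewrite leNgt; apply/negP => hx; apply: H; exists f, x, y; split=> //.
by apply: le_lt_trans hy; rewrite le_max lexx.
Qed.

(** Otherwise a sequence has jumps of at least 1/8 at points tending to [x0]. Along a subsequence
    the heights are within 1/32 of those of a single polynomial, whose own variation near [x0] is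
    below 1/32, so the jump is below 3/32. *)
Lemma Fatou_equicontinuous G x0 : Fatou G (pt x0) ->
  exists d, 0 < d /\ forall f, G f -> forall y, normc (y - x0) < d ->
    `|height (pt f.[y]) - height (pt f.[x0])| < 1 / 8.
Proof.
move=> [U [[oU Ux] nU]]; apply: contrapT => H.
have /choice[fy fyP] : forall n : nat, exists fy : {poly C} * C,
   [/\ G fy.1, normc (fy.2 - x0) < n.+1%:R^-1 &
       1 / 8 <= `|height (pt fy.1.[fy.2]) - height (pt fy.1.[x0])| ].
  move=> n; apply: contrapT => nH; apply: H; exists n.+1%:R^-1; split; first by rewrite invr_gt0.
  move=> f Gf y yn; rewrite ltNge; apply/negP => hy; apply: nH; by exists (f, y).
have := open_nbhs_nbhs (conj oU Ux); move=> /nbhs_ptP/nbhs_normcP[e [e0 eU]].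
have [|phi [h [hphi hP]]] := nU (fun n => polymap (fy n).1).
  by move=> n; exists (fy n).1 => //; have [] := fyP n.
pose K := pt @` [set y | normc (y - x0) <= e / 2].
have cK : compact K by apply: compact_pt; exact: compact_disc.
have KU : K `<=` U by move=> _ [y /= ye <-]; apply: eU; lra.
have e64 : 0 < 1 / 64 :> R by rewrite divr_gt0.
have [N _ NP] := hP K cK KU _ e64.
have close n y : (N <= n)%N -> normc (y - x0) <= e / 2 ->
    `|height (pt (fy (phi n)).1.[y]) - height (pt (fy (phi N)).1.[y])| <= 1 / 32.
  move=> Nn ye; have Ky : K (pt y) by exists y.
  have h1 : chordal (pt (fy (phi n)).1.[y]) (h (pt y)) < 1 / 64 := NP n Nn (pt y) Ky.
  have h2 : chordal (pt (fy (phi N)).1.[y]) (h (pt y)) < 1 / 64 := NP N (leqnn N) (pt y) Ky.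
  have h3 := le_lt_trans (height_lip (fy (phi n)).1.[y] (h (pt y))) h1.
  have h4 := le_lt_trans (height_lip (fy (phi N)).1.[y] (h (pt y))) h2.
  have h5 := ler_distD (height (h (pt y))) (height (pt (fy (phi n)).1.[y])) (height (pt (fy (phi N)).1.[y])).
  rewrite distrC in h4; lra.
have e32 : 0 < 1 / 32 :> R by rewrite divr_gt0.
have := @height_continuous R (fy (phi N)).1 x0.
move=> /cvgrPdist_lt/(_ _ e32)/nbhs_normcP[d [d0 dP]].
have de0 : 0 < Num.min d (e / 2) by rewrite lt_min d0 divr_gt0.
have [M _ MP] := near_infty_natSinv_lt (PosNum de0).
pose n := maxn N M.
have Nn : (N <= n)%N by rewrite leq_maxl.
have [_ yn ybad] := fyP (phi n).
have yd : normc ((fy (phi n)).2 - x0) < Num.min d (e / 2).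
  apply: lt_trans yn _; apply: (MP (phi n)) => /=.
  by apply: leq_trans (homo_ge_id hphi n); rewrite leq_maxr.
move: yd; rewrite lt_min => /andP[yd ye].
have c1 := close n _ Nn (ltW ye).
have c2 : `|height (pt (fy (phi n)).1.[x0]) - height (pt (fy (phi N)).1.[x0])| <= 1 / 32.
  by apply: close => //; rewrite subrr Normc.normc0 ltW// divr_gt0.
have c3 := dP _ yd.
move: ybad c1 c2 c3.
set X := height _; set Y := height _; set X' := height _; set Y' := height _.
move=> h1 h2 h3 h4.
have h5 := ler_distD X' X Y; have h6 := ler_distD Y' X' Y.
rewrite (distrC Y' Y) in h6; rewrite (distrC Y' X') in h4; lra.
Qed.

(** If the height at [x0] is at least 3/8, it is at least 1/4 nearby and [|f| <= 4]. Otherwise it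
    stays below 1/2, so [|f| >= 1], and [poly_harnack] applies twice, between [x0] and [y] and
    between [y'] and [x0]; the radius [d / 64] is a sixteenth of the [d / 4] used around [y']. *)
Lemma Fatou_comparison G x0 : Fatou G (pt x0) ->
  exists d, 0 < d /\ forall K, exists K', forall f, G f ->
    (exists y, normc (y - x0) < d /\ normc f.[y] <= K) ->
    forall y, normc (y - x0) < d -> normc f.[y] <= K'.
Proof.
move=> /Fatou_equicontinuous[d [d0 dP]].
exists (d / 64); split; first by rewrite divr_gt0.
move=> K; have [N1 N1P] := @poly_harnack R (K + 1); have [N2 N2P] := poly_harnack N1.
exists (Num.max 4 N2) => f Gf [y [yd yK]] y' y'd; rewrite le_max.
have [h|h] := leP (3 / 8) (height (pt f.[x0])).
  apply/orP; left; have y'd' : normc (y' - x0) < d by lra.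
  have := dP f Gf y' y'd'; rewrite ltr_norml => /andP[h1 h2].
  have h3 : 1 / 4 <= height (pt f.[y']) by lra.
  have q4 : 0 < 1 / 4 :> R by rewrite divr_gt0.
  by have := height_bound q4 h3; rewrite div1r invrK.
apply/orP; right.
have f1 z : normc (z - x0) < d -> 1 <= normc f.[z].
  move=> zd; have := dP f Gf z zd; rewrite ltr_norml => /andP[h1 h2].
  have h3 : height (pt f.[z]) <= 1 / 2 by lra.
  have q2 : 0 < 1 / 2 :> R by rewrite divr_gt0.
  have := height_small q2 h3; rewrite div1r invrK; lra.
have fx : normc f.[x0] < N1.
  rewrite ltNge; apply/negP => hN1.
  have : K + 1 <= normc f.[y].
    apply: (N1P f x0 (d / 2)) => //; [by rewrite divr_gt0| |lra].
    by move=> z zd; apply: f1; lra.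
  lra.
rewrite leNgt; apply/negP => hN2.
have : N1 <= normc f.[x0].
  apply: (N2P f y' (d / 4)) => //; [by rewrite divr_gt0| |exact: ltW|].
    move=> z zd; apply: f1; apply: le_lt_trans (normc_triangle z y' x0) _; lra.
  by rewrite normc_dist; lra.
by rewrite leNgt fx.
Qed.
End Normality.

(** * Julia components *)

Section PlaneComponents.
Variable R : realType.
Local Notation C := R[i].
Local Notation S := (sphere R).
Local Notation pt := (@pt R).
Implicit Types (z w a : C) (e r s d : R) (A B D J : set C).

(** [bounded_set] quantifies over bounds in [R[i]], whose order is partial: anything above a real
    number is real. *)
Lemma bounded_setP D : bounded_set D <-> exists r, forall z, D z -> normc z <= r.
Proof.
split.
  move=> [M [Mr HM]].
  have [k kM] : exists k, M = k%:C%C by apply/complex_realP.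
  exists (k + 1) => z Dz.
  have := HM (k + 1)%:C%C; rewrite kM ltcR ltrDl ltr01 => /(_ isT z Dz).
  by rewrite /= normcE' lecR.
move=> [r rP]; exists (r%:C%C); split; first by apply/complex_realP; exists r.
move=> x; case: x => a b; rewrite ltcE /= => /andP[/eqP b0 ra] z Dz.
rewrite /= normcE' lecE /= b0 eqxx /=; exact: le_trans (rP z Dz) (ltW ra).
Qed.

Definition inside A B := exists D, [/\ components (~` B) D, bounded_set D & A `<=` D].

Lemma components_prop (T : topologicalType) (A D : set T) : components A D ->
  [/\ D !=set0, connected D, D `<=` A &
      forall E : set T, connected E -> E `<=` A -> E `&` D !=set0 -> E `<=` D].
Proof.
move=> [x Ax <-]; split.
- by exists x; exact: connected_component_refl.
- exact: component_connected.
- exact: connected_component_sub.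
- move=> E cE EA [y [Ey Dy]].
  rewrite (same_connected_component Dy); exact: connected_component_max.
Qed.

Lemma components_eq (T : topologicalType) (A D E : set T) : components A D -> components A E ->
  D `&` E !=set0 -> D = E.
Proof.
move=> /components_prop[_ cD DA mD] /components_prop[_ cE EA mE] DE.
apply/seteqP; split; first exact: mE.
by apply: mD => //; rewrite setIC.
Qed.

Lemma connected_plane : connected [set: C].
Proof.
apply: locconst_connected => P u v loc _ _ Pu.
apply: (connected_locconst (@connected_segm R u v) _ (segm_l u v) (segm_r u v) Pu).
by move=> t _; have := loc t I; apply: filterS => t' + _; apply.
Qed.

(** A component whose closure missed [B] would be open and closed in the plane. *)
Lemma component_closure_meets B D : closed B -> B !=set0 -> components (~` B) D ->
  exists b, B b /\ closure D b.
Proof.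
move=> cB [b Bb] cD; apply: contrapT => H.
have [[x Dx] cnD DB mD] := components_prop cD.
have clD : closure D `<=` D.
  apply: mD; first exact: connected_closure.
    by move=> y cly By; apply: H; exists y.
  by exists x; split=> //; exact: subset_closure.
have oD : open D by case: cD => y _ <-; apply: plane_component_open; exact: closed_openC.
have : D b.
  apply: (connected_locconst connected_plane _ I I Dx) => z _.
  have [Dz|nDz] := pselect (D z).
    by have := open_nbhs_nbhs (conj oD Dz); apply: filterS.
  have : (~` closure D) z by move/clD.
  move=> h; have := open_nbhs_nbhs (conj (closed_openC (@closed_closure _ D)) h).
  apply: filterS => w nw _; split=> // Dw; exfalso; apply: nw; exact: subset_closure.
by move/DB.
Qed.

Lemma connected_closure_union (T : topologicalType) (A B : set T) x : connected A -> connected B -> B x -> closure A x ->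
  connected (A `|` B).
Proof.
move=> cA cB Bx clx; apply: locconst_connected => P u v loc Hu Hv Pu.
have AP (y z : T) : A y -> A z -> P y -> P z.
  move=> Ay Az; apply: (connected_locconst cA) => // t At.
  by have := loc t (or_introl At); apply: filterS => t' + At'; apply; left.
have BP (y z : T) : B y -> B z -> P y -> P z.
  move=> By Bz; apply: (connected_locconst cB) => // t Bt.
  by have := loc t (or_intror Bt); apply: filterS => t' + Bt'; apply; right.
have [a [Aa aP]] := clx _ (loc x (or_intror Bx)).
have {}aP := aP (or_introl Aa).
have key y : (A `|` B) y -> (P y <-> P x).
  move=> [Ay|By]; last by split; exact: BP.
  by rewrite -(propext aP); split; exact: AP.
by apply/(key v Hv); apply/(key u Hu).
Qed.

Lemma component_union_connected B D : closed B -> B !=set0 -> connected B ->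
  components (~` B) D -> connected (D `|` B).
Proof.
move=> cB B0 cnB cD; have [b [Bb clb]] := component_closure_meets cB B0 cD.
have [_ cnD _ _] := components_prop cD.
exact: connected_closure_union Bb clb.
Qed.

(** If [B] had no point of modulus above [|z|], the radial ray from [z] outwards would avoid [B] and
    make the component of [z] unbounded. Comparing maximal moduli then replaces separation
    theorems. *)
Lemma inside_max A B z : compact B -> B !=set0 -> inside A B -> A z ->
  exists w, B w /\ normc z < normc w.
Proof.
move=> cB B0 [D [cD /bounded_setP[r rP] AD]] Az; apply: contrapT => H.
have le w : B w -> normc w <= normc z.
  by move=> Bw; rewrite leNgt; apply/negP => zw; apply: H; exists w.
have [_ _ DB mD] := components_prop cD.
have nBz : ~ B z by apply: DB; exact: AD.
have z0 : z != 0.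
  apply/eqP => z0; have [w Bw] := B0; have := le w Bw.
  rewrite z0 Normc.normc0 => w0; have : w = 0.
    by apply/eqP; rewrite -normc_eq0 eq_le w0 normc_ge0.
  by move=> w00; apply: nBz; rewrite z0 -w00.
have nz : 0 < normc z by rewrite normc_gt0.
(* Chosen so that [t * |z| = |r| + 1 + |z|] exceeds the bound [r] of [D]. *)
pose t := (`|r| + 1) / normc z + 1.
have q0 : 0 <= (`|r| + 1) / normc z by rewrite divr_ge0// ltW.
have : D (t%:C%C * z).
  apply: (mD (segm z (t%:C%C * z))); [exact: connected_segm| | |exact: segm_r].
    move=> _ [u /= + <-]; rewrite in_itv /= => /andP[u0 u1] Bl.
    have E : lin z (t%:C%C * z) u = (1 + u * ((`|r| + 1) / normc z))%:C%C * z.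
      by rewrite /lin /t !(rmorphD, rmorphM, rmorph1); ring.
    have := le _ Bl; rewrite E Normc.normcM normc_real ger0_norm; last by rewrite addr_ge0// mulr_ge0.
    move=> h; have [u00|un0] := eqVneq u 0.
      by apply: nBz; move: Bl; rewrite u00 lin0.
    have : 0 < u * ((`|r| + 1) / normc z) * normc z.
      by rewrite mulr_gt0// mulr_gt0 ?divr_gt0// ?ltr_wpDl// lt_neqAle eq_sym un0.
    by lra.
  by exists z; split; [exact: segm_l|exact: AD].
move/rP; rewrite Normc.normcM normc_real ger0_norm; last by rewrite addr_ge0.
rewrite mulrDl divfK ?gt_eqF//; have := ler_norm r; lra.
Qed.

Lemma inside_asym A B : compact A -> compact B -> A !=set0 -> B !=set0 ->
  inside A B -> inside B A -> False.
Proof.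
move=> cA cB A0 B0 iAB iBA.
have [z [Az zmax]] := compact_max A0 cA (@normc_continuous R).
have [w [Bw zw]] := inside_max cB B0 iAB Az.
have [z' [Az' wz']] := inside_max cA A0 iBA Bw.
by have := zmax z' Az'; rewrite leNgt (lt_trans zw wz').
Qed.

(** The component [D] of the complement of [J2] that contains [A] misses [J3], by asymmetry. So [D]
    together with [J2] is a connected set avoiding [J3], and lies in the same component as [J2]. *)
Lemma inside_trans A J2 J3 : compact J2 -> compact J3 -> J2 !=set0 -> J3 !=set0 ->
  connected J2 -> connected J3 -> J2 `&` J3 = set0 ->
  inside A J2 -> inside J2 J3 -> inside A J3.
Proof.
move=> cJ2 cJ3 J20 J30 cn2 cn3 dis [D [cD bD AD]] i23.
have [D' [cD' bD' JD']] := i23.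
have [_ cnD DJ mD] := components_prop cD.
have [_ _ DJ' mD'] := components_prop cD'.
have nJ3 x : J3 x -> ~ D x.
  move=> J3x Dx; apply: (inside_asym cJ2 cJ3) => //.
  exists D; split=> //; apply: mD => //; last by exists x.
  by move=> y J3y J2y; have : (J2 `&` J3) y by []; rewrite dis.
have clJ2 := plane_compact_closed cJ2.
have cU := component_union_connected clJ2 J20 cn2 cD.
exists D'; split=> //; apply: subset_trans AD _; apply: subset_trans (_ : D `|` J2 `<=` D').
  by move=> x Dx; left.
apply: mD' => //; last by have [x J2x] := J20; exists x; split; [right|exact: JD'].
move=> y [Dy J3y|J2y J3y]; first exact: nJ3 Dy.
by have : (J2 `&` J3) y by []; rewrite dis.
Qed.

Lemma open_connected_arc A p q : open A -> connected A -> A p -> A q ->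
  exists L, [/\ compact L, connected L, L `<=` A, L p & L q].
Proof.
move=> oA cA Ap Aq.
pose P := [set y | exists L, [/\ compact L, connected L, L `<=` A, L p & L y]].
apply: (@connected_locconst _ A P cA _ p q) => //; last first.
  by exists [set p]; split=> //; [exact: compact_set1|exact: connected1|move=> _ ->].
move=> z Az; have := open_nbhs_nbhs (conj oA Az) => /nbhs_normcP[e [e0 eA]].
apply/nbhs_normcP; exists e; split=> // y yz Ay.
have zz : normc (z - z) < e by rewrite subrr Normc.normc0.
have ext u v : normc (u - z) < e -> normc (v - z) < e -> P u -> P v.
  move=> uz vz [L [cL cnL LA Lp Lu]]; exists (L `|` segm u v); split.
  - by apply: compactU => //; exact: compact_segm.
  - by apply: connectedU => //; [exists u; split=> //; exact: segm_l|exact: connected_segm].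
  - by move=> t [/LA//|/(segm_disc uz vz)/eA].
  - by left.
  - by right; exact: segm_r.
by split; exact: ext.
Qed.
End PlaneComponents.

(** * Polynomial maps as open and closed maps of the sphere *)

Section PolymapTopology.
Variable R : realType.
Local Notation C := R[i].
Local Notation S := (sphere R).
Local Notation pt := (@pt R).
Local Notation infty := (@infty R).
Implicit Types (e r s d : R) (p f g : {poly C}) (G : set {poly C}).

Lemma polymap_nbhs_image p (z : S) (V : set S) : (1 < size p)%N -> nbhs z V ->
  nbhs (polymap p z) (polymap p @` V).
Proof.
move=> sp; case: z => [z|].
  move=> /nbhs_ptP/nbhs_normcP[e [e0 eV]].
  have [d [d0 dP]] := poly_open_map z sp e0.
  apply/nbhs_ptP/nbhs_normcP; exists d; split=> // w /dP[y [ye yw]].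
  by exists (pt y); [exact: eV|rewrite /= yw].
move=> /nbhs_inftyP[Vi [r [r0 rV]]].
have A0 : [set y : C | normc (y - 0) <= r] !=set0.
  by exists 0; rewrite /= subrr Normc.normc0 ltW.
have [m [_ mM]] := compact_max A0 (@compact_disc _ 0 r) (@normc_poly_continuous _ p).
apply/nbhs_inftyP; split; first by exists infty.
exists (normc p.[m] + 1); split; first by rewrite ltr_wpDl// normc_ge0.
move=> w hw; have [[z|//] [zw]] := polymap_surj sp (pt w).
exists (pt z); last by rewrite /= zw.
apply: rV; rewrite leNgt; apply/negP => zr.
have : normc p.[z] <= normc p.[m] by apply: mM; rewrite /= subr0 ltW.
by rewrite zw; lra.
Qed.

Lemma polymap_closed_image p (A : set S) : (1 < size p)%N -> closed A -> closed (polymap p @` A).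
Proof.
move=> sp cA; apply: compact_closed; first exact: sphere_hausdorff.
apply: continuous_compact; last exact: sphere_closed_compact.
by apply: continuous_subspaceT; exact: polymap_continuous.
Qed.

Lemma polymap_closed_preimage p (A : set S) : (1 < size p)%N -> closed A -> closed (polymap p @^-1` A).
Proof. by move=> sp cA; apply: closed_comp => // z _; exact: polymap_continuous. Qed.

(** The image of a clopen part of the preimage is closed by compactness and relatively open because
    [polymap p] is an open map. *)
Lemma preimage_part_onto p (J Q : set S) : (1 < size p)%N -> closed J -> connected J ->
  (forall z, (polymap p @^-1` J) z -> \forall y \near z, (polymap p @^-1` J) y -> (Q y <-> Q z)) ->
  (exists2 z, (polymap p @^-1` J) z & Q z) ->
  forall w, J w -> exists2 z, Q z & polymap p z = w.
Proof.
move=> sp cJ cnJ loc [z0 Jz0 Qz0] w Jw.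
pose E := polymap p @^-1` J.
have cE : closed E := polymap_closed_preimage sp cJ.
have cEQ : closed (E `&` Q).
  by apply: compact_closed; [exact: sphere_hausdorff|apply: compact_locconst => //; exact: sphere_closed_compact].
suff : (polymap p @` (E `&` Q)) w by move=> [z [_ Qz] zw]; exists z.
apply: (connected_locconst cnJ _ Jz0 Jw); last by exists z0.
move=> y Jy; have [Wy|nWy] := pselect ((polymap p @` (E `&` Q)) y).
  have [z [Ez Qz] zy] := Wy.
  have := polymap_nbhs_image sp (loc z Ez); rewrite zy.
  apply: filterS => _ [v vP <-] Jv; split=> // _; exists v => //.
  by split=> //; apply/vP.
have := open_nbhs_nbhs (conj (closed_openC (polymap_closed_image sp cEQ)) nWy).
by apply: filterS => v nv Jv; split.
Qed.

(** A sequence of the family composed with [g] stays in the family. Its uniform convergence on the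
    compact set [closure V] is carried to [g(V)] by a pointwise section [sel] of [g], which need not
    be continuous. *)
Lemma Fatou_forward G g (z : S) : (forall f g, G f -> G g -> G (f \Po g)) ->
  G g -> (1 < size g)%N -> Fatou G z -> Fatou G (polymap g z).
Proof.
move=> Gcomp Gg sg [U [[oU Uz] nU]].
have [V Vz VU] : exists2 V, nbhs z V & closure V `<=` U.
  have zT : nbhs z [set: S] by exact: filterT.
  have := compact_regular (@sphere_hausdorff R) (@sphere_compact R) zT.
  by move=> /(_ U (open_nbhs_nbhs (conj oU Uz)))[V Vz VU]; exists V.
exists (interior (polymap g @` V)); split.
  split; first exact: open_interior.
  exact: polymap_nbhs_image.
move=> u uG.
have [|phi [h [hphi hP]]] := nU (fun n => u n \o polymap g).
  move=> n; have [f Gf fu] := uG n; exists (f \Po g); first exact: Gcomp.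
  by rewrite polymap_comp fu.
have /choice[sel selP] : forall w, exists v, (polymap g @` V) w -> V v /\ polymap g v = w.
  move=> w; have [[v Vv vw]|nw] := pselect ((polymap g @` V) w); first by exists v.
  by exists w.
exists phi, (h \o sel); split=> // K _ KV e e0.
have cV : compact (closure V) by apply: sphere_closed_compact; exact: closed_closure.
apply: filterS (hP _ cV VU e e0) => n hn w /KV/interior_subset/selP[Vs sw].
by have /= := hn (sel w) (subset_closure Vs); rewrite sw.
Qed.
End PolymapTopology.

(** * Level curves close to a Julia component *)

Section Dynamics.
Variables (R : realType) (G : set {poly R[i]}).
Local Notation C := R[i].
Local Notation S := (sphere R).
Local Notation pt := (@pt R).
Local Notation infty := (@infty R).
Hypothesis hG : class_G G.
Implicit Types (z w a : C) (e r s d : R) (p f g : {poly C}) (J : set S).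

Lemma G_comp f g : G f -> G g -> G (f \Po g).
Proof. by case: hG => -[A [_ _ ->]] _ _; exact: semigroup_gen_comp. Qed.

Lemma G_size f : G f -> (2 < size f)%N.
Proof. by case: hG => _ + _; apply. Qed.

Lemma G_size1 f : G f -> (1 < size f)%N.
Proof. by move=> /G_size; exact: ltnW. Qed.

Lemma G_nonempty : exists g, G g.
Proof. by case: hG => -[A [[p Ap] _ ->]] _ _; exists p; exact: semigroup_gen_base. Qed.

Lemma G_critical_bound : exists r, 0 < r /\
  forall f c, G f -> root f^`() c -> normc f.[c] < r.
Proof.
case: hG => _ _ /bounded_setP[r rP]; exists (`|r| + 1); split.
  by rewrite ltr_wpDl.
move=> f c Gf fc; apply: le_lt_trans (_ : r < _); last by have := ler_norm r; lra.
apply: rP; apply: subset_closure; exists f => //; exists (pt c) => //.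
Qed.

Lemma exists_critical_point p : (2 < size p)%N -> exists c, root p^`() c.
Proof.
move=> sp; apply/closed_rootP; apply/eqP => s1.
have : p^`()`_(size p).-2 = 0 by apply: nth_default; rewrite s1 -ltnS -(ltn_predK sp) ltnS; case: (size p) sp => [|[|[]]].
rewrite coef_deriv; have -> : (size p).-2.+1 = (size p).-1 by case: (size p) sp => [|[|[]]].
move/eqP; rewrite mulrn_eq0 -lead_coefE lead_coef_eq0 -size_poly_eq0.
by case: (size p) sp => [|[|[]]].
Qed.

(** By the chain rule a critical point [c] of [q] is critical for [f \Po q], so [f] sends [q.[c]] to
    a critical value of an element of [G]. *)
Lemma G_bounded_point : exists r z0, 0 < r /\
  (forall f c, G f -> root f^`() c -> normc f.[c] < r) /\
  (forall f, G f -> normc f.[z0] < r).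
Proof.
have [r [r0 rP]] := G_critical_bound; have [q Gq] := G_nonempty.
have [c qc] := exists_critical_point (G_size Gq).
exists r, q.[c]; split=> //; split=> // f Gf.
have := rP (f \Po q) c (G_comp Gf Gq); rewrite horner_comp; apply.
by rewrite deriv_comp rootM qc orbT.
Qed.

Lemma Julia_closed : closed (Julia G).
Proof.
apply: open_closedC; rewrite openE => z [U [oU nU]].
have [oU1 _] := oU.
apply: filterS (open_nbhs_nbhs oU) => w Uw; by exists U.
Qed.

Lemma Julia_preimage g (z : S) : G g -> Julia G (polymap g z) -> Julia G z.
Proof. by move=> Gg Jg Fz; apply: Jg; apply: Fatou_forward => //; [exact: G_comp|exact: G_size1]. Qed.

Lemma Julia_component_closed J : components (Julia G) J -> closed J.
Proof. by move=> [x _ <-]; apply: component_closed; exact: Julia_closed. Qed.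

Lemma planar_component_plane J : planar_components G J ->
  [/\ compact (pt @^-1` J), connected (pt @^-1` J), (pt @^-1` J) !=set0 & pt @` (pt @^-1` J) = J].
Proof.
move=> [cJ nJ]; have [[x Jx] cnJ _ _] := components_prop cJ.
split.
- by apply: compact_preimage_pt => //; exact: Julia_component_closed.
- exact: connected_preimage_pt.
- by case: x Jx => [x|//] Jx; exists x.
- exact: image_preimage_pt.
Qed.

Lemma planar_component_nbhd J (O : set C) : planar_components G J -> open O ->
  pt @^-1` J `<=` O -> exists N : set C, [/\ open N, pt @^-1` J `<=` N, N `<=` O,
    compact (closure N) & forall y, closure N y -> ~ N y -> Fatou G (pt y)].
Proof.
move=> pJ oO JO; have [cJ cnJ J0 JE] := planar_component_plane pJ.
have [[x Jx xJ] nJ] := pJ.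
have [r [r0 rP]] := plane_compact_bounded cJ.
have [||N [oN JN cNO NJ]] := @component_separation _ (@sphere_hausdorff R) (@sphere_compact R)
   (Julia G) x (pt @` (O `&` [set z | normc (z - 0) < r])) Julia_closed Jx.
- by apply: open_pt; apply: openI => //; exact: open_disc.
- rewrite xJ -JE => _ [z Jz <-]; exists z => //; split; first exact: JO.
  by rewrite /= subr0; exact: rP.
have clN : closure (pt @^-1` N) `<=` pt @^-1` (closure N).
  rewrite [X in _ `<=` X](closure_id _).1.
    by apply: closureS => z Nz; exact: (@subset_closure _ N (pt z)).
  by apply: closed_preimage_pt; exact: closed_closure.
exists (pt @^-1` N); split.
- exact: open_preimage_pt.
- by move=> z Jz; apply: JN; rewrite xJ.
- by move=> z Nz; have [y [Oy _] [<-]] := cNO _ (@subset_closure _ N (pt z) Nz).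
- apply: (@compact_bounded_closed _ _ r); first exact: closed_closure.
  move=> z /clN/cNO[y [_ + [yz]]]; rewrite /= subr0 yz; exact: ltW.
- move=> y /clN cy nNy; apply: contrapT => Jy; apply: nNy.
  by apply: NJ.
Qed.

(* On a disc around a Fatou point the family is comparable with its value at one point, so along
   an ultrafilter it is bounded on the disc or tends to infinity uniformly there. *)
Lemma level_curve (N : set C) z0 d r0 : open N -> compact (closure N) ->
  (forall y, closure N y -> ~ N y -> Fatou G (pt y)) ->
  N z0 -> Julia G (pt z0) -> 0 < d ->
  exists f r, [/\ G f, r0 < r, [set z | normc f.[z] = r] `<=` N &
    exists y, normc (y - z0) < d /\ normc f.[y] = r].
Proof.
move=> oN cN NF Nz0 Jz0 d0.
have [R0 [R00 R0P]] := G_critical_bound.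
have [e [e0 eN]] := (open_normcP _).1 oN z0 Nz0.
pose d' := Num.min d e.
have d'0 : 0 < d' by rewrite lt_min d0.
have dd' y : normc (y - z0) < d' -> normc (y - z0) < d /\ N y.
  by rewrite lt_min => /andP[? /eN].
have /choice[u uP] : forall n : nat, exists u : {poly C} * (C * C),
   [/\ G u.1, normc (u.2.1 - z0) < d', normc (u.2.2 - z0) < d',
    normc u.1.[u.2.1] < 1 & n%:R < normc u.1.[u.2.2] ].
  move=> n; have [f [x [y H]]] := Julia_oscillation n%:R Jz0 d'0 ltr01.
  by exists (f, (x, y)).
pose f n := (u n).1.
have Gf n : G (f n) by have [] := uP n.
have [F [UF oF]] := free_ultrafilter.
have PF : ProperFilter F by exact: ultra_proper.
pose B := closure N `&` ~` N.
have cB : compact B by apply: compact_closedI => //; exact: open_closedC.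
have /choice[dx dxP] : forall x, exists d, B x -> 0 < d /\ exists K, forall M, \forall n \near F,
    forall y, normc (y - x) < d -> normc (f n).[y] <= K \/ M < normc (f n).[y].
  move=> x; have [Bx|nBx] := pselect (B x); last by exists 0.
  have [dd [dd0 ddP]] : exists d, 0 < d /\ forall K, exists K', forall f, G f ->
    (exists y, normc (y - x) < d /\ normc f.[y] <= K) ->
    forall y, normc (y - x) < d -> normc f.[y] <= K'.
    by apply: Fatou_comparison; apply: NF; case: Bx.
  exists dd => _; split=> //.
  pose A M := [set n | exists y, normc (y - x) < dd /\ normc (f n).[y] <= M].
  have [[M FA]|nA] := pselect (exists M, F (A M)).
    have [K' K'P] := ddP M; exists K' => M'; apply: filterS FA => n An y yd.
    by left; exact: K'P An y yd.
  exists 0 => M; have [FA|FA] := in_ultra_setVsetC (A M) UF.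
    by case: nA; exists M.
  apply: filterS FA => n nAn y yd; right; rewrite ltNge; apply/negP => yM.
  by apply: nAn; exists y.
(* Finitely many of the discs cover [B]; the largest of their bounds serves for all of [B],
   whichever alternative holds on each disc. *)
have [K KP] : exists K, forall M, \forall n \near F, forall y, B y ->
    normc (f n).[y] <= K \/ M < normc (f n).[y].
  move: cB; rewrite compact_cover => cB.
  have [||D DB DC] := cB C B (fun x => [set y | normc (y - x) < dx x]).
  - by move=> x _; exact: open_disc.
  - move=> x Bx; exists x => //=; rewrite subrr Normc.normc0.
    by have [] := dxP x Bx.
  have fin (s : seq C) : (forall x, x \in s -> B x) -> exists K, forall M, \forall n \near F,
      forall x y, x \in s -> normc (y - x) < dx x -> normc (f n).[y] <= K \/ M < normc (f n).[y].
    elim: s => [_|x s IH sB]; first by exists 0 => M; apply: nearW => n x y.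
    have [|K1 K1P] := IH; first by move=> y ys; apply: sB; rewrite in_cons ys orbT.
    have [_ [K2 K2P]] := dxP x (sB x (mem_head _ _)).
    exists (Num.max K1 K2) => M; apply: filterS2 (K1P M) (K2P M) => n h1 h2 x' y.
    rewrite in_cons => /orP[/eqP->|x's] yd.
      by have [h|h] := h2 y yd; [left; rewrite le_max h orbT|right].
    by have [h|h] := h1 x' y x's yd; [left; rewrite le_max h|right].
  have [|K KP] := fin (finmap.enum_fset D); first by move=> x xD; have := DB x xD; rewrite inE.
  exists K => M; apply: filterS (KP M) => n Hn y By.
  by have [x xD yd] := DC y By; exact: Hn x y xD yd.
(* Above [K], so that the moduli on [B], at most [K] or more than [r + 1], skip [r]; above 1, so
   that [f n] takes the modulus [r] near [z0]; above [R0], so that the level curve is connected. *)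
pose r := Num.max (Num.max K r0) (Num.max 1 R0) + 1.
have rK : K < r by rewrite ltr_pwDr// !le_max lexx.
have rr0 : r0 < r by rewrite ltr_pwDr// !le_max lexx orbT.
have r1 : 1 < r by rewrite ltr_pwDr// !le_max lexx !orbT.
have rR0 : R0 < r by rewrite ltr_pwDr// !le_max lexx !orbT.
have Fr : F [set n | r <= n%:R].
  apply: oF; have := nbhs_infty_ger r; exact.
have [n [Hn rn]] := @filter_ex _ F _ _ (@filterI _ F _ _ _ (KP (r + 1)) Fr).
have [_ xd yd fx fy] := uP n.
have [y [yd' yr]] : exists y, normc (y - z0) < d' /\ normc (f n).[y] = r.
  have := @connected_IVT _ R _ (fun z => normc (f n).[z]) _ _ r (@connected_disc R z0 d') _ xd yd.
  move=> /(_ _ _ _)[|||y [yd' yr]]; last by exists y.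
  - by move=> z _; exact: normc_poly_continuous.
  - exact: lt_trans fx r1.
  - exact/ltW/(le_lt_trans rn).
exists (f n), r; split=> //; last by exists y; split=> //; have [] := dd' y yd'.
have cnC : connected [set z | normc (f n).[z] = r].
  apply: connected_circle_preimage; [exact: G_size1|exact: lt_trans r1|].
  by move=> c fc; apply: lt_trans rR0; exact: R0P.
(* The connected curve meets [N] and misses its boundary, so it stays in [N]. *)
move=> z zr; have [_ Ny] := dd' y yd'.
apply: (connected_locconst cnC _ yr zr Ny) => v vr.
have [Nv|nNv] := pselect (N v).
  by have := open_nbhs_nbhs (conj oN Nv); apply: filterS.
have ncl : (~` closure N) v.
  move=> clv; have [h|h] := Hn v (conj clv nNv); move: h; rewrite vr; lra.
have := open_nbhs_nbhs (conj (closed_openC (@closed_closure _ N)) ncl).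
by apply: filterS => t nt _; split=> // Nt; exfalso; apply: nt; exact: subset_closure.
Qed.

Lemma level_curve_planar J (O : set C) z0 d r0 : planar_components G J -> open O ->
  pt @^-1` J `<=` O -> J (pt z0) -> 0 < d ->
  exists f r, [/\ G f, r0 < r, [set z | normc f.[z] = r] `<=` O &
    exists y, normc (y - z0) < d /\ normc f.[y] = r].
Proof.
move=> pJ oO JO Jz0 d0.
have [N [oN JN NO cN NF]] := planar_component_nbhd pJ oO JO.
have Jul : Julia G (pt z0) by have [/components_prop[_ _ JJ _] _] := pJ; exact: JJ.
have [f [r [Gf r0r fN ex]]] := level_curve r0 oN cN NF (JN z0 Jz0) Jul d0.
by exists f, r; split=> //; exact: subset_trans fN NO.
Qed.
End Dynamics.

(** * Nested Julia components, their preimages and the Fatou components *)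

Section Order.
Variables (R : realType) (G : set {poly R[i]}).
Local Notation C := R[i].
Local Notation S := (sphere R).
Local Notation pt := (@pt R).
Local Notation infty := (@infty R).
Hypothesis hG : class_G G.
Implicit Types (z w a : C) (e r s d : R) (p f g : {poly C}) (J K : set S).

(** If [D] were unbounded, an arc [L] in [D] would lead from [z0] beyond the disc containing [J]. A
    level curve close to [J] avoids both [L] and the exterior of that disc, yet [|f|] passes the
    level on their connected union, being below it at [z0] and above it far out. *)
Lemma postcritical_point_enclosed : exists z0, forall J D, planar_components G J ->
  components (~` (pt @^-1` J)) D -> D z0 -> bounded_set D.
Proof.
have [R0 [z0 [R00 [R0P z0P]]]] := G_bounded_point hG.
exists z0 => J D pJ cD Dz0; apply: contrapT => nbD.
have [cJ cnJ [w Jw] JE] := planar_component_plane pJ.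
have [rho [rho0 rhoP]] := plane_compact_bounded cJ.
have [_ cnD DJ _] := components_prop cD.
have oD : open D.
  by case: cD => y _ <-; apply: plane_component_open; apply: closed_openC; exact: plane_compact_closed.
have [q [Dq qrho]] : exists q, D q /\ rho <= normc q.
  apply: contrapT => H; apply: nbD; apply/bounded_setP; exists rho => z Dz.
  by rewrite leNgt; apply/negP => zr; apply: H; exists z; split=> //; exact: ltW.
have [L [cL cnL LD Lz0 Lq]] := open_connected_arc oD cnD Dz0 Dq.
have oO : open ([set z : C | normc (z - 0) < rho] `&` ~` L).
  apply: openI; first exact: open_disc.
  by apply: closed_openC; exact: plane_compact_closed.
have JO : pt @^-1` J `<=` [set z : C | normc (z - 0) < rho] `&` ~` L.
  by move=> z Jz; split; [rewrite /= subr0; exact: rhoP|move/LD/DJ].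
have [f [r [Gf R0r curve _]]] := level_curve_planar hG R0 pJ oO JO Jw ltr01.
have [s [s0 sP]] := poly_growth r (G_size1 hG Gf).
have ns : normc (Num.max rho s)%:C%C = Num.max rho s.
  by rewrite normc_real ger0_norm// le_max ltW.
have cnT : connected (L `|` [set z | rho <= normc z]).
  by apply: connectedU => //; [exists q|exact: connected_exterior].
have Tz0 : (L `|` [set z | rho <= normc z]) z0 by left.
have Tm : (L `|` [set z | rho <= normc z]) (Num.max rho s)%:C%C.
  by right; rewrite /= ns le_max lexx.
have fm : r <= normc f.[(Num.max rho s)%:C%C] by apply: sP; rewrite ns le_max lexx orbT.
have cf z : (L `|` [set z | rho <= normc z]) z -> {for z, continuous (fun z => normc f.[z])}.
  by move=> _; exact: (@normc_poly_continuous R f z).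
have [z [Tz zr]] := connected_IVT cnT cf Tz0 Tm (lt_trans (z0P f Gf) R0r) fm.
have [zrho nLz] := curve z zr.
case: Tz => [//|]; rewrite /= leNgt; move: zrho; rewrite /= subr0 => ->.
by [].
Qed.

Lemma surround_leP J K : ~ J infty ->
  surround_le J K <-> J = K \/ inside (pt @^-1` J) (pt @^-1` K).
Proof.
move=> nJ; split=> -[->|[D [cD bD JD]]]; [by left| |by left| ]; right; exists D; split=> //.
  by move=> z /JD[y Dy [<-]].
by move=> [z|//] Jz; exists z => //; exact: JD.
Qed.

Lemma planar_disjoint J K : planar_components G J -> planar_components G K -> J <> K ->
  pt @^-1` J `&` pt @^-1` K = set0.
Proof.
move=> [cJ _] [cK _] JK; apply/seteqP; split=> // z [Jz Kz]; apply: JK.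
by apply: (components_eq cJ cK); exists (pt z).
Qed.

(** Suppose each lies in an unbounded component of the complement of the other. Unless [z0] is in
    [J], its component [E] off [J] is bounded, so [E] misses [K]. Then [E] with [J] is connected off
    [K] and puts [z0] into [DK], which is thereby bounded. *)
Lemma planar_total J K : planar_components G J -> planar_components G K -> J <> K ->
  inside (pt @^-1` J) (pt @^-1` K) \/ inside (pt @^-1` K) (pt @^-1` J).
Proof.
move=> pJ pK JK.
have [z0 enc] := postcritical_point_enclosed.
have [cJ cnJ [x Jx] _] := planar_component_plane pJ.
have [cK cnK [y Ky] _] := planar_component_plane pK.
have dis := planar_disjoint pJ pK JK.
have JnK : pt @^-1` J `<=` ~` (pt @^-1` K).
  by move=> z Jz Kz; have : (pt @^-1` J `&` pt @^-1` K) z by []; rewrite dis.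
have KnJ : pt @^-1` K `<=` ~` (pt @^-1` J) by move=> z Kz Jz; exact: (JnK z Jz).
pose DK := connected_component (~` (pt @^-1` K)) x.
pose DJ := connected_component (~` (pt @^-1` J)) y.
have cDK : components (~` (pt @^-1` K)) DK by exists x => //; exact: JnK.
have cDJ : components (~` (pt @^-1` J)) DJ by exists y => //; exact: KnJ.
have JDK : pt @^-1` J `<=` DK by exact: connected_component_max.
have KDJ : pt @^-1` K `<=` DJ by exact: connected_component_max.
have [bK|nbK] := pselect (bounded_set DK); first by left; exists DK.
have [bJ|nbJ] := pselect (bounded_set DJ); first by right; exists DJ.
exfalso; apply: nbK; apply: (enc K DK pK cDK).
have [Jz0|nJz0] := pselect ((pt @^-1` J) z0); first exact: JDK.
pose E := connected_component (~` (pt @^-1` J)) z0.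
have cE : components (~` (pt @^-1` J)) E by exists z0.
have Ez0 : E z0 by exact: connected_component_refl.
have bE := enc J E pJ cE Ez0.
have cU := component_union_connected (plane_compact_closed cJ) (ex_intro _ x Jx) cnJ cE.
have [_ _ _ mDK] := components_prop cDK.
apply: (mDK _ cU); [|by exists x; split; [right|exact: JDK]|by left].
move=> u [Eu Ku|Ju]; last exact: JnK.
by apply: nbJ; rewrite (components_eq cDJ cE)//; exists u; split=> //; exact: KDJ.
Qed.

(** Two clopen parts of the preimage would both map onto [J], so both contain points over the same
    [z0]. A level curve of [f] near [J] passing close to [z0] lifts near both points. Its full lift
    is a level curve of [f \Po g], connected, yet contained in the disjoint sets [N1] and [N2]. If
    [J] contains infinity, both parts contain its only preimage. *)
Lemma preimage_component_connected g J : G g -> components (Julia G) J ->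
  connected (polymap g @^-1` J).
Proof.
move=> Gg cJ; have sg := G_size1 hG Gg.
have clJ := Julia_component_closed cJ.
have [[w0 Jw0] cnJ _ _] := components_prop cJ.
apply: locconst_connected => P x y loc Ex Ey Px; apply: contrapT => nPy.
have loc' (z : S) : (polymap g @^-1` J) z -> \forall y \near z, (polymap g @^-1` J) y -> ((~` P) y <-> (~` P) z).
  move=> Ez; have := loc z Ez; apply: filterS => u + Eu => /(_ Eu) [h1 h2].
  by split=> np p; apply: np; [exact: h2|exact: h1].
have ontoP := preimage_part_onto sg clJ cnJ loc (ex_intro2 _ _ x Ex Px).
have ontoN := preimage_part_onto sg clJ cnJ loc' (ex_intro2 _ _ y Ey nPy).
have [Ji|nJi] := pselect (J infty).
  have [u Pu /polymap_inftyP ui] := ontoP _ Ji; have [v Pv /polymap_inftyP vi] := ontoN _ Ji.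
  by apply: Pv; rewrite vi -ui.
have pJ : planar_components G J by [].
case: w0 Jw0 => [z0|//] Jz0.
have [[y1|//] Py1 [gy1]] := ontoP _ Jz0; have [[y2|//] Py2 [gy2]] := ontoN _ Jz0.
have [R0 [R00 R0P]] := G_critical_bound hG.
have clE : closed (polymap g @^-1` J) by exact: polymap_closed_preimage.
have cE1 : compact ((polymap g @^-1` J) `&` P).
  by apply: compact_locconst => //; exact: sphere_closed_compact.
have cE2 : compact ((polymap g @^-1` J) `&` ~` P).
  by apply: compact_locconst => //; exact: sphere_closed_compact.
have cl1 := closed_preimage_pt (compact_closed (@sphere_hausdorff R) cE1).
have cl2 := closed_preimage_pt (compact_closed (@sphere_hausdorff R) cE2).
have [|N1 [N2 [oN1 oN2 EN1 EN2 N12]]] := plane_separation cl1 cl2.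
  by apply/seteqP; split=> // u [[_ ?] []].
have N12' u : N1 u -> ~ N2 u by move=> h1 h2; have : (N1 `&` N2) u by []; rewrite N12.
(* Open because [g] is a closed map; a curve in [O] has all its preimages in [N1] or [N2]. *)
pose O := [set w | forall z, g.[z] = w -> N1 z \/ N2 z].
have oO : open O.
  have -> : O = pt @^-1` (~` (polymap g @` (~` (pt @` (N1 `|` N2))))).
    apply/seteqP; split=> w.
      move=> Ow [[z|//] nz [zw]]; apply: nz; exists z => //; exact: Ow.
    move=> nw z zw; apply: contrapT => nN; apply: nw; exists (pt z); last by rewrite /= zw.
    by move=> [u Nu [uz]]; apply: nN; rewrite -uz.
  apply: open_preimage_pt; apply: closed_openC; apply: polymap_closed_image => //.
  by apply: open_closedC; apply: open_pt; exact: openU.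
have JO : pt @^-1` J `<=` O.
  move=> w Jw z zw; have Ez : (polymap g @^-1` J) (pt z) by rewrite /= zw.
  by have [p|p] := pselect (P (pt z)); [left; apply: EN1|right; apply: EN2].
have N1y1 : N1 y1 by apply: EN1; split=> //=; rewrite gy1.
have N2y2 : N2 y2 by apply: EN2; split=> //=; rewrite gy2.
have [e1 [e10 e1P]] := (open_normcP _).1 oN1 y1 N1y1.
have [e2 [e20 e2P]] := (open_normcP _).1 oN2 y2 N2y2.
have [d1 [d10 d1P]] := poly_open_map y1 sg e10.
have [d2 [d20 d2P]] := poly_open_map y2 sg e20.
have d0 : 0 < Num.min d1 d2 by rewrite lt_min d10.
have [f [r [Gf R0r curve [v [vd vr]]]]] := level_curve_planar hG R0 pJ oO JO Jz0 d0.
move: vd; rewrite lt_min => /andP[vd1 vd2].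
rewrite -gy1 in vd1; rewrite -gy2 in vd2.
have [x1 [/e1P N1x1 gx1]] := d1P v vd1; have [x2 [/e2P N2x2 gx2]] := d2P v vd2.
have Gh := G_comp hG Gf Gg.
have cnC : connected [set z | normc (f \Po g).[z] = r].
  apply: connected_circle_preimage; [exact: (G_size1 hG Gh)|exact: lt_trans R0r|].
  by move=> c fc; apply: lt_trans R0r; exact: R0P.
apply: (N12' x2 _ N2x2).
have A1 : [set z | normc (f \Po g).[z] = r] x1 by rewrite /= horner_comp gx1.
have A2 : [set z | normc (f \Po g).[z] = r] x2 by rewrite /= horner_comp gx2.
apply: (connected_locconst cnC _ A1 A2 N1x1).
move=> u ur; have [N1u|N2u] : N1 u \/ N2 u by apply: (curve g.[u]) => //; rewrite /= -horner_comp.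
  by have := open_nbhs_nbhs (conj oN1 N1u); apply: filterS.
have := open_nbhs_nbhs (conj oN2 N2u); apply: filterS => t N2t _.
by split=> h; exfalso; [exact: (N12' t)|exact: (N12' u)].
Qed.

Lemma exists_pullback g J : G g -> components (Julia G) J -> exists! J', is_pullback G g J J'.
Proof.
move=> Gg cJ; have sg := G_size1 hG Gg.
have [[w Jw] _ JJ _] := components_prop cJ.
have [x xw] := polymap_surj sg w.
have Jx : Julia G x by apply: (Julia_preimage hG Gg); rewrite xw; exact: JJ.
have sub : polymap g @^-1` J `<=` Julia G by move=> z Jz; apply: (Julia_preimage hG Gg); exact: JJ.
have Ex : (polymap g @^-1` J) x by rewrite /= xw.
exists (connected_component (Julia G) x); split.
  split; first by exists x.
  by apply: connected_component_max => //; exact: preimage_component_connected.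
move=> K [cK EK]; apply: (components_eq _ cK); first by exists x.
by exists x; split; [exact: connected_component_refl|exact: EK].
Qed.

Lemma pullbackP g J : G g -> components (Julia G) J -> is_pullback G g J (pullback G g J).
Proof. by move=> Gg cJ; apply: getPex; have [K [PK _]] := exists_pullback Gg cJ; exists K. Qed.

(** Suppose [K] contains infinity. For every [f] in [G] the connected set [f^-1(K)] contains
    infinity and so lies in [K]. Choose a level curve of [f] off [K], close to [J], at a level above
    [|a|] for a point [a] of [K]. Then [f^-1(K)] joins a point over [a], below the level, to
    infinity without crossing the level. *)
Lemma planar_pullback g J : G g -> planar_components G J -> planar_components G (pullback G g J).
Proof.
move=> Gg pJ; have [cJ nJ] := pJ; have [cK EK] := pullbackP Gg cJ.
set K := pullback G g J in cK EK *; split=> // Ki.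
have sg := G_size1 hG Gg.
have [_ _ [w Jw] _] := planar_component_plane pJ.
have [[a|//] [aw]] := polymap_surj sg (pt w).
have Ka : K (pt a) by apply: EK; rewrite /= aw.
have [_ _ KJ mK] := components_prop cK.
have oO : open (~` (pt @^-1` K)).
  by apply: closed_openC; apply: closed_preimage_pt; exact: (Julia_component_closed cK).
have JO : pt @^-1` J `<=` ~` (pt @^-1` K).
  move=> z Jz Kz; apply: nJ; rewrite (components_eq cJ cK)//; by exists (pt z).
have [f [r [Gf ar curve _]]] := level_curve_planar hG (normc a) pJ oO JO Jw ltr01.
have sf := G_size1 hG Gf.
have cnE := preimage_component_connected Gf cK.
have EsubK : polymap f @^-1` K `<=` K.
  apply: mK => //; first by move=> z Kz; apply: (Julia_preimage hG Gf); exact: KJ.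
  by exists infty.
have [[b|//] [ba]] := polymap_surj sf (pt a).
have noC y : (polymap f @^-1` K) (pt y) -> normc f.[y] <> r.
  by move=> /EsubK Ky yr; apply: (curve y yr).
pose P : set S := fun z : S => if z is Some y then is_true (normc f.[y] < r) else False.
suff : P infty by [].
have Eb : (polymap f @^-1` K) (pt b) by rewrite /= ba.
have Ei : (polymap f @^-1` K) infty by [].
have Pb : P (pt b) by rewrite /P /= ba.
apply: (connected_locconst cnE _ Eb Ei Pb) => -[y|] Ey.
  have [yr|yr|/(noC y Ey)//] := ltgtP (normc f.[y]) r.
      have : \forall u \near y, normc f.[u] < r.
        by apply: near_continuous_lt => //; exact: (@normc_poly_continuous R f y).
      by move=> h; apply/nbhs_ptP; apply: filterS h => u ur _; rewrite /P /=.
    have : \forall u \near y, r < normc f.[u].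
      by apply: near_continuous_gt => //; exact: (@normc_poly_continuous R f y).
    move=> h; apply/nbhs_ptP; apply: filterS h => u ur _.
    by rewrite /P /=; split; [rewrite ltNge (ltW ur)|rewrite ltNge (ltW yr)].
have [s [s0 sP]] := poly_growth r sf.
apply/nbhs_inftyP; split=> //; exists s; split=> // z /sP zr _.
by rewrite /P /= ltNge zr.
Qed.

(** The image under [g] of the component [E] is connected, avoids [K] and meets [D], so it lies in
    the bounded set [D]; by growth of [g], [E] is bounded. *)
Lemma inside_preimage g J K : G g -> planar_components G J -> planar_components G K ->
  inside (pt @^-1` J) (pt @^-1` K) ->
  inside (pt @^-1` (polymap g @^-1` J)) (pt @^-1` (polymap g @^-1` K)).
Proof.
move=> Gg pJ pK [D [cD bD JD]]; have sg := G_size1 hG Gg.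
have [_ _ [w Jw] _] := planar_component_plane pJ.
have [[x|//] [xw]] := polymap_surj sg (pt w).
have [cJ nJ] := pJ.
have [_ _ DK mD] := components_prop cD.
have dis z : J (pt g.[z]) -> ~ K (pt g.[z]) by move=> Jz; exact: (DK _ (JD _ Jz)).
have Jx : J (pt g.[x]) by rewrite xw.
pose E := connected_component (~` (pt @^-1` (polymap g @^-1` K))) x.
have nx : (~` (pt @^-1` (polymap g @^-1` K))) x by exact: dis.
exists E; split.
- by exists x.
- have ED : (fun z => g.[z]) @` E `<=` D.
    apply: mD.
    + by apply: connected_image; [exact: component_connected|exact: horner_continuous].
    + by move=> _ [z /connected_component_sub Ez <-].
    + exists g.[x]; split; last exact: JD.
      by exists x => //; exact: connected_component_refl.
  have [r rP] := (bounded_setP _).1 bD.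
  have [s [s0 sP]] := poly_growth (r + 1) sg.
  apply/bounded_setP; exists s => z Ez; rewrite leNgt; apply/negP => /ltW/sP.
  have : normc g.[z] <= r by apply: rP; apply: ED; exists z.
  lra.
- apply: connected_component_max => //.
  apply: connected_preimage_pt; last by [].
  exact: preimage_component_connected.
Qed.

(** In the reversed case the pullback of [J] is connected, misses [g^-1(K)] and meets its inside,
    hence lies inside [g^-1(K)]. Then the maximal modulus on the pullback of [J] is exceeded on
    [g^-1(K)], which is part of the pullback of [K], and exceeded again on the pullback of [J]. *)
Lemma pullback_monotone g J K : G g -> planar_components G J -> planar_components G K ->
  inside (pt @^-1` J) (pt @^-1` K) ->
  pullback G g J = pullback G g K \/
  inside (pt @^-1` (pullback G g J)) (pt @^-1` (pullback G g K)).
Proof.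
move=> Gg pJ pK iJK; have sg := G_size1 hG Gg.
have [D [cD bD AD]] := inside_preimage Gg pJ pK iJK.
have pJ' := planar_pullback Gg pJ; have pK' := planar_pullback Gg pK.
have [_ EJ] := pullbackP Gg pJ.1; have [_ EK] := pullbackP Gg pK.1.
have [eq|neq] := pselect (pullback G g J = pullback G g K); [by left|right].
have [//|iKJ] := planar_total pJ' pK' neq; exfalso.
have [_ _ [w Jw] _] := planar_component_plane pJ.
have [[x|//] [xw]] := polymap_surj sg (pt w).
have [_ _ [v Kv] _] := planar_component_plane pK.
have [[y|//] [yv]] := polymap_surj sg (pt v).
have [cJ' cnJ' J'0 _] := planar_component_plane pJ'.
have dis := planar_disjoint pJ' pK' neq.
have [_ _ DK mD] := components_prop cD.
have Ax : (pt @^-1` (polymap g @^-1` J)) x by rewrite /= xw.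
have iJA : inside (pt @^-1` (pullback G g J)) (pt @^-1` (polymap g @^-1` K)).
  exists D; split=> //; apply: mD => //.
    move=> z J'z /EK K'z.
    by have : (pt @^-1` (pullback G g J) `&` pt @^-1` (pullback G g K)) z by []; rewrite dis.
  by exists x; split; [exact: EJ|exact: AD].
have cA : compact (pt @^-1` (polymap g @^-1` K)).
  apply: compact_preimage_pt; last by case: pK.
  by apply: polymap_closed_preimage => //; exact: (Julia_component_closed pK.1).
have A0 : (pt @^-1` (polymap g @^-1` K)) !=set0 by exists y; rewrite /= yv.
have [z [J'z zmax]] := compact_max J'0 cJ' (@normc_continuous R).
have [u [Au zu]] := inside_max cA A0 iJA J'z.
have [z' [J'z' uz']] := inside_max cJ' J'0 iKJ (EK _ Au).
by have := zmax z' J'z'; rewrite leNgt (lt_trans zu uz').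
Qed.

(** If every point of the plane were a Fatou point, the set [Esc] escaping under the iterates of a
    single [g] would be open with open complement: near a non-escaping point [Fatou_comparison]
    bounds all iterates, whereas escaping orbits double. But large points escape and [z0] does
    not. *)
Lemma Julia_nonempty : Julia G !=set0.
Proof.
apply: contrapT => J0.
have Fat z : Fatou G (pt z) by apply: contrapT => nF; apply: J0; exists (pt z).
have [g Gg] := G_nonempty hG.
have [R0 [z0 [R00 [_ z0P]]]] := G_bounded_point hG.
have [rho [rho0 rhoP]] := poly_escape (G_size hG Gg).
pose it := fix it n := if n is n'.+1 then g \Po it n' else g.
have Git n : G (it n) by elim: n => [|n IH] //=; exact: G_comp.
pose M := Num.max rho R0.
have M0 : 0 < M by rewrite lt_max rho0.
pose Esc := [set z : C | exists n, M <= normc (it n).[z]].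
have grow z n k : M <= normc (it n).[z] -> 2 ^+ k * M <= normc (it (k + n)%N).[z].
  move=> h; elim: k => [|k IH]; first by rewrite expr0 mul1r add0n.
  rewrite addSn /= horner_comp exprS -mulrA.
  apply: le_trans (_ : 2 * normc (it (k + n)%N).[z] <= _); first by rewrite ler_pM2l.
  apply: rhoP; apply: le_trans IH; apply: le_trans (_ : M <= _); first by rewrite le_max lexx.
  apply: ler_peMl; first exact: ltW.
  by rewrite exprn_ege1// ler1n.
have [n [n0 nP]] : exists n : C, 0 < normc n /\ M <= normc n.
  by exists (M%:C%C); rewrite normc_real gtr0_norm.
have En : Esc n.
  exists 0%N; apply: (le_trans nP); apply: le_trans (_ : 2 * normc n <= _); first by lra.
  by apply: rhoP; apply: le_trans nP; rewrite le_max lexx.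
have [m] : Esc z0; last first.
  by rewrite leNgt (lt_le_trans (z0P _ (Git m)))// le_max lexx orbT.
apply: (connected_locconst (@connected_plane R) _ I I En) => z _.
have [[k Ek]|nE] := pselect (Esc z).
  have Ek1 : M < normc (it (1 + k)%N).[z] by have := grow z k 1%N Ek; rewrite expr1; lra.
  have : \forall y \near z, M < normc (it (1 + k)%N).[y].
    by apply: near_continuous_gt => //; exact: (@normc_poly_continuous R _ z).
  by apply: filterS => y hy _; split=> _; [exists k|exists (1 + k)%N; exact: ltW].
have [d [d0 dP]] := Fatou_comparison (Fat z).
have [K' K'P] := dP M.
apply/nbhs_normcP; exists d; split=> // y yd _; split=> // -[k Ek]; exfalso.
have bd j : normc (it j).[y] <= K'.
  apply: (K'P _ (Git j)) => //; exists z; rewrite subrr Normc.normc0; split=> //.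
  by rewrite leNgt; apply/negP => h; apply: nE; exists j; exact: ltW.
have [j jP] : exists j, K' < 2 ^+ j * M.
  exists (Num.bound `|K' / M|); rewrite -ltr_pdivrMr//.
  apply: le_lt_trans (ler_norm _) _; apply: lt_trans (archi_boundP (normr_ge0 _)) _.
  by rewrite -natrX ltr_nat ltn_expl.
by have := lt_le_trans jP (grow y k j Ek); rewrite ltNge bd.
Qed.

(** Membership in [D] is locally constant off [J], at infinity because [D] is bounded. In particular
    [X] cannot contain infinity. *)
Lemma bounded_component_trap J D (X : set S) : closed J -> components (~` (pt @^-1` J)) D ->
  bounded_set D -> connected X -> X `&` J = set0 -> X `&` pt @` D !=set0 -> X `<=` pt @` D.
Proof.
move=> clJ cD bD cX XJ [x [Xx Dx]] y Xy.
have XnJ (z : S) : X z -> ~ J z by move=> h1 h2; have : (X `&` J) z by []; rewrite XJ.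
have oc : open (~` (pt @^-1` J)) by apply: closed_openC; exact: closed_preimage_pt.
apply: (connected_locconst cX _ Xx Xy Dx) => -[z|] Xz.
  have nJz : (~` (pt @^-1` J)) z by exact: XnJ.
  pose E := connected_component (~` (pt @^-1` J)) z.
  have cE : components (~` (pt @^-1` J)) E by exists z.
  have oE : open E by exact: plane_component_open.
  have Ez : E z by exact: connected_component_refl.
  have key u : E u -> ((pt @` D) (pt u) <-> D = E).
    move=> Eu; split=> [[v Dv [vu]]|->]; last by exists u.
    by apply: (components_eq cD cE); exists u; split; [rewrite -vu|].
  have := open_nbhs_nbhs (conj oE Ez) => h; apply/nbhs_ptP; apply: filterS h => u Eu _.
  by rewrite (propext (key u Eu)) (propext (key z Ez)).
have [r rP] := (bounded_setP _).1 bD.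
apply/nbhs_inftyP; split=> //; exists (`|r| + 1); split; first by rewrite ltr_wpDl.
move=> z rz _; split=> -[u Du]; last by [].
by move=> [uz]; have := rP u Du; rewrite uz; have := ler_norm r; lra.
Qed.

Section FatouComponent.
Variable U : set S.
Hypothesis cU : components (Fatou G) U.

Lemma Fatou_component_open : open U.
Proof.
have [x _ <-] := cU; apply: sphere_component_open.
by rewrite -[Fatou G]setCK; apply: closed_openC; exact: Julia_closed.
Qed.

(** A component [D] away from [closure U] would have a clopen neighbourhood in the sphere. A common
    point of [D] and [closure U] is in the Julia set, since a Fatou component around it would meet
    [U] and coincide with it. *)
Lemma complement_component_Julia D : components (~` U) D ->
  exists b, [/\ Julia G b, closure U b, D b & connected_component (Julia G) b `<=` D].
Proof.
move=> cD; have [[y Uy] cnU UF mU] := components_prop cU.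
have [_ cnD DU mD] := components_prop cD.
have oU := Fatou_component_open.
have [b [Db clb]] : exists b, D b /\ closure U b.
  apply: contrapT => H; have [x Ux xD] := cD.
  have [|||N [oN DN cNO NA]] := @component_separation _ (@sphere_hausdorff R) (@sphere_compact R)
    (~` U) x (~` closure U) _ Ux.
  - exact: open_closedC.
  - exact/closed_openC/closed_closure.
  - by rewrite xD => z Dz clz; apply: H; exists z.
  have Nx : N x by apply: DN; exact: connected_component_refl.
  have : N y.
    apply: (connected_locconst (@sphere_connected R) _ I I Nx) => z _.
    have [Nz|nNz] := pselect (N z).
      by have := open_nbhs_nbhs (conj oN Nz); apply: filterS.
    have ncl : (~` closure N) z.
      move=> clz; apply: nNz; apply: NA; split=> // Uz.
      by apply: (cNO z clz); exact: subset_closure.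
    have := open_nbhs_nbhs (conj (closed_openC (@closed_closure _ N)) ncl).
    by apply: filterS => t nt _; split=> // Nt; exfalso; apply: nt; exact: subset_closure.
  move=> Ny; apply: (cNO y (subset_closure Ny)); exact: subset_closure.
have Jb : Julia G b.
  move=> Fb.
  have oF : open (Fatou G) by rewrite -[Fatou G]setCK; apply: closed_openC; exact: Julia_closed.
  have oB := @sphere_component_open R (Fatou G) b oF.
  have [z [Uz Bz]] := clb _ (open_nbhs_nbhs (conj oB (connected_component_refl Fb))).
  apply: (DU b Db); apply: (mU (connected_component (Fatou G) b)).
  - exact: component_connected.
  - exact: connected_component_sub.
  - by exists z.
  - exact: connected_component_refl.
exists b; split=> //; apply: mD.
- exact: component_connected.
- by move=> z /connected_component_sub Jz Uz; apply: Jz; exact: UF.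
- by exists b; split=> //; exact: connected_component_refl.
Qed.

(** Each complementary component contains a Julia component touching [closure U]. Of three such
    components one lies between the other two, yet [U] joins these two without meeting it. A
    component containing infinity counts as the outermost. *)
Lemma no_three_components D1 D2 D3 : components (~` U) D1 -> components (~` U) D2 ->
  components (~` U) D3 -> D1 <> D2 -> D2 <> D3 -> D1 <> D3 -> False.
Proof.
move=> c1 c2 c3.
have [[y Uy] cnU UF mU] := components_prop cU.
have oU := Fatou_component_open.
have [b1 [J1 cl1 Db1 JD1]] := complement_component_Julia c1.
have [b2 [J2 cl2 Db2 JD2]] := complement_component_Julia c2.
have [b3 [J3 cl3 Db3 JD3]] := complement_component_Julia c3.
pose Jc b := connected_component (Julia G) b.
have cJ b : Julia G b -> components (Julia G) (Jc b) by move=> Jb; exists b.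
have JJ b : Julia G b -> Jc b b by move=> Jb; exact: connected_component_refl.
have disj D E (z : S) : components (~` U) D -> components (~` U) E -> D <> E -> D z -> ~ E z.
  by move=> cD cE DE Dz Ez; apply: DE; apply: (components_eq cD cE); exists z.
(* The case of [a] inside [b] inside [c]: the union of [U], [Da] and [Dc] is connected off [Jc b],
   so it is trapped with [Jc a] inside [Jc b], against the position of [Jc c]. *)
have main Da Db Dc (a b c : S) : components (~` U) Da -> components (~` U) Db -> components (~` U) Dc ->
    Da <> Db -> Db <> Dc -> closure U a -> closure U c -> Da a -> Dc c ->
    Julia G a -> Julia G b -> Julia G c -> Jc a `<=` Da -> Jc b `<=` Db -> Jc c `<=` Dc ->
    ~ Jc a infty -> ~ Jc b infty ->
    inside (pt @^-1` (Jc a)) (pt @^-1` (Jc b)) ->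
    (Jc c infty \/ inside (pt @^-1` (Jc b)) (pt @^-1` (Jc c))) -> False.
  move=> ca cb cc ab bc cla clc Daa Dcc Ja Jb Jcc sa sb sc na nb [D [cD bD JaD]] H.
  have [_ cnDa DaU _] := components_prop ca; have [_ cnDc DcU _] := components_prop cc.
  have [_ _ DbU _] := components_prop cb.
  have cX : connected ((U `|` Da) `|` Dc).
    have cUa := connected_closure_union cnU cnDa Daa cla.
    have clc' : closure (U `|` Da) c by apply: closureS clc => z Uz; left.
    exact: connected_closure_union cUa cnDc Dcc clc'.
  have XJ : ((U `|` Da) `|` Dc) `&` Jc b = set0.
    apply/seteqP; split=> // z [Xz /sb Dbz].
    case: Xz => [[Uz|Daz]|Dcz]; first exact: (DbU z Dbz).
      exact: (disj _ _ _ ca cb ab Daz).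
    exact: (disj _ _ _ cb cc bc Dbz).
  have clJb := Julia_component_closed (cJ b Jb).
  have sub := bounded_component_trap clJb cD bD cX XJ.
  have {}sub : (U `|` Da) `|` Dc `<=` pt @` D.
    apply: sub; case: a na JaD sa Ja Daa cla => [z|] na JaD sa Ja Daa _; last by case: na; exact: JJ.
    exists (pt z); split; first by left; right.
    by exists z => //; apply: JaD; exact: JJ.
  case: H => [Jci|ibc].
    by have [z _ //] : (pt @` D) infty by apply: sub; right; exact: sc.
  have nc : ~ Jc c infty.
    by move=> Jci; have [u _ //] : (pt @` D) infty by apply: sub; right; exact: sc.
  have [kb _ b0 _] := planar_component_plane (conj (cJ b Jb) nb).
  have [kc _ c0 _] := planar_component_plane (conj (cJ c Jcc) nc).
  apply: (inside_asym kb kc b0 c0 ibc); exists D; split=> // z Jcz.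
  by have [v Dv [<-]] : (pt @` D) (pt z) by apply: sub; right; exact: sc.
move=> n12 n23 n13.
have n21 : D2 <> D1 by move=> e; exact: n12.
have n32 : D3 <> D2 by move=> e; exact: n23.
have n31 : D3 <> D1 by move=> e; exact: n13.
have neqJ (a b : S) Da Db : components (~` U) Da -> components (~` U) Db -> Da <> Db ->
    Julia G a -> Jc a `<=` Da -> Jc b `<=` Db -> Jc a <> Jc b.
  move=> ca cb ab Ja sa sb e; apply: (disj _ _ a ca cb ab); first by apply: sa; exact: JJ.
  by apply: sb; rewrite -e; exact: JJ.
have tot (a b : S) Da Db : components (~` U) Da -> components (~` U) Db -> Da <> Db ->
    Julia G a -> Julia G b -> Jc a `<=` Da -> Jc b `<=` Db -> ~ Jc a infty -> ~ Jc b infty ->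
    inside (pt @^-1` (Jc a)) (pt @^-1` (Jc b)) \/ inside (pt @^-1` (Jc b)) (pt @^-1` (Jc a)).
  move=> ca cb ab Ja Jb sa sb na nb; apply: planar_total.
  - by split=> //; exact: cJ.
  - by split=> //; exact: cJ.
  - exact: neqJ ca cb ab Ja sa sb.
have noinf (a b : S) Da Db : components (~` U) Da -> components (~` U) Db -> Da <> Db ->
    Jc a `<=` Da -> Jc b `<=` Db -> Jc a infty -> ~ Jc b infty.
  by move=> ca cb ab sa sb /sa h1 /sb h2; exact: (disj _ _ _ ca cb ab h1).
have m1 := main D1 D2 D3 b1 b2 b3 c1 c2 c3 n12 n23 cl1 cl3 Db1 Db3 J1 J2 J3 JD1 JD2 JD3.
have m2 := main D1 D3 D2 b1 b3 b2 c1 c3 c2 n13 n32 cl1 cl2 Db1 Db2 J1 J3 J2 JD1 JD3 JD2.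
have m3 := main D2 D1 D3 b2 b1 b3 c2 c1 c3 n21 n13 cl2 cl3 Db2 Db3 J2 J1 J3 JD2 JD1 JD3.
have m4 := main D2 D3 D1 b2 b3 b1 c2 c3 c1 n23 n31 cl2 cl1 Db2 Db1 J2 J3 J1 JD2 JD3 JD1.
have m5 := main D3 D1 D2 b3 b1 b2 c3 c1 c2 n31 n12 cl3 cl2 Db3 Db2 J3 J1 J2 JD3 JD1 JD2.
have m6 := main D3 D2 D1 b3 b2 b1 c3 c2 c1 n32 n21 cl3 cl1 Db3 Db1 J3 J2 J1 JD3 JD2 JD1.
have [i1|i1] := pselect (Jc b1 infty).
  have i2 := noinf _ _ _ _ c1 c2 n12 JD1 JD2 i1; have i3 := noinf _ _ _ _ c1 c3 n13 JD1 JD3 i1.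
  by have [h|h] := tot _ _ _ _ c2 c3 n23 J2 J3 JD2 JD3 i2 i3; [apply: m4 => //; left|apply: m6 => //; left].
have [i2|i2] := pselect (Jc b2 infty).
  have i3 := noinf _ _ _ _ c2 c3 n23 JD2 JD3 i2.
  by have [h|h] := tot _ _ _ _ c1 c3 n13 J1 J3 JD1 JD3 i1 i3; [apply: m2 => //; left|apply: m5 => //; left].
have [i3|i3] := pselect (Jc b3 infty).
  by have [h|h] := tot _ _ _ _ c1 c2 n12 J1 J2 JD1 JD2 i1 i2; [apply: m1 => //; left|apply: m3 => //; left].
have [h12|h21] := tot _ _ _ _ c1 c2 n12 J1 J2 JD1 JD2 i1 i2.
  have [h23|h32] := tot _ _ _ _ c2 c3 n23 J2 J3 JD2 JD3 i2 i3; first by apply: m1 => //; right.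
  have [h13|h31] := tot _ _ _ _ c1 c3 n13 J1 J3 JD1 JD3 i1 i3; first by apply: m2 => //; right.
  by apply: m5 => //; right.
have [h13|h31] := tot _ _ _ _ c1 c3 n13 J1 J3 JD1 JD3 i1 i3; first by apply: m3 => //; right.
have [h23|h32] := tot _ _ _ _ c2 c3 n23 J2 J3 JD2 JD3 i2 i3; first by apply: m4 => //; right.
by apply: m6 => //; right.
Qed.

Lemma Fatou_component_cases :
  (connected (~` U) /\ (~` U) !=set0) \/ doubly_connected U.
Proof.
have [x Jx] := Julia_nonempty.
have Ux : (~` U) x by move=> Ux; have [_ _ UF _] := components_prop cU; exact: Jx (UF x Ux).
pose D1 := connected_component (~` U) x.
have c1 : components (~` U) D1 by exists x.
have [[D2 [c2 n12]]|one] := pselect (exists D2, components (~` U) D2 /\ D1 <> D2).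
  right; exists D1, D2; split=> //; apply/seteqP; split=> [D cD|D [->|->]] //.
  have [e1|n1] := pselect (D = D1); first by left.
  have [e2|n2] := pselect (D = D2); first by right.
  exfalso; apply: (no_three_components c1 c2 cD n12); first by move=> e; exact: n2.
  by move=> e; exact: n1.
left; split; last by exists x.
suff -> : ~` U = D1 by exact: component_connected.
apply/seteqP; split; last exact: connected_component_sub.
move=> z Uz; have -> : D1 = connected_component (~` U) z.
  apply: contrapT => ne; apply: one; exists (connected_component (~` U) z); split=> //.
  by exists z.
exact: connected_component_refl.
Qed.
End FatouComponent.
End Order.

(** * Closed walks on the square lattice *)

(* Edges of the square lattice: [(true, (i, j))] joins (i, j) to (i + 1, j) and
   [(false, (i, j))] joins (i, j) to (i, j + 1). The face (i, j) is the square
   [i, i + 1] x [j, j + 1]. *)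
Definition ends (e : bool * (int * int)) : (int * int) * (int * int) :=
  (e.2, if e.1 then (e.2.1 + 1, e.2.2) else (e.2.1, e.2.2 + 1)).

Definition sides (e : bool * (int * int)) : (int * int) * (int * int) :=
  (if e.1 then (e.2.1, e.2.2 - 1) else (e.2.1 - 1, e.2.2), e.2).

Definition face_edges (f : int * int) : seq (bool * (int * int)) :=
  [:: (true, f); (true, (f.1, f.2 + 1)); (false, f); (false, (f.1 + 1, f.2))].

Definition corners (f : int * int) : seq (int * int) :=
  [:: f; (f.1 + 1, f.2); (f.1, f.2 + 1); (f.1 + 1, f.2 + 1)].

Definition joins (e : bool * (int * int)) (a b : int * int) : bool :=
  (ends e == (a, b)) || (ends e == (b, a)).

Definition adj (E : seq (bool * (int * int))) : rel (int * int) :=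
  fun a b => has (fun e => joins e a b) E.

(** Connection in the dual graph: faces are neighbours across an edge that is missing from [E]. *)
Inductive dconn (E : seq (bool * (int * int))) : int * int -> int * int -> Prop :=
  | dconn_refl f : dconn E f f
  | dconn_cross e : e \notin E -> dconn E (sides e).1 (sides e).2
  | dconn_sym f g : dconn E f g -> dconn E g f
  | dconn_trans f g h : dconn E f g -> dconn E g h -> dconn E f h.

Ltac int_cases :=
  rewrite ?eqxx;
  do ?[case: eqP => ? //=; try (exfalso; lia)];
  do ?[case: ltP => ? //=; try (exfalso; lia)]; lia.

Section Lattice.
Implicit Types (E : seq (bool * (int * int))) (S : seq (int * int)) (e : bool * (int * int))
  (f g x y a b u v : int * int) (p q : seq (int * int)).

Lemma dconn_sub E E' f g : {subset E' <= E} -> dconn E f g -> dconn E' f g.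
Proof.
move=> sE; elim=> {f g}.
- by move=> f; exact: dconn_refl.
- by move=> e eE; apply: dconn_cross; apply: contra eE => /sE.
- by move=> f g _; exact: dconn_sym.
- by move=> f g h _ H1 _; exact: dconn_trans.
Qed.

Lemma face_edgesP e f : (e \in face_edges f) = (f == (sides e).1) || (f == (sides e).2).
Proof.
case: e f => -[] [i j] [k l]; rewrite /face_edges /sides !inE /= !xpair_eqE /=; lia.
Qed.

Definition walk_sum (w : int * int -> int * int -> int) x p : int :=
  (fix ws x p := if p is y :: p' then w x y + ws y p' else 0) x p.

Definition step_count u v a b : int := ((a == u) && (b == v))%:Z - ((a == v) && (b == u))%:Z.

(* Signed crossings of the ray going right from the centre of the face [f]. *)
Definition step_wind f a b : int :=
  if (a.1 == b.1) && (f.1 < a.1) then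
    ((a.2 == f.2) && (b.2 == f.2 + 1))%:Z - ((b.2 == f.2) && (a.2 == f.2 + 1))%:Z
  else 0.

(** Weights that differ by the coboundary of [phi] have equal sums over closed walks. *)
Lemma walk_sum_telescope E w w' (phi : int * int -> int) x p :
  (forall a b, adj E a b -> w a b = w' a b + (phi b - phi a)) ->
  path (adj E) x p -> walk_sum w x p = walk_sum w' x p + (phi (last x p) - phi x).
Proof.
move=> H; elim: p x => [|y p IH] x /=; first by rewrite subrr addr0.
by move=> /andP[xy yp]; rewrite (IH _ yp) (H _ _ xy); lia.
Qed.

Lemma walk_sumB w w' x p :
  walk_sum (fun a b => w a b - w' a b) x p = walk_sum w x p - walk_sum w' x p.
Proof. by elim: p x => [|y p IH] x /=; rewrite ?IH; lia. Qed.

Lemma adj_cases E a b : adj E a b -> [\/ b = (a.1 + 1, a.2), a = (b.1 + 1, b.2),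
  b = (a.1, a.2 + 1) | a = (b.1, b.2 + 1)].
Proof.
move=> /hasP[[[] [i j]] _]; rewrite /joins /ends /= => /orP[] /eqP[<- <-] /=.
- by constructor 1.
- by constructor 2.
- by constructor 3.
- by constructor 4.
Qed.

(** Winding numbers of the two faces beside [e] differ by the net number of traversals of [e]. For a
    vertical edge the two rays differ exactly by [e]; for a horizontal one the difference is
    corrected by the coboundary of the indicator of the lattice points of that row to the right of
    [i]. *)
Lemma crossing_count E x p e : path (adj E) x p -> last x p = x ->
  (walk_sum (step_count (ends e).1 (ends e).2) x p == 0) =
  (walk_sum (step_wind (sides e).1) x p == walk_sum (step_wind (sides e).2) x p).
Proof.
move=> xp lx; case: e => -[] [i j]; rewrite /ends /sides /=.
  have := @walk_sum_telescope E (step_count (i, j) (i + 1, j))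
    (fun a b => step_wind (i, j) a b - step_wind (i, j - 1) a b)
    (fun v => ((v.2 == j) && (i < v.1))%:Z) x p _ xp.
  rewrite lx subrr addr0 => -> //.
    by rewrite walk_sumB subr_eq0 eq_sym.
  move=> [a1 a2] [b1 b2] /adj_cases[] [-> ->];
  rewrite /step_count /step_wind /= ?xpair_eqE /=; int_cases.
have := @walk_sum_telescope E (step_count (i, j) (i, j + 1))
    (fun a b => step_wind (i - 1, j) a b - step_wind (i, j) a b)
    (fun v => 0) x p _ xp.
rewrite subrr addr0 => -> //.
  by rewrite walk_sumB subr_eq0.
move=> [a1 a2] [b1 b2] /adj_cases[] [-> ->];
  rewrite /step_count /step_wind /= ?xpair_eqE /=; int_cases.
Qed.

Lemma joins_inj e e' a b : joins e a b -> joins e' a b -> e = e'.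
Proof.
case: e e' a b => -[] [i j] [[] [k l]] [a1 a2] [b1 b2]; rewrite /joins /ends /= => /orP[] /eqP[? ? ? ?]
  /orP[] /eqP[? ? ? ?]; subst; try (exfalso; lia); congr (_, (_, _)); lia.
Qed.

Lemma step_count0 e a b : ~~ joins e a b -> step_count (ends e).1 (ends e).2 a b = 0.
Proof.
rewrite /joins /step_count; case: (ends e) => u v; rewrite !xpair_eqE negb_or /=.
by rewrite ![u == _]eq_sym ![v == _]eq_sym => /andP[/negbTE h1 /negbTE h2]; rewrite h1 [(a == v) && _]andbC h2.
Qed.

Lemma joinsC e a b : joins e a b = joins e b a.
Proof. by rewrite /joins orbC. Qed.

Lemma joins_neq e a b : joins e a b -> a != b.
Proof.
by case: e => -[] [i j]; rewrite /joins /ends /= => /orP[] /eqP[<- <-];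
   rewrite xpair_eqE /=; lia.
Qed.

(** A walk on [E] never traverses the edges crossed by a dual path, so [crossing_count] equates the
    winding numbers step by step. *)
Lemma wind_dconn E x p f g : path (adj E) x p -> last x p = x -> dconn E f g ->
  walk_sum (step_wind f) x p = walk_sum (step_wind g) x p.
Proof.
move=> xp lx; elim=> {f g} //.
  move=> e eE; apply/eqP; rewrite -(crossing_count e xp lx); apply/eqP.
  elim: p x xp {lx} => [//|y p IH] x /= /andP[/hasP[e' e'E xy] yp].
  rewrite IH// addr0 step_count0//; apply: contraNN eE => xy'.
  by rewrite (joins_inj xy' xy).
by move=> f g h _ -> _ ->.
Qed.

Lemma path_first_step (T : eqType) (r : rel T) (a b x : T) (p : seq T) : path r x p ->
  path [rel s t | r s t && ((s, t) != (a, b))] x p \/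
  exists p1 p2 : seq T, [/\ p = p1 ++ b :: p2, last x p1 = a &
    path [rel s t | r s t && ((s, t) != (a, b))] x p1].
Proof.
elim: p x => [|y p IH] x /=; first by left.
move=> /andP[xy yp]; have [[xa yb]|ne] := eqVneq (x, y) (a, b).
  by right; exists [::], p; rewrite xa yb.
case: (IH y yp) => [h|[p1 [p2 [-> l1 h1]]]]; first by left; rewrite xy.
by right; exists (y :: p1), p2; rewrite /= xy ne.
Qed.

(** * Contracting closed walks modulo an abstract equivalence *)

Section Contraction.
(** [eqv x p q] abstracts homotopy, with fixed end points, of two walks from [x]; the instance is
    [walk_hom]. This keeps the combinatorics free of topology. *)
Variable eqv : int * int -> seq (int * int) -> seq (int * int) -> Prop.
Hypotheses (eqv_refl : forall x p, eqv x p p)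
  (eqv_trans : forall x p q r, eqv x p q -> eqv x q r -> eqv x p r)
  (eqv_cat : forall x p q r s, last x p = last x q -> eqv x p q ->
     eqv (last x p) r s -> eqv x (p ++ r) (q ++ s)).
Variables (E0 : seq (bool * (int * int))) (S0 : seq (int * int)).
Hypotheses
  (eqv_edge : forall e x p q, e \in E0 -> all (mem [:: (ends e).1; (ends e).2]) (x :: p) ->
     all (mem [:: (ends e).1; (ends e).2]) (x :: q) -> last x p = last x q -> eqv x p q)
  (eqv_face : forall f x p q, f \in S0 -> all (mem (corners f)) (x :: p) ->
     all (mem (corners f)) (x :: q) -> last x p = last x q -> eqv x p q).

Definition null E := forall x p, path (adj E) x p -> last x p = x -> eqv x p [::].

Let eqv_cons x y p q : eqv y p q -> eqv x (y :: p) (y :: q).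
Proof. by move=> h; apply: (@eqv_cat x [:: y] [:: y] p q). Qed.

Let remove_edge E e a b : adj E a b -> ~~ joins e a b -> adj (seq.filter (predC1 e) E) a b.
Proof.
move=> /hasP[e' e'E ab] nab; apply/hasP; exists e' => //.
rewrite mem_filter e'E andbT /=; apply: contraNneq nab => <-; exact: ab.
Qed.

Let joins_ends e a b : joins e a b -> a \in [:: (ends e).1; (ends e).2] /\ b \in [:: (ends e).1; (ends e).2].
Proof.
by rewrite /joins => /orP[] /eqP -> /=; rewrite !inE !eqxx ?orbT.
Qed.

(* Successive opposite traversals of [e] cancel, the closed walk between them
   avoiding [e]. *)
Let reduce E e : e \in E0 -> null (seq.filter (predC1 e) E) ->
  forall x p, path (adj E) x p -> exists q, [/\ path (adj E) x q, last x q = last x p, eqv x p q &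
    exists u v, joins e u v /\ path [rel s t | adj E s t && ((s, t) != (u, v))] x q].
Proof.
move=> eE0 nE x p; elim: p x => [|y p IH] x /=.
  move=> _; exists [::]; split=> //; exists (ends e).1, (ends e).2; split=> //.
  by rewrite /joins eqxx.
move=> /andP[xy yp]; have [q [yq lq pq [u [v [uv quv]]]]] := IH y yp.
have [[xu yv]|ne] := eqVneq (x, y) (u, v); last first.
  exists (y :: q); rewrite /= xy yq lq; split=> //; first exact: eqv_cons.
  exists u, v; split=> //; apply/andP; split; last exact: quv.
  by apply/andP.
have vu : joins e v u by rewrite joinsC.
have unv : u != v := joins_neq uv.
have [h|[q1 [q2 [qE lq1 h1]]]] := @path_first_step _ (adj E) v u y q yq.
  exists (y :: q); rewrite /= xy yq lq; split=> //; first exact: eqv_cons.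
  exists v, u; split=> //; apply/andP; split; last exact: h.
  by apply/andP; split=> //; rewrite xu yv xpair_eqE negb_and unv.
have q1E : path (adj (seq.filter (predC1 e) E)) y q1.
  move: quv; rewrite qE cat_path => /andP[h2 _]; move: h1 h2.
  elim: q1 y {IH yp yq lq pq xy yv qE lq1} => [//|z q1 IHq] y /= /andP[/andP[yz n1] h1] /andP[/andP[_ n2] h2].
  rewrite IHq// andbT; apply: remove_edge => //; apply: contra n1 => jyz.
  move: jyz uv; rewrite /joins => /orP[] /eqP-> /orP[] /eqP[e1 e2]; subst; rewrite ?eqxx // in n2 *.
have c1 : eqv y q1 [::] by apply: nE => //; rewrite lq1 yv.
exists q2; split.
- by move: yq; rewrite qE cat_path /= lq1 xu => /and3P[].
- by rewrite -lq qE last_cat /= xu.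
- apply: (@eqv_trans _ _ (y :: q)); first exact: eqv_cons.
  rewrite qE; apply: (@eqv_trans _ _ ([:: y; u] ++ q2)).
    apply: (@eqv_cat x [:: y] [:: y] (q1 ++ u :: q2) (u :: q2)) => //=.
    by apply: (@eqv_cat y q1 [::] (u :: q2) (u :: q2)) => //=; rewrite lq1 yv.
  apply: (@eqv_cat x [:: y; u] [::] q2 q2) => //=; rewrite ?xu//.
  have [ue ve] := joins_ends uv; rewrite !inE in ue ve.
  apply: (eqv_edge eE0); rewrite ?xu ?yv //.
    by apply/allP => z; rewrite !inE => /or3P[] /eqP->; [exact: ue|exact: ve|exact: ue].
  by apply/allP => z; rewrite !inE => /eqP->; exact: ue.
- exists u, v; split=> //; move: quv; rewrite qE cat_path /= lq1 xu => /and3P[_ _ h].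
  exact: h.
Qed.

(** Traversals of [e] in a single direction all count with the same sign [eps], so a vanishing total
    excludes them. *)
Let one_sided_no_crossing E e u v x q : joins e u v ->
  path [rel s t | adj E s t && ((s, t) != (u, v))] x q ->
  walk_sum (step_count (ends e).1 (ends e).2) x q = 0 ->
  path (adj (seq.filter (predC1 e) E)) x q.
Proof.
move=> uv.
have [eps [eps0 sgn]] : exists eps : int, eps != 0 /\ forall a b, (a, b) != (u, v) ->
   0 <= eps * step_count (ends e).1 (ends e).2 a b /\
   (joins e a b -> 0 < eps * step_count (ends e).1 (ends e).2 a b).
  move: uv; rewrite /joins => /orP[] /eqP ->; [exists (-1)|exists 1]; split=> // a b;
    rewrite /step_count /= !xpair_eqE => /negbTE hX; rewrite hX ![u == _]eq_sym ![v == _]eq_sym.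
    by rewrite hX /= [(b == u) && _]andbC; case: ((a == v) && (b == u)) => /=; split=> //; lia.
  by rewrite [(b == v) && _]andbC hX orbF; case: ((a == v) && (b == u)) => /=; split=> //; lia.
move=> xq s0.
have : 0 <= eps * walk_sum (step_count (ends e).1 (ends e).2) x q /\
  (eps * walk_sum (step_count (ends e).1 (ends e).2) x q = 0 -> path (adj (seq.filter (predC1 e) E)) x q).
  elim: q x xq {s0} => [|y q IH] x /=; first by rewrite mulr0.
  move=> /andP[/andP[xy ne] yq]; have [h1 h2] := IH y yq; have [h3 h4] := sgn x y ne.
  rewrite mulrDr; split; first by rewrite addr_ge0.
  move=> /eqP; rewrite paddr_eq0// => /andP[/eqP h6 /eqP /h2 ->]; rewrite andbT.
  by apply: remove_edge => //; apply/negP => /h4; rewrite h6 ltxx.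
by move=> [_]; apply; rewrite s0 mulr0.
Qed.

(* Without faces all dual faces have the same winding number, so a closed walk
   traverses each edge equally often in both directions. *)
Let null_edges n E : (size E <= n)%N -> {subset E <= E0} -> (forall f g, dconn E f g) -> null E.
Proof.
elim: n E => [|n IH] E; first by rewrite leqn0 size_eq0 => /eqP -> _ _ x [|y p].
case: E => [|e E1]; first by move=> _ _ _ x [|y p].
set E := e :: E1 => sE EE0 con x p xp lx.
pose E' := seq.filter (predC1 e) E.
have EE' : {subset E' <= E} by move=> z; rewrite mem_filter => /andP[].
have nE' : null E'.
  apply: IH; first by rewrite /E' /E /= eqxx /= -ltnS; apply: leq_trans sE; rewrite ltnS size_filter count_size.
    by move=> z /EE'/EE0.
  by move=> f g; apply: dconn_sub (con f g).
have eE0 : e \in E0 by apply: EE0; rewrite mem_head.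
have [q [xq lq pq [u [v [uv quv]]]]] := reduce eE0 nE' xp.
apply: eqv_trans pq _; apply: nE'; last by rewrite lq.
apply: (one_sided_no_crossing uv quv); apply/eqP.
by rewrite (crossing_count e xq) ?lq//; apply/eqP; apply: (wind_dconn xq); rewrite ?lq.
Qed.

(* Collapse a face of [S] with largest abscissa through its free right edge. *)
Lemma null_complex n E S : (size S <= n)%N -> {subset E <= E0} -> {subset S <= S0} ->
  (forall f, f \in S -> {subset face_edges f <= E}) ->
  (forall f g, f \notin S -> g \notin S -> dconn E f g) -> null E.
Proof.
elim: n E S => [|n IH] E S.
  rewrite leqn0 size_eq0 => /eqP -> EE0 _ _ con; apply: (@null_edges (size E)) => // f g.
  exact: con.
case: S => [|s0 S1]; first by move=> _ EE0 _ _ con; apply: (@null_edges (size E)) => // f g; exact: con.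
set S := s0 :: S1 => sS EE0 SS0 SE con.
have [s sS' smax] : exists2 s, s \in S & (s.1 + 1, s.2) \notin S.
  have [s sS' smax] : exists2 s, s \in S & forall t, t \in S -> t.1 <= s.1.
    elim: S {sS SS0 SE con} (mem_head s0 S1 : s0 \in S) => {S1} [//|t [|t' S] IHS] _.
      by exists t; [rewrite mem_head|move=> t'; rewrite inE => /eqP->].
    have [s' s'S s'max] : exists2 s, s \in t' :: S & forall t, t \in t' :: S -> t.1 <= s.1.
      elim: S t' {IHS} => [|t2 S IH2] t'; first by exists t'; [rewrite mem_head|move=> r; rewrite inE => /eqP->].
      have [s' s'S s'max] := IH2 t2.
      have [h|h] := leP t'.1 s'.1.
        by exists s'; [rewrite in_cons s'S orbT|move=> r; rewrite in_cons => /orP[/eqP->|/s'max]].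
      exists t'; first by rewrite mem_head.
      by move=> r; rewrite in_cons => /orP[/eqP->//|/s'max hr]; exact: ltW (le_lt_trans hr h).
    have [h|h] := leP t.1 s'.1.
      by exists s'; [rewrite in_cons s'S orbT|move=> r; rewrite in_cons => /orP[/eqP->|/s'max]].
    exists t; first by rewrite mem_head.
    by move=> r; rewrite in_cons => /orP[/eqP->//|/s'max hr]; exact: ltW (le_lt_trans hr h).
  by exists s => //; apply/negP => /smax /=; lia.
pose e := (false, (s.1 + 1, s.2)).
have se1 : (sides e).1 = s by case: s {sS' smax} @e => a b; rewrite /sides /=; congr (_, _); lia.
have se2 : (sides e).2 = (s.1 + 1, s.2) by [].
pose E' := seq.filter (predC1 e) E; pose S' := seq.filter (predC1 s) S.
have eE' : e \notin E' by rewrite mem_filter /= eqxx.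
have EE' : {subset E' <= E} by move=> z; rewrite mem_filter => /andP[].
have SS' : {subset S' <= S} by move=> z; rewrite mem_filter => /andP[].
have nE' : null E'.
  apply: (IH E' S').
  - rewrite -ltnS; apply: leq_trans sS; rewrite /S' -(count_predC (pred1 s) S) size_filter addnC -addn1 leq_add2l.
    by rewrite -has_count has_pred1.
  - by move=> z /EE'/EE0.
  - by move=> z /SS'/SS0.
  - move=> f; rewrite mem_filter => /andP[/= fs fS] z zf; rewrite mem_filter (SE f fS z zf) andbT /=.
    apply: contraNneq fs => ze; move: zf; rewrite ze face_edgesP se1 se2 => /orP[//|/eqP fe].
    by move: smax; rewrite -fe fS.
  (* Removing [e] opens the face [s] to its right neighbour, which is outside [S] by the choice of
     [s]. *)
  - have right f : f \notin S' -> dconn E' f (s.1 + 1, s.2).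
      have [->|fs] := eqVneq f s => fS'.
        by rewrite -{1}se1 -se2; exact: dconn_cross.
      apply: (@dconn_sub E) => //; apply: con => //.
      by move: fS'; rewrite mem_filter /= fs.
    move=> f g fS' gS'; apply: dconn_trans (right f fS') _; exact/dconn_sym/right.
have keep t : t \in face_edges s -> t != e -> t \in E'.
  by move=> ts te; rewrite mem_filter /= te (SE s sS').
have detour x p : path (adj E) x p -> exists q, [/\ path (adj E') x q, last x q = last x p & eqv x p q].
  elim: p x => [|y p IHp] x /=; first by exists [::].
  move=> /andP[xy yp]; have [q [yq lq pq]] := IHp y yp.
  have [jxy|njxy] := boolP (joins e x y); last first.
    exists (y :: q); rewrite /= yq lq; split=> //; last exact: eqv_cons.
    by rewrite andbT; exact: remove_edge.
  (* The detour along the other three sides of the face, equivalent to the step across [e] by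
     [eqv_face]. *)
  have [d [xd ld cd cxy]] : exists d, [/\ path (adj E') x d, last x d = y,
      all (mem (corners s)) (x :: d) & all (mem (corners s)) [:: x; y]].
    have k1 : (true, s) \in E' by apply: keep => //; rewrite !inE eqxx.
    have k2 : (true, (s.1, s.2 + 1)) \in E' by apply: keep => //; rewrite !inE eqxx ?orbT.
    have k3 : (false, s) \in E'.
      apply: keep; first by rewrite !inE eqxx ?orbT.
      by apply/eqP => /(congr1 (fun t : bool * (int * int) => t.2.1)) /=; lia.
    have a1 : adj E' s (s.1 + 1, s.2) by apply/hasP; exists (true, s); rewrite // /joins /ends /= eqxx.
    have a2 : adj E' (s.1, s.2 + 1) (s.1 + 1, s.2 + 1) by apply/hasP; exists (true, (s.1, s.2 + 1)); rewrite // /joins /ends /= eqxx.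
    have a3 : adj E' s (s.1, s.2 + 1) by apply/hasP; exists (false, s); rewrite // /joins /ends /= eqxx.
    have aC a b : adj E' a b = adj E' b a by apply: eq_has => t; rewrite joinsC.
    move: jxy; rewrite /joins /ends /= => /orP[] /eqP[<- <-].
      exists [:: s; (s.1, s.2 + 1); (s.1 + 1, s.2 + 1)]; split=> //.
      - by rewrite /= aC a1 a3 a2.
      - by rewrite /= !inE !eqxx ?orbT.
      - by rewrite /= !inE !eqxx ?orbT.
    exists [:: (s.1, s.2 + 1); s; (s.1 + 1, s.2)]; split=> //.
    - by rewrite /= aC a2 aC a3 a1.
    - by rewrite /= !inE !eqxx ?orbT.
    - by rewrite /= !inE !eqxx ?orbT.
  exists (d ++ q); split.
  - by rewrite cat_path xd ld.
  - by rewrite last_cat ld lq.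
  - apply: (@eqv_cat x [:: y] d p q) => //=.
    by apply: (eqv_face (SS0 s sS')).
move=> x p xp lx; have [q [xq lq pq]] := detour x p xp.
by apply: eqv_trans pq _; apply: nE'; rewrite ?lq.
Qed.
End Contraction.
End Lattice.

(** * Homotopies of plane paths *)

Section Homotopy.
Variables (R : realType) (U : set R[i]).
Local Notation C := R[i].
Implicit Types (x y z w : C) (c d : R -> C) (s t : R).

Definition clamp t : R := Num.max 0 (Num.min 1 t).

Lemma clamp_continuous : continuous clamp.
Proof.
move=> t; apply: continuous_max; first exact: cst_continuous.
by apply: continuous_min; [exact: cst_continuous|exact: cvg_id].
Qed.

Lemma clamp01 t : 0 <= clamp t /\ clamp t <= 1.
Proof. by rewrite /clamp le_max lexx ge_max ler01 ge_min lexx. Qed.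

Lemma clamp_le0 t : t <= 0 -> clamp t = 0.
Proof. by move=> t0; rewrite /clamp min_r ?(le_trans t0)// max_l. Qed.

Lemma clamp_ge1 t : 1 <= t -> clamp t = 1.
Proof. by move=> t1; rewrite /clamp min_l// max_r. Qed.

Lemma clamp_id t : 0 <= t -> t <= 1 -> clamp t = t.
Proof. by move=> t0 t1; rewrite /clamp min_r// max_r. Qed.

(* Paths are constant outside [0, 1], so that concatenations and gluings of
   homotopies are given by a single continuous formula, e.g.
   [c (2 t) + d (2 t - 1) - y]. *)
Definition upath x y c :=
  [/\ continuous c, forall t, U (c t), forall t, t <= 0 -> c t = x & forall t, 1 <= t -> c t = y].

Definition hom x y c d := exists H : R * R -> C,
  [/\ continuous H, forall p, U (H p),
    forall s t, (s <= 0 -> H (s, t) = c t) /\ (1 <= s -> H (s, t) = d t)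
    & forall s t, (t <= 0 -> H (s, t) = x) /\ (1 <= t -> H (s, t) = y)].

Lemma affine_continuous (a e : R) : continuous (fun t : R => a * t + e).
Proof.
move=> p; apply: cvgD; last exact: cvg_cst.
by apply: cvgM; [exact: cvg_cst|exact: cvg_id].
Qed.

Lemma comp_continuous (T V W : topologicalType) (f : T -> V) (g : V -> W) :
  continuous f -> continuous g -> continuous (g \o f).
Proof. by move=> cf cg u; exact: (continuous_comp (cf u) (cg (f u))). Qed.

Lemma continuous_addC (T : topologicalType) (f g : T -> C) :
  continuous f -> continuous g -> continuous (fun u => f u + g u).
Proof. by move=> cf cg u; exact: (plane_continuousD (cf u) (cg u)). Qed.

Lemma continuous_subC (T : topologicalType) (f g : T -> C) :
  continuous f -> continuous g -> continuous (fun u => f u - g u).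
Proof. by move=> cf cg u; exact: (plane_continuousB (cf u) (cg u)). Qed.

Lemma continuous_mulC (T : topologicalType) (f g : T -> C) :
  continuous f -> continuous g -> continuous (fun u => f u * g u).
Proof. by move=> cf cg u; exact: (plane_continuousM (cf u) (cg u)). Qed.

Lemma continuous_cstC (T : topologicalType) (a : C) : continuous (fun _ : T => a).
Proof. by move=> u; exact: plane_continuous_cst. Qed.

Lemma continuous_realC (T : topologicalType) (f : T -> R) :
  continuous f -> continuous (fun u => (f u)%:C%C : C).
Proof. by move=> cf u; exact: (plane_continuousR (cf u)). Qed.

Lemma hom_refl x y c : upath x y c -> hom x y c c.
Proof.
move=> [cc Uc c0 c1]; exists (fun p => c p.2); split.
- have c2 : continuous (fun p : R * R => p.2) by move=> p; exact: cvg_snd.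
  exact: (comp_continuous c2 cc).
- by move=> p; exact: Uc.
- by move=> s t.
- by move=> s t; split; [exact: c0|exact: c1].
Qed.

Lemma continuous_compC2 (H : R * R -> C) (f g : R * R -> R) :
  continuous H -> continuous f -> continuous g -> continuous (fun p => H (f p, g p)).
Proof.
move=> cH cf cg; have cfg : continuous (fun p => (f p, g p)).
  by move=> p; exact: (cvg_pair (cf p) (cg p)).
exact: (comp_continuous cfg cH).
Qed.

Lemma hom_sym x y c d : hom x y c d -> hom x y d c.
Proof.
move=> [H [cH UH Hs Ht]]; exists (fun p => H (1 - p.1, p.2)); split.
- apply: (continuous_compC2 cH); last by move=> p; exact: cvg_snd.
  by move=> p; apply: cvgB; [exact: cvg_cst|exact: cvg_fst].
- by move=> p; exact: UH.
- by move=> s t; split=> h /=; [apply: (Hs _ _).2; lra|apply: (Hs _ _).1; lra].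
- by move=> s t; exact: Ht.
Qed.

Lemma hom_trans x y c d e : upath x y d -> hom x y c d -> hom x y d e -> hom x y c e.
Proof.
move=> [cd Ud d0 d1] [H [cH UH Hs Ht]] [K [cK UK Ks Kt]].
exists (fun p => H (2 * p.1, p.2) + K (2 * p.1 - 1, p.2) - d p.2).
have c1 : continuous (fun p : R * R => 2 * p.1).
  by move=> p; apply: cvgM; [exact: cvg_cst|exact: cvg_fst].
have c2 : continuous (fun p : R * R => 2 * p.1 - 1).
  by move=> p; apply: cvgB; [exact: c1|exact: cvg_cst].
have c3 : continuous (fun p : R * R => p.2) by move=> p; exact: cvg_snd.
split.
- apply: continuous_subC; last exact: (comp_continuous c3 cd).
  by apply: continuous_addC; [exact: (continuous_compC2 cH)|exact: (continuous_compC2 cK)].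
- move=> [s t] /=; have [h|h] := leP s (1 / 2).
    by rewrite (Ks (2 * s - 1) t).1 ?addrK//; lra.
  by rewrite (Hs (2 * s) t).2 ?[d t + _]addrC ?addrK//; lra.
- move=> s t; split=> h /=.
    by rewrite (Ks (2 * s - 1) t).1 ?addrK ?(Hs (2 * s) t).1//; lra.
  by rewrite (Hs (2 * s) t).2 ?[d t + _]addrC ?addrK ?(Ks (2 * s - 1) t).2//; lra.
- move=> s t; split=> h /=.
    by rewrite (Ht _ t).1// (Kt _ t).1// d0// addrK.
  by rewrite (Ht _ t).2// (Kt _ t).2// d1// addrK.
Qed.

Definition concat y c d t : C := c (2 * t) + d (2 * t - 1) - y.

Lemma cat_first y z c d t : upath y z d -> t <= 1 / 2 -> concat y c d t = c (2 * t).
Proof. by move=> [_ _ d0 _] h; rewrite /concat d0 ?addrK//; lra. Qed.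

Lemma cat_second x y c d t : upath x y c -> 1 / 2 <= t -> concat y c d t = d (2 * t - 1).
Proof. by move=> [_ _ _ c1] h; rewrite /concat c1 ?[y + _]addrC ?addrK//; lra. Qed.

Lemma cat_upath x y z c d : upath x y c -> upath y z d -> upath x z (concat y c d).
Proof.
move=> pc pd; have [cc Uc c0 c1] := pc; have [cd Ud d0 d1] := pd; split.
- apply: continuous_subC; last exact: continuous_cstC.
  have c2 : continuous (fun t : R => 2 * t) by move=> t; apply: cvgM; [exact: cvg_cst|exact: cvg_id].
  apply: continuous_addC; last exact: (comp_continuous (@affine_continuous 2 (-1)) cd).
  exact: (comp_continuous c2 cc).
- move=> t; have [h|h] := leP t (1 / 2); first by rewrite (cat_first c pd h).
  by rewrite (cat_second d pc (ltW h)).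
- by move=> t h; rewrite (cat_first c pd) ?c0//; lra.
- by move=> t h; rewrite (cat_second d pc) ?d1//; lra.
Qed.

Lemma hom_cat x y z c c' d d' : hom x y c c' -> hom y z d d' -> hom x z (concat y c d) (concat y c' d').
Proof.
move=> [H [cH UH Hs Ht]] [K [cK UK Ks Kt]].
exists (fun p => H (p.1, 2 * p.2) + K (p.1, 2 * p.2 - 1) - y).
split.
- apply: continuous_subC; last exact: continuous_cstC.
  have c1 : continuous (fun p : R * R => 2 * p.2).
    by move=> p; apply: cvgM; [exact: cvg_cst|exact: cvg_snd].
  have c2 : continuous (fun p : R * R => 2 * p.2 - 1).
    by move=> p; apply: cvgB; [exact: c1|exact: cvg_cst].
  have c3 : continuous (fun p : R * R => p.1) by move=> p; exact: cvg_fst.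
  by apply: continuous_addC; [exact: (continuous_compC2 cH)|exact: (continuous_compC2 cK)].
- move=> [s t] /=; have [h|h] := leP t (1 / 2).
    by rewrite (Kt s (2 * t - 1)).1 ?addrK//; lra.
  by rewrite (Ht s (2 * t)).2 ?[y + _]addrC ?addrK//; lra.
- move=> s t; split=> h; rewrite /concat /=.
    by rewrite (Hs s _).1// (Ks s _).1.
  by rewrite (Hs s _).2// (Ks s _).2.
- move=> s t; split=> h /=.
    by rewrite (Kt s (2 * t - 1)).1 ?addrK ?(Ht s (2 * t)).1//; lra.
  by rewrite (Ht s (2 * t)).2 ?[y + _]addrC ?addrK ?(Kt s (2 * t - 1)).2//; lra.
Qed.

Lemma hom_assoc x y z w c d e : upath x y c -> upath y z d -> upath z w e ->
  hom x w (concat z (concat y c d) e) (concat y c (concat z d e)).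
Proof.
move=> [cc Uc c0 c1] [cd Ud d0 d1] [ce Ue e0 e1].
pose k s := clamp s.
have ck : continuous (fun p : R * R => k p.1).
  by move=> p; exact: (continuous_comp (@cvg_fst _ _ _ _ _) (@clamp_continuous p.1)).
(* The breakpoints move from 1/4 and 1/2 to 1/2 and 3/4. In between [c], [d] and [e] are run in turn
   with pauses, whose lengths are non-negative because [0 <= k * (1 - k)]; so only one summand moves
   at a time. *)
exists (fun p => c ((4 - 2 * k p.1) * p.2) + d (4 * p.2 - 1 - k p.1) +
   e ((2 + 2 * k p.1) * p.2 - 1 - 2 * k p.1) - z - y).
have k01 s : 0 <= k s /\ k s <= 1 by exact: clamp01.
split.
- apply: continuous_subC; last exact: continuous_cstC.
  apply: continuous_subC; last exact: continuous_cstC.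
  apply: continuous_addC; first apply: continuous_addC.
  + have h : continuous (fun p : R * R => (4 - 2 * k p.1) * p.2).
      move=> p; apply: cvgM; last exact: cvg_snd.
      apply: cvgB; first exact: cvg_cst.
      by apply: cvgM; [exact: cvg_cst|exact: ck].
    exact: (comp_continuous h cc).
  + have h : continuous (fun p : R * R => 4 * p.2 - 1 - k p.1).
      move=> p; apply: cvgB; last exact: ck.
      apply: cvgB; last exact: cvg_cst.
      by apply: cvgM; [exact: cvg_cst|exact: cvg_snd].
    exact: (comp_continuous h cd).
  + have h : continuous (fun p : R * R => (2 + 2 * k p.1) * p.2 - 1 - 2 * k p.1).
      move=> p; apply: cvgB; last by apply: cvgM; [exact: cvg_cst|exact: ck].
      apply: cvgB; last exact: cvg_cst.
      apply: cvgM; last exact: cvg_snd.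
      apply: cvgD; first exact: cvg_cst.
      by apply: cvgM; [exact: cvg_cst|exact: ck].
    exact: (comp_continuous h ce).
- move=> [s t] /=; have [k0 k1] := k01 s; move: (k s) k0 k1 => u u0 u1.
  have uu : 0 <= u * (1 - u) by rewrite mulr_ge0// subr_ge0.
  have [h|h] := leP (4 * t - 1 - u) 0.
    rewrite d0// e0; last by nra.
    by rewrite addrK addrK.
  have c1' : c ((4 - 2 * u) * t) = y by apply: c1; nra.
  rewrite c1'; have [h2|h2] := leP (4 * t - 1 - u) 1.
    rewrite e0; last by nra.
    by rewrite addrK [y + _]addrC addrK.
  by rewrite d1 ?ltW// [y + z + _]addrC addrA addrK addrK.
- move=> s t; split=> h; rewrite /= /k /concat.
    rewrite clamp_le0// !mulr0 !subr0 !addr0.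
    have -> : 2 * (2 * t) = 4 * t by ring.
    by ring.
  rewrite clamp_ge1// mulr1.
  have -> : (4 - 2) * t = 2 * t by ring.
  have -> : 4 * t - 1 - 1 = 2 * (2 * t - 1) by ring.
  have -> : (2 + 2) * t - 1 - 2 = 2 * (2 * t - 1) - 1 by ring.
  by ring.
- move=> s t; have [k0 k1] := k01 s; move: (k s) k0 k1 => u u0 u1; split=> h /=.
    rewrite c0 ?d0 ?e0; [by rewrite addrK addrK|nra|nra|nra].
  rewrite c1 ?d1 ?e1; [by ring|nra|nra|nra].
Qed.

Lemma hom_reparam c (phi psi : R -> R) a b :
  continuous c -> (forall t, U (c t)) -> continuous phi -> continuous psi ->
  (forall t, t <= 0 -> phi t = a /\ psi t = a) ->
  (forall t, 1 <= t -> phi t = b /\ psi t = b) ->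
  hom (c a) (c b) (c \o phi) (c \o psi).
Proof.
move=> cc Uc cphi cpsi h0 h1.
exists (fun p => c ((1 - clamp p.1) * phi p.2 + clamp p.1 * psi p.2)); split.
- have h : continuous (fun p : R * R => (1 - clamp p.1) * phi p.2 + clamp p.1 * psi p.2); last first.
    exact: (comp_continuous h cc).
  move=> p; have ck : clamp q.1 @[q --> p] --> clamp p.1.
    exact: (continuous_comp (@cvg_fst _ _ _ _ _) (@clamp_continuous p.1)).
  have c2 (f : R -> R) : continuous f -> f q.2 @[q --> p] --> f p.2.
    by move=> cf; exact: (continuous_comp (@cvg_snd _ _ _ _ _) (cf p.2)).
  apply: cvgD; apply: cvgM => //; try exact: c2.
  by apply: cvgB => //; exact: cvg_cst.
- by move=> p; exact: Uc.
- move=> s t; split=> h /=.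
    by rewrite clamp_le0// subr0 mul1r mul0r addr0.
  by rewrite clamp_ge1// subrr mul1r mul0r add0r.
- move=> s t; split=> h /=.
    by have [-> ->] := h0 t h; rewrite -mulrDl subrK mul1r.
  by have [-> ->] := h1 t h; rewrite -mulrDl subrK mul1r.
Qed.

Lemma upath_cst x : U x -> upath x x (fun=> x).
Proof. by move=> Ux; split=> //; exact: continuous_cstC. Qed.

Lemma hom_cst_cat x y c : upath x y c -> hom x y (concat x (fun=> x) c) c.
Proof.
move=> [cc Uc c0 c1].
have -> : concat x (fun=> x) c = c \o (fun t => clamp (2 * t - 1)).
  apply/funext => t; rewrite /concat /= [x + _]addrC addrK.
  have [h|h] := leP (2 * t - 1) 0; first by rewrite clamp_le0// !c0.
  have [h1|h1] := leP (2 * t - 1) 1; first by rewrite clamp_id// ltW.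
  by rewrite clamp_ge1 ?ltW// !c1// ltW.
have cE : c = c \o clamp.
  apply/funext => t /=; have [h|h] := leP t 0; first by rewrite clamp_le0// !c0.
  have [h1|h1] := leP t 1; first by rewrite clamp_id// ltW.
  by rewrite clamp_ge1 ?ltW// !c1// ltW.
rewrite [X in hom _ _ _ X]cE -(c0 0 (lexx _)) -(c1 1 (lexx _)).
apply: hom_reparam => //.
- by move=> t; exact: (continuous_comp (@affine_continuous 2 (-1) t) (@clamp_continuous _)).
- exact: clamp_continuous.
- by move=> t h; rewrite !clamp_le0//; lra.
- by move=> t h; rewrite !clamp_ge1//; lra.
Qed.

Definition convex (K : set C) := forall z w t, K z -> K w -> 0 <= t -> t <= 1 -> K (lin z w t).

Lemma hom_convex (K : set C) x y c d : convex K -> K `<=` U -> upath x y c -> upath x y d ->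
  (forall t, K (c t)) -> (forall t, K (d t)) -> hom x y c d.
Proof.
move=> cK KU [cc Uc c0 c1] [cd Ud d0 d1] Kc Kd.
exists (fun p => lin (c p.2) (d p.2) (clamp p.1)); split.
- have ck : continuous (fun p : R * R => clamp p.1).
    by move=> p; exact: (continuous_comp (@cvg_fst _ _ _ _ _) (@clamp_continuous p.1)).
  have c2 (f : R -> C) : continuous f -> continuous (fun p : R * R => f p.2).
    have h : continuous (fun p : R * R => p.2) by move=> p; exact: cvg_snd.
    exact: (comp_continuous h).
  rewrite /lin; apply: continuous_addC; first exact: c2.
  apply: continuous_mulC; first exact: continuous_realC.
  by apply: continuous_subC; exact: c2.
- by move=> p; apply: KU; apply: cK => //; have [] := clamp01 p.1.
- by move=> s t; split=> h /=; [rewrite clamp_le0// lin0|rewrite clamp_ge1// lin1].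
- move=> s t; split=> h /=.
    by rewrite c0// d0// /lin subrr mulr0 addr0.
  by rewrite c1// d1// /lin subrr mulr0 addr0.
Qed.

Definition seg x y t : C := lin x y (clamp t).

Lemma seg_continuous x y : continuous (seg x y).
Proof. exact: (comp_continuous clamp_continuous (@lin_continuous R x y)). Qed.

Lemma segm_seg x y t : segm x y (seg x y t).
Proof.
by have [h0 h1] := clamp01 t; exists (clamp t) => //; rewrite /= in_itv /= h0 h1.
Qed.

Lemma seg_upath x y : segm x y `<=` U -> upath x y (seg x y).
Proof.
move=> sU; split.
- exact: seg_continuous.
- by move=> t; apply: sU; exact: segm_seg.
- by move=> t h; rewrite /seg clamp_le0// lin0.
- by move=> t h; rewrite /seg clamp_ge1// lin1.
Qed.

Lemma convex_segm (K : set C) x y : convex K -> K x -> K y -> segm x y `<=` K.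
Proof. by move=> cK Kx Ky _ [t /= + <-]; rewrite in_itv /= => /andP[t0 t1]; exact: cK. Qed.

Lemma cat_mem (K : set C) x y z c d : upath x y c -> upath y z d ->
  (forall t, K (c t)) -> (forall t, K (d t)) -> forall t, K (concat y c d t).
Proof.
move=> pc pd Kc Kd t; have [h|h] := leP t (1 / 2); first by rewrite (cat_first c pd h).
by rewrite (cat_second d pc (ltW h)).
Qed.

Section Polygon.
Variables (V : eqType) (emb : V -> C).
Implicit Types (u v : V) (p q : seq V).

Fixpoint good v p : Prop :=
  if p is u :: p' then segm (emb v) (emb u) `<=` U /\ good u p' else U (emb v).

Fixpoint polygon v p : R -> C :=
  if p is u :: p' then concat (emb u) (seg (emb v) (emb u)) (polygon u p') else (fun=> emb v).

Lemma good_head v p : good v p -> U (emb v).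
Proof. by case: p => [//|u p] [sU _]; apply: sU; exact: segm_l. Qed.

Lemma good_cat v p q : good v (p ++ q) <-> good v p /\ good (last v p) q.
Proof.
elim: p v => [|u p IH] v /=; first by split=> [h|[]//]; split=> //; exact: good_head h.
by rewrite (propext (IH u)); split=> [[? []]|[[]]].
Qed.

Lemma polygon_upath v p : good v p -> upath (emb v) (emb (last v p)) (polygon v p).
Proof.
elim: p v => [|u p IH] v /=; first exact: upath_cst.
by move=> [sU gp]; apply: cat_upath; [exact: seg_upath|exact: IH].
Qed.

Lemma polygon_cat v p q : good v (p ++ q) ->
  hom (emb v) (emb (last v (p ++ q))) (polygon v (p ++ q)) (concat (emb (last v p)) (polygon v p) (polygon (last v p) q)).
Proof.
elim: p v => [|u p IH] v /=.
  by move=> gq; apply/hom_sym/hom_cst_cat/polygon_upath.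
move=> [sU g]; have [gp gq] := (good_cat u p q).1 g.
have s1 := seg_upath sU; have pp := polygon_upath gp; have pq := polygon_upath gq.
have lE : last u (p ++ q) = last (last u p) q by rewrite last_cat.
apply: (@hom_trans _ _ _ (concat (emb u) (seg (emb v) (emb u)) (concat (emb (last u p)) (polygon u p) (polygon (last u p) q)))).
- by rewrite lE; apply: cat_upath s1 _; exact: cat_upath pp pq.
- by apply: hom_cat (hom_refl s1) _; exact: IH.
- by rewrite lE; apply: hom_sym; exact: hom_assoc s1 pp pq.
Qed.

Lemma convex_good (K : set C) v p : convex K -> K `<=` U -> (forall u, u \in v :: p -> K (emb u)) ->
  good v p /\ forall t, K (polygon v p t).
Proof.
move=> cK KU; elim: p v => [|u p IH] v H /=.
  have Kv : K (emb v) by apply: H; rewrite mem_head.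
  by split=> //; exact: KU.
have Kv : K (emb v) by apply: H; rewrite mem_head.
have Ku : K (emb u) by apply: H; rewrite !inE eqxx orbT.
have [|gp Kp] := IH u; first by move=> w wp; apply: H; rewrite inE wp orbT.
have sK := convex_segm cK Kv Ku.
have sU : segm (emb v) (emb u) `<=` U by exact: subset_trans sK KU.
split=> //; apply: (cat_mem (seg_upath sU) (polygon_upath gp)) => // t.
by apply: sK; exact: segm_seg.
Qed.

(** Staying in [U] is passed on inside the implication, so that the relation satisfies the
    hypotheses on [eqv] for all walks, including those that leave [U]. *)
Definition walk_hom v p q := last v p = last v q /\
  (good v p -> good v q /\ hom (emb v) (emb (last v p)) (polygon v p) (polygon v q)).

Lemma walk_hom_refl v p : walk_hom v p p.
Proof. by split=> // g; split=> //; exact: hom_refl (polygon_upath g). Qed.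

Lemma walk_hom_trans v p q r : walk_hom v p q -> walk_hom v q r -> walk_hom v p r.
Proof.
move=> [l1 h1] [l2 h2]; split; first by rewrite l1.
move=> gp; have [gq hpq] := h1 gp; have [gr hqr] := h2 gq; split=> //.
by apply: hom_trans hpq _; rewrite l1 //; exact: polygon_upath.
Qed.

Lemma walk_hom_cat v p q r (s : seq V) : last v p = last v q -> walk_hom v p q ->
  walk_hom (last v p) r s -> walk_hom v (p ++ r) (q ++ s).
Proof.
move=> l0 [l1 h1] [l2 h2]; split; first by rewrite !last_cat -l1 l2.
move=> /good_cat[gp gr]; have [gq hpq] := h1 gp; have [gs hrs] := h2 gr.
have gqs : good v (q ++ s) by apply/good_cat; rewrite -l1.
have gpr : good v (p ++ r) by apply/good_cat.
split=> //.
have pr := polygon_cat gpr; have qs := polygon_cat gqs.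
have lE : last v (q ++ s) = last v (p ++ r) by rewrite !last_cat -l1 l2.
rewrite lE -l1 in qs.
have up : upath (emb v) (emb (last v (p ++ r))) (concat (emb (last v p)) (polygon v p) (polygon (last v p) r)).
  by rewrite last_cat; apply: cat_upath; exact: polygon_upath.
have uq : upath (emb v) (emb (last v (p ++ r))) (concat (emb (last v p)) (polygon v q) (polygon (last v p) s)).
  rewrite -lE last_cat; apply: (cat_upath (y := emb (last v p))).
    by rewrite l1; exact: polygon_upath.
  by rewrite -l1; exact: polygon_upath.
apply: (hom_trans up pr); apply: (hom_trans uq); last exact: hom_sym.
by rewrite last_cat; apply: hom_cat.
Qed.

Lemma walk_hom_convex (K : set C) v p q : convex K -> K `<=` U ->
  (forall u, u \in v :: p -> K (emb u)) -> (forall u, u \in v :: q -> K (emb u)) ->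
  last v p = last v q -> walk_hom v p q.
Proof.
move=> cK KU Kp Kq lE; split=> // gp.
have [gq Kq'] := convex_good cK KU Kq; have [_ Kp'] := convex_good cK KU Kp.
split=> //; apply: (hom_convex cK KU) => //; first exact: polygon_upath.
by rewrite lE; exact: polygon_upath.
Qed.
End Polygon.
End Homotopy.

(** * Simple connectivity *)

Section Grid.
Variables (R : realType) (U : set R[i]) (rho delta : R).
Local Notation C := R[i].
Hypotheses (delta0 : 0 < delta) (Urho : forall z, U z -> normc z < rho)
  (cU : connected (~` (@pt R @` U))).
Implicit Types (x y z w : C) (e : bool * (int * int)) (f g u v : int * int) (i j k : int).

Definition mesh_pt v : C := Complex (delta * v.1%:~R) (delta * v.2%:~R).

Definition rect (a b c d : R) : set C :=
  [set z | [/\ a <= complex.Re z, complex.Re z <= b, c <= complex.Im z & complex.Im z <= d]].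

Definition face_set f := rect (delta * f.1%:~R) (delta * (f.1 + 1)%:~R)
  (delta * f.2%:~R) (delta * (f.2 + 1)%:~R).

Definition edge_set e := rect (delta * (ends e).1.1%:~R) (delta * (ends e).2.1%:~R)
  (delta * (ends e).1.2%:~R) (delta * (ends e).2.2%:~R).

Lemma Re_lin x y (t : R) : complex.Re (lin x y t) = complex.Re x + t * (complex.Re y - complex.Re x).
Proof. by case: x y => [a b] [c d]; rewrite /lin /=; ring. Qed.

Lemma Im_lin x y (t : R) : complex.Im (lin x y t) = complex.Im x + t * (complex.Im y - complex.Im x).
Proof. by case: x y => [a b] [c d]; rewrite /lin /=; ring. Qed.

Lemma convex_rect a b c d : convex (rect a b c d).
Proof.
move=> x y t [x1 x2 x3 x4] [y1 y2 y3 y4] t0 t1; split; rewrite ?Re_lin ?Im_lin; nra.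
Qed.

Lemma ler_mesh i j : (delta * i%:~R <= delta * j%:~R) = (i <= j).
Proof. by rewrite ler_pM2l// ler_int. Qed.

Lemma mesh_intrD1 i : delta * (i + 1)%:~R = delta * i%:~R + delta.
Proof. by rewrite intrD mulrDr mulr1. Qed.

Lemma face_set_corner f v : v \in corners f -> face_set f (mesh_pt v).
Proof.
case: f v => [a b] [c d]; rewrite !inE /= !xpair_eqE => H.
by split; rewrite /= ler_mesh; lia.
Qed.

Lemma edge_set_end e v : v \in [:: (ends e).1; (ends e).2] -> edge_set e (mesh_pt v).
Proof.
case: e => -[] [a b]; case: v => c d; rewrite !inE /ends /= !xpair_eqE => H;
by split; rewrite /= ler_mesh; lia.
Qed.

Lemma edge_sub_face e f : e \in face_edges f -> edge_set e `<=` face_set f.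
Proof.
case: f => a b; rewrite !inE => /or4P[] /eqP-> z [/= h1 h2 h3 h4]; split=> //=;
  by apply: le_trans; try eassumption; rewrite ler_mesh; lia.
Qed.

Lemma edge_sub_convex e K : convex K -> K (mesh_pt (ends e).1) -> K (mesh_pt (ends e).2) ->
  edge_set e `<=` K.
Proof.
move=> cK K1 K2 [a b] [/=]; case: e K1 K2 => -[] [i j]; rewrite /ends /= => K1 K2 h1 h2 h3 h4.
  have -> : Complex a b = lin (mesh_pt (i, j)) (mesh_pt (i + 1, j)) (a / delta - i%:~R).
    apply/eqP; rewrite eq_complex Re_lin Im_lin /= mesh_intrD1; apply/andP; split; apply/eqP.
      by field; exact: lt0r_neq0.
    by lra.
  rewrite mesh_intrD1 in h2; apply: cK => //.
    by rewrite subr_ge0 ler_pdivlMr// mulrC.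
  by rewrite lerBlDr ler_pdivrMr// mulrDl mul1r [i%:~R * _]mulrC; lra.
have -> : Complex a b = lin (mesh_pt (i, j)) (mesh_pt (i, j + 1)) (b / delta - j%:~R).
  apply/eqP; rewrite eq_complex Re_lin Im_lin /= mesh_intrD1; apply/andP; split; apply/eqP.
    by lra.
  by field; exact: lt0r_neq0.
rewrite mesh_intrD1 in h4; apply: cK => //.
  by rewrite subr_ge0 ler_pdivlMr// mulrC.
by rewrite lerBlDr ler_pdivrMr// mulrDl mul1r [j%:~R * _]mulrC; lra.
Qed.

(** The closed mesh intervals are locally finite: [eta] is the mesh size at a mesh point and the
    distance to the nearest mesh point elsewhere. *)
Lemma near_mesh_interval (a : R) : exists eta, 0 < eta /\ forall b k, `|b - a| < eta ->
  delta * k%:~R <= b -> b <= delta * (k + 1)%:~R ->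
  delta * k%:~R <= a /\ a <= delta * (k + 1)%:~R.
Proof.
pose i := Num.floor (a / delta).
have h1 : delta * i%:~R <= a by rewrite mulrC -ler_pdivlMr// floor_le.
have h2 : a < delta * (i + 1)%:~R by rewrite mulrC -ltr_pdivrMr// floorD1_gt.
have [ai|ai] := eqVneq a (delta * i%:~R).
  exists delta; split=> // b k; rewrite ltr_norml => /andP[b1 b2] kb bk.
  rewrite mesh_intrD1 in bk *.
  have : delta * (k)%:~R < delta * (i + 1)%:~R by rewrite mesh_intrD1; lra.
  have : delta * (i - 1)%:~R < delta * (k + 1)%:~R by rewrite intrB mulrBr mulr1 mesh_intrD1; lra.
  rewrite !ltr_pM2l// !ltr_int => h3 h4; rewrite ai.
  have : delta * k%:~R <= delta * i%:~R by rewrite ler_mesh; lia.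
  have : delta * i%:~R <= delta * (k + 1)%:~R by rewrite ler_mesh; lia.
  by rewrite mesh_intrD1; split; lra.
have ia : delta * i%:~R < a by rewrite lt_neqAle eq_sym ai.
exists (Num.min (a - delta * i%:~R) (delta * (i + 1)%:~R - a)); split.
  by rewrite lt_min !subr_gt0 ia.
move=> b k; rewrite lt_min !ltr_norml => /andP[/andP[b1 b2] /andP[b3 b4]] kb bk.
have : delta * k%:~R < delta * (i + 1)%:~R by lra.
have : delta * i%:~R < delta * (k + 1)%:~R by lra.
rewrite !ltr_pM2l// !ltr_int => h3 h4.
have -> : k = i by clear -h3 h4; lia.
by split; lra.
Qed.

Lemma near_face z : exists eta, 0 < eta /\ forall y f, normc (y - z) < eta -> face_set f y -> face_set f z.
Proof.
have [e1 [e10 h1]] := near_mesh_interval (complex.Re z).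
have [e2 [e20 h2]] := near_mesh_interval (complex.Im z).
exists (Num.min e1 e2); split; first by rewrite lt_min e10.
move=> y f; rewrite lt_min => /andP[y1 y2] [f1 f2 f3 f4].
have [r1 r2] : delta * f.1%:~R <= complex.Re z /\ complex.Re z <= delta * (f.1 + 1)%:~R.
  by apply: (h1 (complex.Re y)) => //; rewrite -raddfB; apply: le_lt_trans (Re_le_normc _) y1.
have [r3 r4] : delta * f.2%:~R <= complex.Im z /\ complex.Im z <= delta * (f.2 + 1)%:~R.
  by apply: (h2 (complex.Im y)) => //; rewrite -raddfB; apply: le_lt_trans (Im_le_normc _) y2.
by split.
Qed.

Definition face_of z : int * int := (Num.floor (complex.Re z / delta), Num.floor (complex.Im z / delta)).

Lemma face_ofP z : face_set (face_of z) z.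
Proof.
have key (r : R) : delta * (Num.floor (r / delta))%:~R <= r /\
    r <= delta * (Num.floor (r / delta) + 1)%:~R.
  by split; rewrite mulrC; [rewrite -ler_pdivlMr// floor_le|rewrite -ler_pdivrMr// ltW// floorD1_gt].
by have [? ?] := key (complex.Re z); have [? ?] := key (complex.Im z).
Qed.

Variable n : nat.
Hypothesis n_rho : rho <= delta * n%:R.

Lemma U_bound z : U z -> `|complex.Re z| < delta * n%:R /\ `|complex.Im z| < delta * n%:R.
Proof.
move=> /Urho h; split.
  by apply: le_lt_trans (Re_le_normc _) (lt_le_trans h n_rho).
by apply: le_lt_trans (Im_le_normc _) (lt_le_trans h n_rho).
Qed.

Lemma mesh_bound v : U (mesh_pt v) -> `|v.1| < n /\ `|v.2| < n.
Proof.
have key i : `|delta * i%:~R| < delta * n%:R -> `|i| < n.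
  by rewrite normrM gtr0_norm// ltr_pM2l// -intr_norm -[n%:R]/(n%:Z%:~R) ltr_int.
by move=> /U_bound[/= h1 h2]; split; exact: key.
Qed.

Lemma finite_enum (Q : int * int -> Prop) : (forall v, Q v -> `|v.1| < n /\ `|v.2| < n) ->
  exists s : seq (int * int), forall v, v \in s <-> Q v.
Proof.
move=> Qn; pose l : seq int := [seq (m : nat)%:Z - n%:Z | m <- iota 0 (n + n)].
have lP i : `|i| < n -> i \in l.
  move=> h; apply/mapP; exists (absz (i + n%:Z)%R); last lia.
  by rewrite mem_iota; lia.
exists [seq v <- [seq (i, j) | i <- l, j <- l] | `[< Q v >]] => v.
rewrite mem_filter; split=> [/andP[/asboolP//]|Qv].
rewrite asboolT//=; have [h1 h2] := Qn v Qv; case: v {Qv} h1 h2 => i j /= h1 h2.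
by apply/allpairsP; exists (i, j); rewrite /= !lP.
Qed.

Lemma edges_enum : exists E : seq (bool * (int * int)), forall e, e \in E <-> edge_set e `<=` U.
Proof.
have h b : exists s : seq (int * int), forall v, v \in s <-> edge_set (b, v) `<=` U.
  apply: finite_enum => v vU; apply: mesh_bound; apply: vU; apply: edge_set_end.
  by rewrite /ends mem_head.
have [s1 h1] := h true; have [s2 h2] := h false.
exists (map (pair true) s1 ++ map (pair false) s2) => -[b v]; rewrite mem_cat; split.
  move=> /orP[] /mapP[u us [-> ->]]; [exact/h1|exact/h2].
by case: b => H; apply/orP; [left|right]; apply/mapP; exists v => //; [apply/h1|apply/h2].
Qed.

Lemma faces_enum : exists S : seq (int * int), forall f, f \in S <-> face_set f `<=` U.
Proof.
apply: finite_enum => v vU; apply: mesh_bound; apply: vU; apply: face_set_corner.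
exact: mem_head.
Qed.

Section Complement.
Variable E : seq (bool * (int * int)).
Hypothesis EP : forall e, e \in E <-> edge_set e `<=` U.

Lemma dconn_edge e z : edge_set e z -> ~ U z -> dconn E (sides e).1 (sides e).2.
Proof. by move=> ez nU; apply: dconn_cross; apply/negP => /EP/(_ _ ez). Qed.

(** From [f] to [g] by at most one horizontal and then one vertical move, through the face
    [(i', j)]; each edge crossed contains [z] and so is not in [U]. *)
Lemma dconn_common f g z : ~ U z -> face_set f z -> face_set g z -> dconn E f g.
Proof.
move=> nU; case: f => i j; case: g => i' j' [/= f1 f2 f3 f4] [/= g1 g2 g3 g4].
have adj0 (a b : int) (r : R) : delta * a%:~R <= r -> r <= delta * (a + 1)%:~R ->
    delta * b%:~R <= r -> r <= delta * (b + 1)%:~R -> [\/ b = a, b = a + 1 /\ r = delta * (a + 1)%:~R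
     | a = b + 1 /\ r = delta * (b + 1)%:~R].
  move=> a1 a2 b1 b2.
  have : delta * a%:~R <= delta * (b + 1)%:~R by lra.
  have : delta * b%:~R <= delta * (a + 1)%:~R by lra.
  rewrite !ler_mesh => h1 h2.
  have [h|[h|h]] : b = a \/ b = a + 1 \/ a = b + 1 by clear -h1 h2; lia.
  - by constructor 1.
  - by constructor 2; split=> //; apply/eqP; rewrite eq_le a2 -h b1.
  - by constructor 3; split=> //; apply/eqP; rewrite eq_le b2 -h a1.
apply: (@dconn_trans _ _ (i', j)).
  have H (k : int) : complex.Re z = delta * (k + 1)%:~R -> dconn E (k, j) (k + 1, j).
    move=> zk; have := @dconn_edge (false, (k + 1, j)) z; rewrite /sides /= addrK; apply=> //.
    by split; rewrite /= ?zk.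
  have [->|[-> h]|[-> h]] := adj0 _ _ _ f1 f2 g1 g2.
  - exact: dconn_refl.
  - exact: H.
  - exact/dconn_sym/H.
have H (k : int) : complex.Im z = delta * (k + 1)%:~R -> dconn E (i', k) (i', k + 1).
  move=> zk; have := @dconn_edge (true, (i', k + 1)) z; rewrite /sides /= addrK; apply=> //.
  by split; rewrite /= ?zk.
have [->|[-> h]|[-> h]] := adj0 _ _ _ f3 f4 g3 g4.
- exact: dconn_refl.
- exact: H.
- exact/dconn_sym/H.
Qed.

Lemma dconn_line (F : int -> int * int) : (forall k, dconn E (F k) (F (k + 1))) ->
  forall j j', dconn E (F j) (F j').
Proof.
move=> H; have up j (m : nat) : dconn E (F j) (F (j + m%:Z)).
  elim: m => [|m IH]; first by rewrite addr0; exact: dconn_refl.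
  by apply: dconn_trans IH _; have := H (j + m%:Z); rewrite -addrA -[m%:Z + 1]/((m + 1)%:Z) addn1.
move=> j j'; have [h|h] := leP j j'.
  by have := up j (absz (j' - j)%R); rewrite gez0_abs ?subr_ge0// addrC subrK.
by apply: dconn_sym; have := up j' (absz (j - j')%R); rewrite gez0_abs ?subr_ge0 1?ltW// addrC subrK.
Qed.

(** An edge that starts at a vertex with a coordinate of size at least [n] is not contained in [U],
    so far rows and columns can be followed freely. *)
Lemma dconn_far f : n%:Z <= `|f.1| \/ n%:Z <= `|f.2| -> dconn E f (n%:Z, n%:Z).
Proof.
have far e : n%:Z <= `|e.2.1| \/ n%:Z <= `|e.2.2| -> dconn E (sides e).1 (sides e).2.
  move=> h; apply: (@dconn_edge e (mesh_pt e.2)).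
    by apply: edge_set_end; rewrite /ends mem_head.
  by move=> /mesh_bound; lia.
have col i : n%:Z <= `|i| -> forall j j', dconn E (i, j) (i, j').
  move=> ni; apply: (@dconn_line (fun k => (i, k))) => k.
  by have := far (true, (i, k + 1)); rewrite /sides /= addrK; apply; left.
have row j : n%:Z <= `|j| -> forall i i', dconn E (i, j) (i', j).
  move=> nj; apply: (@dconn_line (fun k => (k, j))) => k.
  by have := far (false, (k + 1, j)); rewrite /sides /= addrK; apply; right.
case: f => i j /= [h|h].
  by apply: dconn_trans (col i h j n%:Z) _; apply: row; lia.
by apply: dconn_trans (row j h i n%:Z) _; apply: col; lia.
Qed.

(** Connectedness of the complement in the sphere enters here: being dual connected to the far face
    is locally constant along the complement, since faces near a point also contain that point. *)
Lemma dconn_complement z f : ~ U z -> face_set f z -> dconn E f (n%:Z, n%:Z).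
Proof.
move=> nU fz.
(* [True] is the right value at infinity, as all faces around distant points are covered by
   [dconn_far]. *)
pose T (s : sphere R) := if s is Some y then forall g, face_set g y -> dconn E g (n%:Z, n%:Z) else True.
suff : T (pt z) by exact.
have cz : (~` (@pt R @` U)) (pt z) by move=> [y Uy [yz]]; apply: nU; rewrite -yz.
have ci : (~` (@pt R @` U)) infty by move=> [].
apply: (connected_locconst (P := T) cU _ ci cz I) => -[y|] hy.
  have nUy : ~ U y by move=> Uy; apply: hy; exists y.
  have [eta [eta0 H]] := near_face y.
  apply/nbhs_ptP/nbhs_normcP; exists eta; split=> // w wy nw /=; split=> hT g gz.
    apply: dconn_trans (hT _ (face_ofP w)); apply: (dconn_common nUy gz).
    exact: (H _ _ wy (face_ofP w)).
  by apply: hT; exact: H gz.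
apply/nbhs_inftyP; split=> //; exists (`|delta * n%:R| + `|delta * n%:R| + 1); split.
  by rewrite ltr_wpDl// addr_ge0.
move=> w hw _; split=> // _ g [g1 g2 g3 g4]; apply: dconn_far.
have := le_trans hw (normc_le_ReIm w).
have d0 : 0 <= delta * n%:R by rewrite mulr_ge0// ltW.
rewrite (ger0_norm d0) => hw'.
have key (r : R) i : delta * n%:R < `|r| -> delta * i%:~R <= r -> r <= delta * (i + 1)%:~R ->
    n%:Z <= `|i|.
  rewrite -[n%:R]/(n%:Z%:~R) => nr ir ri; have [r0|r0] := leP 0 r.
    have : delta * n%:Z%:~R < delta * (i + 1)%:~R by move: nr; rewrite ger0_norm//; lra.
    by rewrite ltr_pM2l// ltr_int; clear; lia.
  have : delta * i%:~R < delta * (- n%:Z)%:~R.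
    by rewrite intrN mulrN; move: nr; rewrite ltr0_norm//; lra.
  by rewrite ltr_pM2l// ltr_int; clear; lia.
have [h|h] := ltP (delta * n%:R) `|complex.Re w|; first by left; exact: key h g1 g2.
by right; apply: key g3 g4; lra.
Qed.
End Complement.

Lemma grid_null : exists E : seq (bool * (int * int)), (forall e, e \in E <-> edge_set e `<=` U) /\
  forall v p, path (adj E) v p -> last v p = v -> walk_hom U mesh_pt v p [::].
Proof.
have [E EP] := edges_enum; have [S SP] := faces_enum; exists E; split=> //.
apply: (@null_complex (walk_hom U mesh_pt) _ _ _ E S _ _ (size S) E S) => //.
- exact: walk_hom_refl.
- exact: walk_hom_trans.
- exact: walk_hom_cat.
- move=> e v p q /EP eU /allP hp /allP hq; apply: (walk_hom_convex (@convex_rect _ _ _ _) eU).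
    by move=> u /hp; exact: edge_set_end.
  by move=> u /hq; exact: edge_set_end.
- move=> f v p q /SP fU /allP hp /allP hq; apply: (walk_hom_convex (@convex_rect _ _ _ _) fU).
    by move=> u /hp; exact: face_set_corner.
  by move=> u /hq; exact: face_set_corner.
- by move=> f /SP fU e /edge_sub_face ef; apply/EP; exact: subset_trans fU.
- have out f : f \notin S -> dconn E f (n%:Z, n%:Z).
    move=> fS; have [z [fz nUz]] : exists z, face_set f z /\ ~ U z.
      apply: contrapT => H; move/negP: fS; apply; apply/SP => z fz; apply: contrapT => nUz.
      by apply: H; exists z.
    exact: (dconn_complement EP nUz fz).
  by move=> f g /out fo /out go; apply: dconn_trans fo _; exact: dconn_sym.
Qed.
End Grid.

(** * Paths in open plane sets *)

Section PathMargin.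
Variables (R : realType) (U : set R[i]).
Local Notation C := R[i].
Implicit Types (x y z w : C) (c : R -> C) (a b s t : R).

Lemma connected_line : connected [set: R].
Proof. by apply/connected_intervalP. Qed.

Lemma path_margin x y c : open U -> upath U x y c ->
  exists e, 0 < e /\ forall t z, normc (z - c t) < e -> U z.
Proof.
move=> /open_normcP oU [cc Uc c0 c1].
pose P b := exists e, 0 < e /\ forall t z, 0 <= t -> t <= b -> normc (z - c t) < e -> U z.
suff [e [e0 eP]] : P 1.
  exists e; split=> // t z tz.
  have [h|h] := leP t 0; first by apply: (eP 0) => //; rewrite c0// -(c0 t h).
  have [h1|h1] := leP t 1; first by apply: (eP t) => //; exact: ltW.
  by apply: (eP 1) => //; rewrite c1// -(c1 t (ltW h1)).
have [e0 [e00 e0P]] := oU _ (Uc 0).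
have P0 : P 0.
  by exists e0; split=> // t z t0 t0'; have -> : t = 0; [lra|exact: e0P].
apply: (connected_locconst (P := P) connected_line _ I I P0) => b _.
have [r [r0 rP]] := oU _ (Uc b).
have r2 : 0 < r / 2 by rewrite divr_gt0.
have /nbhs_ballP[eta /= eta0 near] := (continuous_normcP c b).1 (cc b) _ r2.
have key a a' : P a -> `|a - b| < eta -> `|a' - b| < eta -> P a'.
  move=> [e [e1 eP]]; rewrite !ltr_norml => /andP[a1 a2] /andP[a3 a4].
  exists (Num.min e (r / 2)); split; first by rewrite lt_min e1.
  move=> t z t0 ta'; rewrite lt_min => /andP[z1 z2].
  have [ta|ta] := leP t a; first exact: eP z1.
  apply: rP; apply: le_lt_trans (normc_triangle z (c t) (c b)) _.
  have : normc (c t - c b) < r / 2.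
    by apply: near; rewrite /ball /= ltr_norml; apply/andP; split; lra.
  by lra.
exists eta => // s; rewrite /ball /= distrC => sb _; split=> H.
  by apply: (key s) => //; rewrite subrr normr0.
by apply: (key b) => //; rewrite subrr normr0.
Qed.

Lemma open_connected_upath x y : open U -> connected U -> U x -> U y -> exists c, upath U x y c.
Proof.
move=> /open_normcP oU cU Ux Uy.
apply: (connected_locconst (P := fun z => exists c, upath U x z c) cU _ Ux Uy).
  move=> z Uz; have [e [e0 eP]] := oU z Uz; apply/nbhs_normcP; exists e; split=> // w wz _.
  have sU (u v : C) : normc (u - z) < e -> normc (v - z) < e -> segm u v `<=` U.
    by move=> uz vz v' /(segm_disc uz vz)/eP.
  have zz : normc (z - z) < e by rewrite subrr Normc.normc0.
  split=> -[c pc].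
    by exists (concat w c (seg w z)); apply: cat_upath pc _; exact: seg_upath (sU _ _ _ _).
  by exists (concat z c (seg z w)); apply: cat_upath pc _; exact: seg_upath (sU _ _ _ _).
by exists (fun=> x); exact: upath_cst.
Qed.
End PathMargin.

(** * Replacing a loop by a closed lattice walk *)

Section Discretization.
Variables (R : realType) (U : set R[i]) (delta : R) (E : seq (bool * (int * int))) (x : R[i]) (c : R -> R[i]).
Local Notation C := R[i].
Local Notation mesh := (mesh_pt delta).
Local Notation round := (face_of delta).
Hypotheses (delta0 : 0 < delta) (EP : forall e, e \in E <-> edge_set delta e `<=` U)
  (Enull : forall v p, path (adj E) v p -> last v p = v -> walk_hom U mesh v p [::])
  (loop : upath U x x c) (margin : forall t z, normc (z - c t) < 8 * delta -> U z).
Implicit Types (y z w : C) (a b s t : R) (u v : int * int) (p q : seq (int * int)).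

(** Large enough for points within [delta] of [z] and their roundings, which move each coordinate by
    at most [delta]; its points are within [4 * delta], below the margin [8 * delta]. *)
Let box z : set C := rect (complex.Re z - 2 * delta) (complex.Re z + 2 * delta)
   (complex.Im z - 2 * delta) (complex.Im z + 2 * delta).

Lemma box_sub t : box (c t) `<=` U.
Proof.
move=> z [h1 h2 h3 h4]; apply: (margin (t := t)); apply: le_lt_trans (normc_le_ReIm _) _.
have re : `|complex.Re z - complex.Re (c t)| <= 2 * delta by rewrite ler_norml; apply/andP; split; lra.
have im : `|complex.Im z - complex.Im (c t)| <= 2 * delta by rewrite ler_norml; apply/andP; split; lra.
by rewrite !raddfB; apply: le_lt_trans (lerD re im) _; have := delta0; lra.
Qed.

Lemma box_near z y : normc (y - z) < delta -> box z y /\ box z (mesh (round y)).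
Proof.
move=> yz.
have := le_lt_trans (Re_le_normc _) yz; have := le_lt_trans (Im_le_normc _) yz.
rewrite !raddfB /= !ltr_norml => /andP[i1 i2] /andP[r1 r2].
have [] := face_ofP delta0 y; rewrite !mesh_intrD1 => h1 h2 h3 h4.
by have := delta0; split; split=> /=; lra.
Qed.

(** Moves monotonically, first horizontally and then vertically, so it never leaves the rectangle;
    the induction is on the lattice distance. *)
Lemma lattice_walk (k1 k2 k3 k4 : R) v (w : int * int) : let K := rect k1 k2 k3 k4 in K `<=` U ->
  K (mesh v) -> K (mesh w) -> exists p, [/\ path (adj E) v p, last v p = w &
    forall u, u \in v :: p -> K (mesh u)].
Proof.
move=> K KU; have [m] := ubnP (absz (w.1 - v.1)%R + absz (w.2 - v.2)%R).
elim: m v => // m IH v vm Kv Kw.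
have step v' e : joins e v v' -> (absz (w.1 - v'.1)%R + absz (w.2 - v'.2)%R < m)%N -> K (mesh v') ->
    exists p, [/\ path (adj E) v p, last v p = w & forall u, u \in v :: p -> K (mesh u)].
  move=> jv lt Kv'; have [p [vp lp pK]] := IH v' lt Kv' Kw.
  exists (v' :: p); split=> //.
    rewrite /= vp andbT; apply/hasP; exists e => //; apply/EP; apply: subset_trans KU.
    apply: (edge_sub_convex delta0 (@convex_rect _ _ _ _ _)).
      by move: jv; rewrite /joins => /orP[] /eqP ->.
    by move: jv; rewrite /joins => /orP[] /eqP ->.
  by move=> u; rewrite inE => /predU1P[->//|]; exact: pK.
have [h1 h2 h3 h4] := Kv; have [h5 h6 h7 h8] := Kw; rewrite /= in h1 h2 h3 h4 h5 h6 h7 h8.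
have le (i j : int) : (i <= j)%R -> delta * i%:~R <= delta * j%:~R by rewrite ler_mesh.
case: v w vm {Kv Kw IH} step h1 h2 h3 h4 h5 h6 h7 h8 => [i j] [i' j'] /= vm step h1 h2 h3 h4 h5 h6 h7 h8.
have [lt|lt|ei] := ltgtP i i'.
- apply: (step (i + 1, j) (true, (i, j))); first by rewrite /joins /ends /= eqxx.
    by move: vm lt; clear; rewrite /=; lia.
  have l1 := le i (i + 1) ltac:(clear; lia); have l2 := le (i + 1) i' ltac:(move: lt; clear; lia).
  by split; rewrite /=; lra.
- apply: (step (i - 1, j) (true, (i - 1, j))); first by rewrite /joins /ends /= subrK eqxx orbT.
    by move: vm lt; clear; rewrite /=; lia.
  have l1 := le (i - 1) i ltac:(clear; lia); have l2 := le i' (i - 1) ltac:(move: lt; clear; lia).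
  by split; rewrite /=; lra.
have [lt|lt|ej] := ltgtP j j'.
- apply: (step (i, j + 1) (false, (i, j))); first by rewrite /joins /ends /= eqxx.
    by move: vm lt; clear; rewrite /=; lia.
  have l1 := le j (j + 1) ltac:(clear; lia); have l2 := le (j + 1) j' ltac:(move: lt; clear; lia).
  by split; rewrite /=; lra.
- apply: (step (i, j - 1) (false, (i, j - 1))); first by rewrite /joins /ends /= subrK eqxx orbT.
    by move: vm lt; clear; rewrite /=; lia.
  have l1 := le (j - 1) j ltac:(clear; lia); have l2 := le j' (j - 1) ltac:(move: lt; clear; lia).
  by split; rewrite /=; lra.
exists [::]; split=> //; first by rewrite /= ei ej.
by move=> u; rewrite inE => /eqP->; split=> /=; lra.
Qed.

Let initial t := c \o (fun s => t * clamp s).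
Let arc a b := c \o (fun s => a + (b - a) * clamp s).
Let v0 := round x.
(* The lattice walk [p], closed up by two short segments, is homotopic to [c]
   on [0, t]. *)
Let tracks t p := [/\ path (adj E) v0 p, last v0 p = round (c t) &
  hom U x (c t) (initial t) (concat (mesh v0) (seg x (mesh v0))
    (concat (mesh (round (c t))) (polygon mesh v0 p) (seg (mesh (round (c t))) (c t))))].

Let cc : continuous c. Proof. by case: loop. Qed.
Let Uc t : U (c t). Proof. by case: loop. Qed.
Let c0 : c 0 = x. Proof. by case: loop => _ _ + _; apply. Qed.
Let c1 : c 1 = x. Proof. by case: loop => _ _ _; apply. Qed.

Let clamp_affine a b : continuous (fun s => a + b * clamp s).
Proof.
move=> s; apply: cvgD; first exact: cvg_cst.
by apply: cvgM; [exact: cvg_cst|exact: clamp_continuous].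
Qed.

Let initial_upath t : upath U x (c t) (initial t).
Proof.
have h : continuous (fun s => t * clamp s).
  by move=> s; apply: cvgM; [exact: cvg_cst|exact: clamp_continuous].
split.
- exact: (comp_continuous h cc).
- by move=> s; exact: Uc.
- by move=> s h0; rewrite /initial /= clamp_le0// mulr0.
- by move=> s h0; rewrite /initial /= clamp_ge1// mulr1.
Qed.

Let arc_upath a b : upath U (c a) (c b) (arc a b).
Proof.
split.
- have h : continuous (fun s => a + (b - a) * clamp s) := @clamp_affine a (b - a).
  exact: (comp_continuous h cc).
- by move=> s; exact: Uc.
- by move=> s h0; rewrite /arc /= clamp_le0// mulr0 addr0.
- by move=> s h0; rewrite /arc /= clamp_ge1// mulr1 addrC subrK.
Qed.

(** Both sides are [c] composed with a parameter change from 0 to [b]. This also holds for [b < a],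
    so tracking can be continued in both directions. *)
Let hom_initial_arc a b : hom U x (c b) (initial b) (concat (c a) (initial a) (arc a b)).
Proof.
have -> : concat (c a) (initial a) (arc a b) =
    c \o (fun s => a * clamp (2 * s) + (b - a) * clamp (2 * s - 1)).
  apply/funext => s; have [h|h] := leP s (1 / 2).
    rewrite (cat_first (initial a) (arc_upath a b) h) /initial /= [clamp (2 * s - 1)]clamp_le0.
      by rewrite mulr0 addr0.
    by lra.
  rewrite (cat_second (arc a b) (initial_upath a) (ltW h)) /arc /= [clamp (2 * s)]clamp_ge1.
    by rewrite mulr1.
  by lra.
rewrite -c0; apply: hom_reparam => //.
- by move=> s; apply: cvgM; [exact: cvg_cst|exact: clamp_continuous].
- have k1 : continuous (fun s : R => clamp (2 * s)).
    have -> : (fun s : R => clamp (2 * s)) = (fun s => clamp (2 * s + 0)) by apply/funext => s; rewrite addr0.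
    by move=> s; exact: (continuous_comp (@affine_continuous R 2 0 s) (@clamp_continuous R _)).
  have k2 : continuous (fun s : R => clamp (2 * s - 1)).
    by move=> s; exact: (continuous_comp (@affine_continuous R 2 (-1) s) (@clamp_continuous R _)).
  move=> s; apply: cvgD; apply: cvgM; [exact: cvg_cst|exact: k1|exact: cvg_cst|exact: k2].
- by move=> s h; rewrite !clamp_le0 ?mulr0 ?addr0//; lra.
- by move=> s h; rewrite !clamp_ge1 ?mulr1//; [rewrite addrC subrK|lra|lra].
Qed.

Let round_seg t : box (c t) (c t) /\ box (c t) (mesh (round (c t))).
Proof. by apply: box_near; rewrite subrr Normc.normc0. Qed.

Let box_convex z : convex (box z).
Proof. exact: convex_rect. Qed.

Let box_seg z y w : box z y -> box z w -> forall s, box z (seg y w s).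
Proof. by move=> zy zw s; apply: (convex_segm (@box_convex z) zy zw); exact: segm_seg. Qed.

Let seg_box t y w : box (c t) y -> box (c t) w -> upath U y w (seg y w).
Proof.
by move=> ty tw; apply: seg_upath; apply: subset_trans (@box_sub t); exact: convex_segm (@box_convex _) ty tw.
Qed.

Let path_good v p : U (mesh v) -> path (adj E) v p -> good U mesh v p.
Proof.
elim: p v => [//|u p IH] v Uv /= /andP[/hasP[e /EP eU vu] up].
have [ev eu] : edge_set delta e (mesh v) /\ edge_set delta e (mesh u).
  by move: vu; rewrite /joins => /orP[] /eqP h; split; apply: edge_set_end => //; rewrite h !inE eqxx ?orbT.
split; last by apply: IH => //; exact: eU.
by apply: subset_trans eU; exact: convex_segm (@convex_rect _ _ _ _ _) ev eu.
Qed.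

Let Uv0 : U (mesh v0).
Proof. by apply: (@box_sub 0); have [] := round_seg 0; rewrite /v0 -c0. Qed.

(** The new piece of [c] and the new piece [q] of the walk lie in one convex box in [U], so they are
    homotopic up to the connecting segments; the rest is reassociation. *)
Lemma tracks_step a b t0 p : (forall s, 0 <= s -> s <= 1 -> normc (c (a + (b - a) * s) - c t0) < delta) ->
  tracks a p -> exists q, tracks b q.
Proof.
move=> small [vp lp hp].
have Ka : box (c t0) (c a) /\ box (c t0) (mesh (round (c a))).
  by apply: box_near; have := small 0 (lexx _) ler01; rewrite mulr0 addr0.
have Kb : box (c t0) (c b) /\ box (c t0) (mesh (round (c b))).
  by apply: box_near; have := small 1 ler01 (lexx _); rewrite mulr1 [a + _]addrC subrK.
have [q [vq lq qK]] := lattice_walk (@box_sub t0) Ka.2 Kb.2.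
have vpq : path (adj E) v0 (p ++ q) by rewrite cat_path vp lp.
have lpq : last v0 (p ++ q) = round (c b) by rewrite last_cat lp.
exists (p ++ q); split=> //.
have gp := path_good Uv0 vp; have gpq := path_good Uv0 vpq.
have gq : good U mesh (round (c a)) q by have [_] := (good_cat U mesh v0 p q).1 gpq; rewrite lp.
have pp := polygon_upath gp; rewrite lp in pp.
have pq := polygon_upath gq; rewrite lq in pq.
have ppq := polygon_upath gpq; rewrite lpq in ppq.
have s0 : upath U x (mesh v0) (seg x (mesh v0)).
  by have [h1 h2] := round_seg 0; rewrite -/v0 c0 in h1 h2; apply: (@seg_box 0); rewrite c0.
have sa := @seg_box t0 _ _ Ka.2 Ka.1; have sb := @seg_box t0 _ _ Kb.2 Kb.1.
have pa := arc_upath a b.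
have Karc s : box (c t0) (arc a b s).
  by have [h1 h2] := clamp01 s; have [] := box_near (small _ h1 h2).
have Kq s : box (c t0) (polygon mesh (round (c a)) q s).
  by have [_] := convex_good (@box_convex _) (@box_sub t0) qK.
set ya := mesh (round (c a)) in Ka hp sa pp pq *; set yb := mesh (round (c b)) in Kb sb pq ppq *.
set sega := seg ya (c a) in sa *; set segb := seg yb (c b) in sb *.
set pol := polygon mesh v0 p in pp *; set polq := polygon mesh (round (c a)) q in pq Kq *.
have inner : hom U ya (c b) (concat (c a) sega (arc a b)) (concat yb polq segb).
  apply: (hom_convex (@box_convex (c t0)) (@box_sub t0)).
  - exact: cat_upath sa pa.
  - exact: cat_upath pq sb.
  - by apply: (cat_mem sa pa) => // s; exact: box_seg Ka.2 Ka.1 s.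
  - by apply: (cat_mem pq sb) => // s; exact: box_seg Kb.2 Kb.1 s.
have pm := cat_upath pp sa; have pn := cat_upath pq sb; have pr := cat_upath pp pq.
have step1 : hom U (mesh v0) (c b) (concat (c a) (concat ya pol sega) (arc a b)) (concat ya pol (concat yb polq segb)).
  apply: hom_trans (hom_assoc pp sa pa) _; first exact: cat_upath pp (cat_upath sa pa).
  by apply: hom_cat (hom_refl pp) _.
have step2 : hom U (mesh v0) (c b) (concat ya pol (concat yb polq segb)) (concat yb (polygon mesh v0 (p ++ q)) segb).
  apply: hom_trans (hom_sym (hom_assoc pp pq sb)) _; first exact: cat_upath pr sb.
  apply: hom_cat (hom_refl sb).
  by have := polygon_cat gpq; rewrite lp lpq => h; exact: hom_sym.
apply: hom_trans (hom_initial_arc a b) _; first exact: cat_upath (initial_upath a) pa.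
have pL := cat_upath s0 pm.
apply: hom_trans (hom_cat hp (hom_refl pa)) _; first exact: cat_upath pL pa.
apply: hom_trans (hom_assoc s0 pm pa) _; first exact: cat_upath s0 (cat_upath pm pa).
apply: hom_cat (hom_refl s0) _.
apply: hom_trans step1 step2; exact: cat_upath pp pn.
Qed.

Lemma tracks_start : exists p, tracks 0 p.
Proof.
exists [::]; split=> //=; first by rewrite c0.
have [h1 h2] := round_seg 0; rewrite c0 -/v0 in h1 h2 *.
have K0 := @box_convex x; have KU := @box_sub 0; rewrite c0 in KU.
have s0 : upath U x (mesh v0) (seg x (mesh v0)) by apply: (@seg_box 0); rewrite c0.
have s1 : upath U (mesh v0) x (seg (mesh v0) x) by apply: (@seg_box 0); rewrite c0.
have pc := upath_cst Uv0.
apply: (hom_convex K0 KU).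
- by have := initial_upath 0; rewrite c0.
- exact: cat_upath s0 (cat_upath pc s1).
- by move=> s; rewrite /initial /= mul0r c0.
- apply: (cat_mem s0 (cat_upath pc s1)) => [s|s]; first exact: box_seg.
  by apply: (cat_mem pc s1) => // s'; exact: box_seg.
Qed.

(** Having a tracking walk is locally constant in [t], so one exists at 1. There it is closed, hence
    contractible by [Enull], and only the segment from [x] to [mesh v0] and back remains, in a
    convex box. *)
Lemma loop_null : hom U x x c (fun=> x).
Proof.
have [p [vp lp hp]] : exists p, tracks 1 p.
  apply: (connected_locconst (P := fun t => exists p, tracks t p) (@connected_line R) _ I I tracks_start).
  move=> t _; have /nbhs_ballP[eta /= eta0 near] := (continuous_normcP c t).1 (@cc t) _ delta0.
  exists eta => // s; rewrite /ball /= => /ltr_normlP[h1 h2] _.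
  have small s' : `|t - s'| < eta -> normc (c s' - c t) < delta by move=> h; exact: near.
  split=> -[p].
    apply: (tracks_step (t0 := t)) => r r0 r1; apply: small; rewrite ltr_norml; apply/andP; split; nra.
  by apply: (tracks_step (t0 := t)) => r r0 r1; apply: small; rewrite ltr_norml; apply/andP; split; nra.
rewrite c1 -/v0 in lp hp.
have -> : c = initial 1.
  apply/funext => s; rewrite /initial /= mul1r; have [_ _ e0 e1] := loop.
  have [h|h] := leP s 0; first by rewrite clamp_le0// !e0.
  have [h1|h1] := leP s 1; first by rewrite clamp_id// ltW.
  by rewrite clamp_ge1 ?ltW// !e1// ltW.
have [h1 h2] := round_seg 0; rewrite c0 -/v0 in h1 h2.
have K0 := @box_convex x; have KU := @box_sub 0; rewrite c0 in KU.
have s0 : upath U x (mesh v0) (seg x (mesh v0)) by apply: (@seg_box 0); rewrite c0.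
have s1 : upath U (mesh v0) x (seg (mesh v0) x) by apply: (@seg_box 0); rewrite c0.
have gp := path_good Uv0 vp; have pp := polygon_upath gp; rewrite lp in pp.
have [_ /(_ gp)[_ hnull]] := Enull vp lp; rewrite lp /= in hnull.
have pc := upath_cst Uv0.
apply: hom_trans hp _; first exact: cat_upath s0 (cat_upath pp s1).
apply: (@hom_trans _ _ _ _ _ (concat (mesh v0) (seg x (mesh v0)) (seg (mesh v0) x))).
- exact: cat_upath s0 s1.
- apply: hom_cat (hom_refl s0) _.
  apply: hom_trans (hom_cat hnull (hom_refl s1)) (hom_cst_cat s1); exact: cat_upath pc s1.
- have Ux : U x by rewrite -c0.
  apply: (hom_convex K0 KU); [exact: cat_upath s0 s1|exact: upath_cst| |by []].
  by apply: (cat_mem s0 s1) => s; exact: box_seg.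
Qed.
End Discretization.

(** * Null-homotopic loops in the plane *)

Section PlaneLoops.
Variables (R : realType) (U : set R[i]).
Local Notation C := R[i].
Hypotheses (oU : open U) (cU : connected (~` (@pt R @` U))).

Lemma connected_infty_exterior (rho : R) : 0 < rho ->
  connected ([set infty] `|` @pt R @` [set z | rho <= normc z]).
Proof.
move=> rho0; rewrite setUC.
apply: (@connected_closure_union _ _ _ infty) => //.
- by apply: connected_pt; exact: connected_exterior.
- exact: connected1.
- move=> A /nbhs_inftyP[_ [r [r0 rA]]].
  exists (pt (Num.max rho r)%:C%C); split.
    by exists (Num.max rho r)%:C%C => //=; rewrite normc_real ger0_norm ?le_max ?lexx// ltW.
  by apply: rA; rewrite normc_real ger0_norm ?le_max ?lexx ?orbT// ltW.
Qed.

(** [U] may be unbounded, whereas the grid must be finite. Cutting [U] with a disc around the loop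
    adds to the complement a connected exterior containing infinity, so the complement stays
    connected. *)
Lemma plane_loop_null x c : upath U x x c -> hom U x x c (fun=> x).
Proof.
move=> pc; have [cc Uc c0 c1] := pc.
have [rho cr] : exists rho, forall t, normc (c t) < rho.
  have cK : compact (c @` `[0, 1]%classic).
    apply: continuous_compact; last exact: segment_compact.
    by apply: continuous_subspaceT; exact: cc.
  have [rho [_ rP]] := plane_compact_bounded cK; exists rho => t; apply: rP.
  have in01 s : 0 <= s -> s <= 1 -> (c @` `[0, 1]%classic) (c s).
    by move=> s0 s1; exists s => //=; rewrite in_itv /= s0.
  have [h|h] := leP t 0; first by rewrite c0// -(c0 0)//; exact: in01.
  have [h1|h1] := leP t 1; first by apply: in01 => //; exact: ltW.
  by rewrite c1 ?ltW// -(c1 1)//; exact: in01.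
have rho0 : 0 < rho := le_lt_trans (normc_ge0 _) (cr 0).
pose V := U `&` [set z : C | normc z < rho].
have oV : open V.
  by apply: openI => //; have := @open_disc R 0 rho; under eq_set do rewrite subr0.
have pcV : upath V x x c by split=> // t; split=> //; exact: cr.
have cV : connected (~` (@pt R @` V)).
  have -> : ~` (@pt R @` V) = ~` (@pt R @` U) `|` ([set infty] `|` @pt R @` [set z | rho <= normc z]).
    apply/seteqP; split=> [[z|] nV|[z|]].
    - have [Uz|nUz] := pselect (U z).
        right; right; exists z => //=; rewrite leNgt; apply/negP => zr.
        by apply: nV; exists z.
      by left=> -[y Uy [yz]]; apply: nUz; rewrite -yz.
    - by right; left.
    - move=> [nU|[//|[y yr [yz]]]] [w [Uw wr] [wz]]; first by apply: nU; exists w => //; rewrite wz.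
      by move: yr; rewrite /= yz -wz leNgt wr.
    - by move=> _ [].
  apply: connectedU => //; last exact: connected_infty_exterior.
  by exists infty; split; [move=> []|left].
have [e [e0 margin]] := path_margin oV pcV.
pose delta := e / 8.
have delta0 : 0 < delta by rewrite divr_gt0.
have bound : rho <= delta * (Num.trunc (rho / delta)).+1%:R.
  by rewrite mulrC -ler_pdivrMr// ltW// truncnS_gt.
have [E [EP Enull]] := grid_null delta0 (fun z Vz => proj2 Vz) cV bound.
have [|H [h1 h2 h3 h4]] := loop_null delta0 EP Enull pcV.
  have -> : 8 * delta = e by rewrite /delta; field.
  exact: margin.
by exists H; split=> // p; have [] := h2 p.
Qed.
End PlaneLoops.

(** * Simply connected open sets of the sphere *)

Section SphereLoops.
Variable R : realType.
Local Notation C := R[i].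
Local Notation S := (sphere R).
Implicit Types (z w a : C) (e r s t : R).

Definition plane_coord (z : S) : C := if z is Some w then w else 0.

(** Passes from paths on the unit interval, as in [path_in], to the globally defined paths of
    [upath]. *)
Lemma clamp_within (T : topologicalType) (c : R -> T) :
  {within `[0, 1], continuous c} -> continuous (c \o @clamp R).
Proof.
move=> /subspace_continuousP cc t W nW.
have t01 : `[0, 1]%classic (clamp t) by have [h1 h2] := clamp01 t; rewrite /= in_itv /= h1 h2.
have near_t : \forall s \near t, `[0, 1]%classic (clamp s) -> W (c (clamp s)).
  exact: (@clamp_continuous R t _ (cc _ t01 W nW)).
apply: filterS near_t => s; apply.
by have [h1 h2] := clamp01 s; rewrite /= in_itv /= h1 h2.
Qed.

Lemma path_plane (U : set S) x y (c : R -> S) : ~ U infty -> path_in U (pt x) (pt y) c ->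
  upath (@pt R @^-1` U) x y (plane_coord \o c \o @clamp R).
Proof.
move=> nU [cc Uc c0 c1].
have U01 t : U (c (clamp t)).
  by have [h1 h2] := clamp01 t; apply: Uc; rewrite in_itv /= h1 h2.
have ptE t : pt (plane_coord (c (clamp t))) = c (clamp t) by have := U01 t; case: (c _).
split.
- move=> t W nW.
  have nW' : nbhs (c (clamp t)) (@pt R @` W).
    by rewrite -ptE; apply/nbhs_ptP; apply: filterS nW => z Wz; exists z.
  have near_t : \forall s \near t, (@pt R @` W) (c (clamp s)) := @clamp_within _ c cc t _ nW'.
  by apply: filterS near_t => s [z Wz] zE; rewrite /= -zE.
- by move=> t /=; rewrite ptE.
- by move=> t h /=; rewrite clamp_le0// c0.
- by move=> t h /=; rewrite clamp_ge1// c1.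
Qed.

Lemma simply_connected_plane (U : set S) : open U -> connected U -> connected (~` U) -> ~ U infty ->
  simply_connected R U.
Proof.
move=> oU cU cnU nU.
pose V : set C := @pt R @^-1` U.
have oV : open V := open_preimage_pt oU.
have VE : @pt R @` V = U := image_preimage_pt nU.
have cV : connected V := connected_preimage_pt cU nU.
have lift (T : topologicalType) (A : set T) (f : T -> C) : continuous f -> {within A, continuous (fun u => pt (f u))}.
  by move=> cf; apply: continuous_subspaceT => u; exact: (continuous_comp (cf u) (@pt_continuous R (f u))).
split.
  move=> [x|//] [y|//] Ux Uy; have [c [cc Vc c0 c1]] := open_connected_upath oV cV Ux Uy.
  exists (fun t => pt (c t)); split.
  - exact: lift.
  - by move=> t _; exact: Vc.
  - by rewrite c0.
  - by rewrite c1.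
move=> x c pc.
have Ux : U x by have [_ Uc c0 _] := pc; rewrite -c0; apply: Uc; rewrite in_itv /= lexx ler01.
case: x Ux pc => [x|//] Ux pc.
have pV := path_plane nU pc.
have [|H [cH VH Hs Ht]] := plane_loop_null oV _ pV; first by rewrite VE.
exists (fun p => pt (H p)); split.
- exact: lift.
- by move=> s t _ _; exact: VH.
- move=> t; rewrite in_itv /= => /andP[t0 t1]; rewrite (Hs 0 t).1// (Hs 1 t).2//; split=> //.
  rewrite /= clamp_id//; have [_ Uc _ _] := pc.
  by have := Uc t; rewrite in_itv /= t0 t1 => /(_ isT); case: (c t).
- by move=> s _; rewrite (Ht s 0).1// (Ht s 1).2.
Qed.

Lemma simply_connected_homeo (U : set S) (phi psi : S -> S) : continuous phi -> continuous psi ->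
  (forall z : S, psi (phi z) = z) -> simply_connected R (psi @^-1` U) -> simply_connected R U.
Proof.
move=> cphi cpsi K [pV lV].
have path_phi x y c : path_in U x y c -> path_in (psi @^-1` U) (phi x) (phi y) (phi \o c).
  move=> [cc Uc c0 c1]; split; rewrite /= ?c0 ?c1//; last by move=> t /Uc; rewrite /= K.
  exact: comp_continuous cc cphi.
split=> [x y Ux Uy|x c /path_phi/lV[H [cH UH Hs Ht]]].
  have [||c [cc Vc c0 c1]] := pV (phi x) (phi y); rewrite /= ?K//.
  exists (psi \o c); split; rewrite /= ?c0 ?c1 ?K//.
  exact: comp_continuous cc cpsi.
exists (psi \o H); split=> //.
- exact: comp_continuous cH cpsi.
- by move=> t /Hs /= [-> ->]; rewrite !K.
- by move=> s /Ht /= [-> ->]; rewrite !K.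
Qed.

Definition inversion (z : S) : S :=
  if z is Some w then if w == 0 then infty else pt w^-1 else pt 0.

Lemma inversionK (z : S) : inversion (inversion z) = z.
Proof.
case: z => [w|] /=; last by rewrite eqxx.
by have [->|w0] := eqVneq w 0; rewrite //= invr_eq0 (negbTE w0) invrK.
Qed.

Lemma inversion_continuous : continuous inversion.
Proof.
move=> [w|]; last first.
  move=> W /nbhs_ptP/nbhs_normcP[e [e0 eW]]; apply/nbhs_inftyP; split.
    by apply: eW; rewrite subrr Normc.normc0.
  exists (2 / e); split=> [|z ez]; first by rewrite divr_gt0.
  have nz : 0 < normc z by apply: lt_le_trans ez; rewrite divr_gt0.
  have z0 : z != 0 by rewrite -normc_gt0.
  rewrite /= (negbTE z0); apply: eW; rewrite subr0 normcV0 invf_plt ?posrE//.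
  by apply: lt_le_trans ez; rewrite -[ltLHS]mul1r ltr_pM2r ?invr_gt0// ltr1n.
have [->|w0] := eqVneq w 0.
  move=> W; rewrite {1}/inversion eqxx => /nbhs_inftyP[Wi [r [r0 rW]]].
  apply/nbhs_ptP/nbhs_normcP; exists r^-1; split=> [|y]; first by rewrite invr_gt0.
  rewrite subr0 /= => yr; case: eqVneq => [//|y0]; apply: rW.
  by rewrite normcV0 -[leLHS]invrK lef_pV2 ?posrE ?invr_gt0 ?normc_gt0// ltW.
move=> W; rewrite {1}/inversion (negbTE w0) => /nbhs_ptP/nbhs_normcP[e [e0 eW]].
have nw : 0 < normc w by rewrite normc_gt0.
apply/nbhs_ptP/nbhs_normcP; exists (Num.min (normc w / 2) (e * normc w ^+ 2 / 2)); split.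
  by rewrite lt_min !divr_gt0// mulr_gt0// exprn_gt0.
move=> y; rewrite lt_min => /andP[y1 y2].
have ny : normc w / 2 < normc y.
  by have := normc_lerB w y; rewrite (normc_dist w y); lra.
have y0 : y != 0 by rewrite -normc_gt0; apply: lt_trans ny; rewrite divr_gt0.
rewrite /= (negbTE y0); apply: eW.
have -> : y^-1 - w^-1 = - (y - w) * (y^-1 * w^-1) by field; rewrite y0 w0.
rewrite !Normc.normcM !normcV0 normcN -invfM ltr_pdivrMr; last by rewrite mulr_gt0// normc_gt0.
apply: lt_le_trans y2 _; rewrite -mulrA ler_pM2l// expr2.
by rewrite mulrAC ler_pM2r// ltW.
Qed.

Lemma simply_connected_sphere (U : set S) : open U -> connected U -> connected (~` U) ->
  (~` U) !=set0 -> simply_connected R U.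
Proof.
move=> oU cU cnU [z0 nz0].
have [Ui|nUi] := pselect (U infty); last exact: simply_connected_plane.
case: z0 nz0 => [a|//] na.
(* Translations of the sphere: [a], a point outside [U], is moved to 0 and then inverted to
   infinity. *)
pose tr (b : C) : S -> S := polymap ('X + b%:P).
have trK b (z : S) : tr (- b) (tr b z) = z.
  by case: z => [z|//]; rewrite /tr /polymap /= !hornerE addrK.
have ctr b : continuous (tr b) by apply: polymap_continuous; rewrite size_XaddC.
have cphi : continuous (inversion \o tr (- a)).
  exact: comp_continuous (@ctr (- a)) inversion_continuous.
have cpsi : continuous (tr a \o inversion).
  exact: comp_continuous inversion_continuous (@ctr a).
have K1 (z : S) : (tr a \o inversion) ((inversion \o tr (- a)) z) = z.
  by rewrite /= inversionK -{1}[a]opprK trK.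
have K2 (z : S) : (inversion \o tr (- a)) ((tr a \o inversion) z) = z by rewrite /= trK inversionK.
have pre (A : set S) : (tr a \o inversion) @^-1` A = (inversion \o tr (- a)) @` A.
  apply/seteqP; split=> [z Az|_ [z Az <-]]; first by exists ((tr a \o inversion) z) => //; exact: K2.
  by rewrite /preimage /mkset K1.
apply: (simply_connected_homeo cphi cpsi K1); apply: simply_connected_plane.
- by apply: open_comp => // z _; exact: cpsi.
- by rewrite pre; exact: connected_image.
- by rewrite preimage_setC pre; exact: connected_image.
- by rewrite /= /tr /polymap /= !hornerE ?add0r.
Qed.
End SphereLoops.

Theorem theorem2p7 (R : realType) (G : set {poly R[i]}) (hG : class_G G) :
  [/\ (forall J, planar_components G J -> surround_le J J),
      (forall J1 J2, planar_components G J1 -> planar_components G J2 ->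
         surround_le J1 J2 -> surround_le J2 J1 -> J1 = J2),
      (forall J1 J2 J3, planar_components G J1 -> planar_components G J2 ->
         planar_components G J3 ->
         surround_le J1 J2 -> surround_le J2 J3 -> surround_le J1 J3)
    & (forall J1 J2, planar_components G J1 -> planar_components G J2 ->
         surround_le J1 J2 \/ surround_le J2 J1)] /\
  (forall U, components (Fatou G) U ->
     simply_connected R U \/ doubly_connected U) /\
  (forall g, G g ->
     [/\ (forall J, components (Julia G) J ->
            connected (polymap g @^-1` J) /\
            exists! J', is_pullback G g J J'),
         (forall J, planar_components G J ->
            planar_components G (pullback G g J))
       & (forall J1 J2, planar_components G J1 -> planar_components G J2 ->
            surround_le J1 J2 ->
            surround_le (polymap g @^-1` J1) (polymap g @^-1` J2) /\
            surround_le (pullback G g J1) (pullback G g J2))]).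
Proof.
have plane J (pJ : planar_components G J) := planar_component_plane pJ.
have leP J K (pJ : planar_components G J) := surround_leP K (proj2 pJ).
split; last split.
- split.
  + by move=> J _; left.
  + move=> J K pJ pK /(leP _ _ pJ)[//|iJK] /(leP _ _ pK)[//|iKJ].
    have [cJ _ J0 _] := plane J pJ; have [cK _ K0 _] := plane K pK.
    by case: (inside_asym cJ cK J0 K0 iJK iKJ).
  + move=> J1 J2 J3 p1 p2 p3 le12 le23.
    have [e12|n12] := pselect (J1 = J2); first by rewrite e12.
    have [e23|n23] := pselect (J2 = J3); first by rewrite -e23.
    move: le12 le23 => /(leP _ _ p1)[//|i12] /(leP _ _ p2)[//|i23].
    apply/(leP _ _ p1); right.
    have [c2 cn2 J20 _] := plane J2 p2; have [c3 cn3 J30 _] := plane J3 p3.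
    exact: (inside_trans c2 c3 J20 J30 cn2 cn3 (planar_disjoint p2 p3 n23) i12 i23).
  + move=> J K pJ pK; have [->|JK] := pselect (J = K); first by left; left.
    by have [i|i] := planar_total hG pJ pK JK; [left|right]; apply/leP => //; right.
- move=> U cU; have [_ cnU _ _] := components_prop cU.
  have [[cC C0]|dc] := Fatou_component_cases hG cU; last by right.
  by left; apply: simply_connected_sphere => //; exact: (Fatou_component_open cU).
- move=> g Gg; split.
  + by move=> J cJ; split; [exact: (preimage_component_connected hG Gg)|exact: (exists_pullback hG Gg)].
  + by move=> J; exact: (planar_pullback hG Gg).
  + move=> J K pJ pK /(leP _ _ pJ)[->|iJK]; first by split; left.
    split.
      apply/surround_leP; first exact: (proj2 pJ).
      by right; exact: (inside_preimage hG Gg).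
    apply/(leP _ _ (planar_pullback hG Gg pJ)).
    by have [->|i] := pullback_monotone hG Gg pJ pK iJK; [left|right].
Qed.
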